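(* Let $\phi_0\in\mathbb{R}$ and $\alpha_0>0$, and let $y_t$ be generated by the model $$y_t=\phi_0 y_{t-1}+\eta_t\sqrt{\alpha_0 y_{t-1}^2},\qquad t\ge 1,$$ where $\{\eta_t\}$ is a sequence of i.i.d. random variables and $\eta_t$ is independent of $\{y_j: j<t\}$. Let $\theta_0=(\phi_0,\alpha_0)^{T}$ and let $\widehat{\theta}_n=(\widehat{\phi}_n,\widehat{\alpha}_n)^{T}$ be the quasi-maximum likelihood estimator of $\theta_0$, which has the explicit expression $$\widehat{\phi}_n=\frac{1}{n}\sum_{t=1}^n\frac{y_t}{y_{t-1}},\qquad \widehat{\alpha}_n=\frac{1}{n}\sum_{t=1}^n\frac{(y_t-\widehat{\phi}_n y_{t-1})^2}{y_{t-1}^2}.$$ Suppose that $E\eta_t=0$ and $E\eta_t^2=1$. Then: (i) $\widehat{\phi}_n$ is unbiased, but $\widehat{\alpha}_n$ is asymptotically unbiased; (ii) $\widehat{\theta}_n\to\theta_0$ almost surely as $n\to\infty$; (iii) furthermore, if $E\eta_t^3=0$ and $\kappa_4=E\eta_t^4<\infty$, then $$\sqrt{n}(\widehat{\theta}_n-\theta_0)\Longrightarrow N(0,\Sigma)\qquad\text{as } n\to\infty,$$ where $\Sigma=\mathrm{diag}\big(\alpha_0,(\kappa_4-1)\alpha_0^2\big)$.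
   Context: ''$\Longrightarrow$'' denotes weak convergence (convergence in distribution). The quasi-maximum likelihood estimator is $\widehat{\theta}_n=\arg\max_{\theta\in\Theta}L_n(\theta)$ over the parameter space $\Theta=\mathbb{R}\times(0,\infty)$, $\theta=(\phi,\alpha)^{T}$, where $L_n(\theta)=\sum_{t=1}^n\ell_t(\theta)$ with $\ell_t(\theta)=-\frac12\big\{\log(\alpha y_{t-1}^2)+\frac{(y_t-\phi y_{t-1})^2}{\alpha y_{t-1}^2}\big\}$ is the Gaussian log-likelihood (up to a constant); the explicit expression in the claim is obtained by setting $\partial L_n(\theta)/\partial\theta=0$. *)

(* Defs.v *)
From HB Require Import structures.
From mathcomp Require Import all_boot all_order all_algebra.
From mathcomp Require Import all_classical all_reals all_analysis.

Set Implicit Arguments.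
Unset Strict Implicit.
Unset Printing Implicit Defensive.

Import Order.TTheory GRing.Theory Num.Theory.
Import numFieldNormedType.Exports.

Local Open Scope classical_set_scope.
Local Open Scope ring_scope.

Definition mutually_independent (d : measure_display) (T : measurableType d)
    (R : realType) (P : probability T R) (X : nat -> T -> R) : Prop :=
  forall (J : seq nat) (B : nat -> set R), uniq J ->
    (forall i, measurable (B i)) ->
    P (\big[setI/setT]_(i <- J) (X i @^-1` B i)) =
    (\prod_(i <- J) P (X i @^-1` B i))%E.

Definition identically_distributed (d : measure_display)
    (T : measurableType d) (R : realType) (P : probability T R)
    (X : nat -> T -> R) : Prop :=
  forall (s t : nat) (B : set R), measurable B ->
    P (X s @^-1` B) = P (X t @^-1` B).

Definition iid (d : measure_display) (T : measurableType d) (R : realType)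
    (P : probability T R) (X : nat -> T -> R) : Prop :=
  mutually_independent P X /\ identically_distributed P X.

(* The sigma-algebra generated by Y_0, ..., Y_{t-1}. *)
Definition sigma_before (d : measure_display) (T : measurableType d)
    (R : realType) (Y : nat -> T -> R) (t : nat) : set (set T) :=
  <<s \bigcup_(j in [set j | (j < t)%N])
        preimage_set_system setT (Y j) measurable >>.

Definition independent_of_past (d : measure_display) (T : measurableType d)
    (R : realType) (P : probability T R) (X : T -> R) (Y : nat -> T -> R)
    (t : nat) : Prop :=
  forall (B : set R) (E : set T), measurable B -> sigma_before Y t E ->
    P (X @^-1` B `&` E) = (P (X @^-1` B) * P E)%E.

(* theta = (phi, alpha) *)

Definition Theta (R : realType) : set (R * R) := [set th | 0 < th.2].

Definition loglik1 (R : realType) (y : nat -> R) (t : nat) (th : R * R) : R :=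
  - 2^-1 * (ln (th.2 * y t.-1 ^+ 2) +
            (y t - th.1 * y t.-1) ^+ 2 / (th.2 * y t.-1 ^+ 2)).

Definition loglik (R : realType) (y : nat -> R) (n : nat) (th : R * R) : R :=
  \sum_(1 <= t < n.+1) loglik1 y t th.

Definition is_qmle (R : realType) (y : nat -> R) (n : nat) (th : R * R) :
    Prop :=
  Theta th /\ forall th' : R * R, Theta th' -> loglik y n th' <= loglik y n th.

Definition phi_hat (R : realType) (y : nat -> R) (n : nat) : R :=
  n%:R^-1 * \sum_(1 <= t < n.+1) y t / y t.-1.

Definition alpha_hat (R : realType) (y : nat -> R) (n : nat) : R :=
  n%:R^-1 *
  \sum_(1 <= t < n.+1) (y t - phi_hat y n * y t.-1) ^+ 2 / y t.-1 ^+ 2.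

Definition theta_hat (R : realType) (y : nat -> R) (n : nat) : R * R :=
  (phi_hat y n, alpha_hat y n).

(* An expectation equal to a finite value forces integrability, because
   +oo - +oo = -oo in the extended reals used here. *)

Definition unbiased (d : measure_display) (T : measurableType d)
    (R : realType) (P : probability T R) (est : nat -> T -> R) (a : R) : Prop :=
  forall n : nat, (0 < n)%N -> ('E_P[est n] = a%:E)%E.

Definition asymptotically_unbiased (d : measure_display)
    (T : measurableType d) (R : realType) (P : probability T R)
    (est : nat -> T -> R) (a : R) : Prop :=
  ('E_P[est n])%E @[n --> \oo] --> a%:E.

Definition affine2 (R : realType) (m : R * R) (A : 'M[R]_2) (z : R * R) :
    R * R :=
  (m.1 + (A 0 0 * z.1 + A 0 1 * z.2), m.2 + (A 1 0 * z.1 + A 1 1 * z.2)).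

(* N(m, Sigma) is the law of m + A Z, with Z standard normal in the plane and
   A A^T = Sigma; the law does not depend on the choice of A, and a singular
   Sigma is allowed. *)
Definition is_normal2 (R : realType) (nu : probability (R * R)%type R)
    (m : R * R) (Sigma : 'M[R]_2) : Prop :=
  exists2 A : 'M[R]_2, A *m A^T = Sigma &
    forall B : set (R * R), measurable B ->
      nu B = (normal_prob 0 1 \x normal_prob 0 1)%E (affine2 m A @^-1` B).

Definition cvg_in_law (d : measure_display) (T : measurableType d)
    (R : realType) (P : probability T R) (X : nat -> T -> R * R)
    (nu : probability (R * R)%type R) : Prop :=
  forall f : R * R -> R, continuous f ->
    (exists M : R, forall x, `|f x| <= M) ->
    ('E_P[(f \o X n)%FUN])%E @[n --> \oo] --> (\int[nu]_x (f x)%:E)%E.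

(* Main.v *)
Require Import Defs.
From HB Require Import structures.
From mathcomp Require Import all_boot all_order all_algebra.
From mathcomp Require Import all_classical all_reals all_analysis.
From mathcomp Require Import measurable_realfun ring lra.

Set Implicit Arguments.
Unset Strict Implicit.
Unset Printing Implicit Defensive.

Import Order.TTheory GRing.Theory Num.Theory.
Import numFieldNormedType.Exports.

Local Open Scope classical_set_scope.
Local Open Scope ring_scope.

(** The residual ratios of the model are, almost surely,
    y_t / y_{t-1} = phi0 + sqrt alpha0 * e_t, where e_t = eta_t * sgn y_{t-1}.
    Dividing by y_{t-1} thus turns the recursion into a signed noise: the sign
    belongs to the past, the innovation eta_t is independent of the past, and
    e_t ^ 2 = eta_t ^ 2 is again an i.i.d. sequence.  In these terms phi_hat - phi0
    is sqrt alpha0 times the mean of e_1, ..., e_n, and alpha_hat is alpha0 times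
    the difference between the mean of the e_t ^ 2 and the square of the mean of
    the e_t.

    The likelihood depends on theta only through
    ln alpha + (alpha_hat + (phi - phi_hat) ^ 2) / alpha, by Steiner's identity,
    and the strict inequality ln x < x - 1 for x <> 1 locates its minimum
    ([qmle_explicit]).

    The e_t are centred and orthogonal with variance 1.  This gives the
    unbiasedness of phi_hat and E alpha_hat = alpha0 (1 - 1 / n).

    For strong consistency, the means of eta_t ^ 2 converge by Etemadi's law of
    large numbers ([etemadi_slln]).  The e_t need not be identically
    distributed, as the law of the sign may vary, but the means of |e_t| = |eta_t| converge
    by the same theorem; orthogonality gives convergence of the means of e_t along
    geometric subsequences, and the monotone sums of e_t + |e_t| allow one to fill
    the gaps ([orthogonal_slln]).

    For asymptotic normality, conditioning one innovation at a time
    ([one_step]) multiplies the expectation of cos (c + u S_n + v Q_n) by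
    exp (- q / (2 n)) up to o (1 / n), where S_n and Q_n are the normalized sums
    of the e_t and of the e_t ^ 2 - 1.  The variance
    q = u ^ 2 + v ^ 2 (kappa4 - 1) is the same for both signs because the third
    moment vanishes, so that the product telescopes ([martingale_cf]).  The limit
    is the characteristic function of the normal law, which solves G' = - u G by
    Stein's identity ([normal_cf]).  Convergence of these cosines, with phases,
    implies convergence in law: a bounded continuous function is within
    epsilon (1 + |x| + |y|) of a trigonometric polynomial, and first moments stay
    bounded ([cf_cvg_in_law]).  The term sqrt n times the squared mean of the e_t
    has expectation 1 / sqrt n and disappears in the limit. *)

(** * Expectations of real random variables *)

Definition L1 (d : measure_display) (T : measurableType d) (R : realType)
  (P : probability T R) (X : T -> R) := P.-integrable setT (EFin \o X).

Definition Ex (d : measure_display) (T : measurableType d) (R : realType)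
  (P : probability T R) (X : T -> R) : R := \int[P]_w X w.

Section expectation_toolbox.
Context (d : measure_display) (T : measurableType d) (R : realType).
Variable P : probability T R.
Implicit Types X Y Z : T -> R.

Lemma L1_measurable X : L1 P X -> measurable_fun setT X.
Proof. by move=> /measurable_int /measurable_EFinP. Qed.

Lemma ExE X : L1 P X -> (Ex P X)%:E = (\int[P]_w (X w)%:E)%E.
Proof. by move=> iX; rewrite fineK//; exact: integrable_fin_num. Qed.

Lemma expectationE X : L1 P X -> ('E_P[X] = (Ex P X)%:E)%E.
Proof. by move=> iX; rewrite ExE// unlock. Qed.

Lemma L1_cst c : L1 P (cst c).
Proof. exact: finite_measure_integrable_cst. Qed.

Lemma Ex_cst c : Ex P (fun=> c) = c.
Proof. rewrite /Ex Rintegral_cst//. rewrite [X in fine X]probability_setT mulr1. by []. Qed.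

Lemma L1D X Y : L1 P X -> L1 P Y -> L1 P (fun w => X w + Y w).
Proof. by move=> iX iY; exact: (integrableD measurableT iX iY). Qed.

Lemma L1B X Y : L1 P X -> L1 P Y -> L1 P (fun w => X w - Y w).
Proof. by move=> iX iY; exact: (integrableB measurableT iX iY). Qed.

Lemma L1Z c X : L1 P X -> L1 P (fun w => c * X w).
Proof. by move=> iX; exact: (integrableZl measurableT c iX). Qed.

Lemma L1N X : L1 P X -> L1 P (fun w => - X w).
Proof. by move=> iX; exact: (integrableN iX). Qed.

Lemma L1_abs X : L1 P X -> L1 P (fun w => `|X w|).
Proof. by move=> iX; exact: (integrable_norm iX). Qed.

Lemma L1_sum (I : Type) (s : seq I) (X : I -> T -> R) :
  (forall i, L1 P (X i)) -> L1 P (fun w => \sum_(i <- s) X i w).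
Proof.
move=> iX; elim: s => [|i s IH].
  rewrite (_ : (fun=> _) = cst 0); first exact: L1_cst.
  by apply/funext => w; rewrite big_nil.
rewrite (_ : (fun=> _) = fun w => X i w + \sum_(j <- s) X j w).
  exact: L1D.
by apply/funext => w; rewrite big_cons.
Qed.

Lemma ExD X Y : L1 P X -> L1 P Y ->
  Ex P (fun w => X w + Y w) = Ex P X + Ex P Y.
Proof. by move=> iX iY; exact: RintegralD. Qed.

Lemma ExB X Y : L1 P X -> L1 P Y ->
  Ex P (fun w => X w - Y w) = Ex P X - Ex P Y.
Proof. by move=> iX iY; exact: RintegralB. Qed.

Lemma ExZ c X : L1 P X -> Ex P (fun w => c * X w) = c * Ex P X.
Proof. by move=> iX; exact: RintegralZl. Qed.

Lemma Ex_sum (I : Type) (s : seq I) (X : I -> T -> R) :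
  (forall i, L1 P (X i)) ->
  Ex P (fun w => \sum_(i <- s) X i w) = \sum_(i <- s) Ex P (X i).
Proof.
move=> iX; elim: s => [|i s IH].
  rewrite big_nil -[RHS](Ex_cst 0); apply: eq_Rintegral => w _.
  by rewrite big_nil.
rewrite big_cons -IH -ExD//; last exact: L1_sum.
by apply: eq_Rintegral => w _; rewrite big_cons.
Qed.

Lemma Ex_ge0 X : (forall w, 0 <= X w) -> 0 <= Ex P X.
Proof. by move=> X0; apply: Rintegral_ge0. Qed.

Lemma Ex_le X Y : L1 P X -> L1 P Y -> (forall w, X w <= Y w) ->
  Ex P X <= Ex P Y.
Proof. by move=> iX iY XY; apply: le_Rintegral. Qed.

Lemma Ex_abs X : L1 P X -> `|Ex P X| <= Ex P (fun w => `|X w|).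
Proof. by move=> iX; apply: le_normr_Rintegral. Qed.

Lemma L1_dom Y X : measurable_fun setT X -> L1 P Y ->
  (forall w, `|X w| <= Y w) -> L1 P X.
Proof.
move=> mX iY XY; apply: (le_integrable measurableT _ _ iY) => //; first exact/measurable_EFinP.
by move=> w _ /=; rewrite lee_fin (le_trans (XY w))// ler_norm.
Qed.

Lemma Ex_abs_le X Y : L1 P X -> L1 P Y -> (forall w, `|X w| <= Y w) ->
  `|Ex P X| <= Ex P Y.
Proof.
by move=> iX iY XY; rewrite (le_trans (Ex_abs iX))// Ex_le//; exact: L1_abs.
Qed.

Lemma L1_bounded c X : measurable_fun setT X -> (forall w, `|X w| <= c) ->
  L1 P X.
Proof. by move=> mX Xc; apply: (L1_dom mX (L1_cst c)). Qed.

Lemma L1_ae X Y : measurable_fun setT Y -> {ae P, forall w, X w = Y w} ->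
  L1 P X -> L1 P Y.
Proof.
move=> mY XY iX; apply/integrableP; split; first exact/measurable_EFinP.
move/integrableP : iX => [mX]; apply: le_lt_trans.
rewrite le_eqVlt; apply/orP; left; apply/eqP/ae_eq_integral => //.
- by apply: measurableT_comp => //; exact/measurable_EFinP.
- by apply: measurableT_comp => //; exact/measurable_EFinP.
- by apply: filterS XY => w XYw _; rewrite /= XYw.
Qed.

Lemma Ex_ae X Y : measurable_fun setT X -> measurable_fun setT Y ->
  {ae P, forall w, X w = Y w} -> Ex P X = Ex P Y.
Proof.
move=> mX mY XY; congr fine; apply: ae_eq_integral => //.
- exact/measurable_EFinP.
- exact/measurable_EFinP.
- by apply: filterS XY => w XYw _; rewrite /= XYw.
Qed.

Lemma L1_of_sqr X : measurable_fun setT X -> L1 P (fun w => X w ^+ 2) -> L1 P X.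
Proof.
move=> mX iX2; apply: (L1_dom mX (L1D (L1_cst 1) iX2)) => w /=.
rewrite -(real_normK (num_real (X w))).
by have := sqr_ge0 (`|X w| - 2^-1); nra.
Qed.

Lemma L1_mul_sqr X Y : measurable_fun setT X -> measurable_fun setT Y ->
  L1 P (fun w => X w ^+ 2) -> L1 P (fun w => Y w ^+ 2) ->
  L1 P (fun w => X w * Y w).
Proof.
move=> mX mY iX iY; apply: (L1_dom (measurable_funM mX mY) (L1D iX iY)) => w.
rewrite normrM -(real_normK (num_real (X w))) -(real_normK (num_real (Y w))).
have := sqr_ge0 (`|X w| - `|Y w|).
by have := normr_ge0 (X w); have := normr_ge0 (Y w); nra.
Qed.

Lemma dominated_Ex (X_ : nat -> T -> R) X Y :
  (forall n, measurable_fun setT (X_ n)) -> measurable_fun setT X ->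
  (forall w, X_ n w @[n --> \oo] --> X w) -> L1 P Y ->
  (forall n w, `|X_ n w| <= Y w) ->
  Ex P (X_ n) @[n --> \oo] --> Ex P X.
Proof.
move=> mX_ mX XX iY XY.
have [iX _] : [/\ P.-integrable setT (EFin \o X),
  [sequence (\int[P]_x `|(EFin \o X_ n) x - (EFin \o X) x|)%E]_n @ \oo --> 0%E &
  [sequence (\int[P]_x ((EFin \o X_ n) x))%E]_n @ \oo
     --> (\int[P]_x ((EFin \o X) x))%E].
  apply: (@dominated_convergence _ _ _ P setT measurableT _ _ (EFin \o Y)) => //.
  - by move=> n; exact/measurable_EFinP.
  - exact/measurable_EFinP.
  - by apply: aeW => w _; apply: cvg_EFin; [exact: nearW | exact: XX].
  - by apply: aeW => w n _; rewrite /= lee_fin; exact: XY.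
by rewrite -(ExE iX); exact: fine_cvg.
Qed.

End expectation_toolbox.

(** * Independence *)

Definition indep (d : measure_display) (T : measurableType d) (R : realType)
    (P : probability T R) (X Y : T -> R) :=
  forall A B : set R, measurable A -> measurable B ->
    P (X @^-1` A `&` Y @^-1` B) = (P (X @^-1` A) * P (Y @^-1` B))%E.

Section independence.
Context (d : measure_display) (T : measurableType d) (R : realType).
Variable P : probability T R.
Implicit Types X Y Z : T -> R.

Lemma indep_comp X Y (f g : R -> R) :
  measurable_fun setT f -> measurable_fun setT g ->
  indep P X Y -> indep P (f \o X) (g \o Y).
Proof.
move=> mf mg iXY A B mA mB.
apply: (iXY (f @^-1` A) (g @^-1` B)).
  by rewrite -[X in measurable X]setTI; exact: mf.
by rewrite -[X in measurable X]setTI; exact: mg.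
Qed.

(** The law of (X, Y) is the product of the marginal laws, because both agree
    on rectangles; the product formula is then Fubini's theorem. *)
Lemma indep_mul X Y : L1 P X -> L1 P Y -> indep P X Y ->
  L1 P (fun w => X w * Y w) /\
  Ex P (fun w => X w * Y w) = Ex P X * Ex P Y.
Proof.
move=> iX iY iXY.
have mX := L1_measurable iX; have mY := L1_measurable iY.
pose X' : {mfun T >-> R} := HB.pack X (isMeasurableFun.Build _ _ _ _ _ mX).
pose Y' : {mfun T >-> R} := HB.pack Y (isMeasurableFun.Build _ _ _ _ _ mY).
have mXY : measurable_fun setT (fun w => (X' w, Y' w)).
  exact: measurable_fun_pair.
pose Z : {mfun T >-> (R * R)%type} :=
  HB.pack (fun w => (X' w, Y' w)) (isMeasurableFun.Build _ _ _ _ _ mXY).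
pose m1 : probability R R := distribution P X'.
pose m2 : probability R R := distribution P Y'.
pose m : probability (R * R)%type R := distribution P Z.
have mE A : measurable A -> (m1 \x m2)%E A = m A.
  apply: product_measure_unique => B C mB mC.
  by rewrite -iXY.
pose g (z : R * R) := z.1 * z.2.
have mg : measurable_fun setT g by exact: measurable_funM.
have mge : measurable_fun setT (EFin \o g) by exact/measurable_EFinP.
have fX : (\int[m1]_x `|x%:E| = \int[P]_w `|(X w)%:E|)%E.
  by rewrite ge0_integral_pushforward//; exact: measurableT_comp.
have fY : (\int[m2]_x `|x%:E| = \int[P]_w `|(Y w)%:E|)%E.
  by rewrite ge0_integral_pushforward//; exact: measurableT_comp.
move/integrableP : (iX) => [_ oX]; move/integrableP : (iY) => [_ oY].
have ig : ((m1 \x m2)%E).-integrable setT (EFin \o g).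
  apply/integrable12ltyP => //.
  have H x : (\int[m2]_y `|(EFin \o g) (x, y)| =
      `|x%:E| * \int[m2]_y `|y%:E|)%E.
    rewrite -ge0_integralZl//; last exact: measurableT_comp.
    by apply: eq_integral => y _; rewrite /= normrM EFinM.
  under eq_integral do rewrite H fY.
  rewrite ge0_integralZr//=; last 2 first.
  - by apply: measurableT_comp.
  - by apply: integral_ge0.
  by rewrite fX lte_mul_pinfty// ?integral_ge0// ge0_fin_numE// integral_ge0.
have mprod (f : R * R -> \bar R) :
    (\int[m]_z f z = \int[(m1 \x m2)%E]_z f z)%E.
  by apply: eq_measure_integral => A mA _; exact: (esym (mE A mA)).
have iXmY : L1 P (fun w => X w * Y w).
  apply/integrableP; split; first exact/measurable_EFinP/measurable_funM.
  move/integrableP : ig => [_]; rewrite -mprod ge0_integral_pushforward//.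
  by do 2 apply: measurableT_comp => //.
split => //; apply/EFin_inj; rewrite EFinM !ExE//.
transitivity (\int[m]_z (EFin \o g) z)%E.
  by rewrite [RHS]integral_pushforward.
rewrite mprod -integral12_prod_meas1//.
have inX : m1.-integrable setT EFin.
  by apply/integrableP; split => //; rewrite fX.
have inY : m2.-integrable setT EFin.
  by apply/integrableP; split => //; rewrite fY.
rewrite /fubini_F.
have H x : (\int[m2]_y (EFin \o g) (x, y) = x%:E * \int[m2]_y y%:E)%E.
  by rewrite -integralZl//; apply: eq_integral => y _; rewrite /= EFinM.
under eq_integral do rewrite H.
have -> : (\int[m2]_x x%:E = (Ex P Y)%:E)%E.
  by rewrite ExE// [LHS]integral_pushforward.
rewrite integralZr//.
by rewrite ExE// [X in (X * _)%E = _]integral_pushforward.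
Qed.

End independence.

(** ** The past of a process *)

(** Measurability of X with respect to the past is phrased as ordinary
    measurability on T equipped with the generated sigma-algebra, which makes
    the closure properties of measurable functions available. *)
Definition past_measurable (d : measure_display) (T : measurableType d)
    (R : realType) (Y : nat -> T -> R) (t : nat) (X : T -> R) :=
  @measurable_fun _ _ (g_sigma_algebraType (\bigcup_(j in [set j | (j < t)%N])
        preimage_set_system setT (Y j) measurable)) R setT X.

Section past.
Context (d : measure_display) (T : measurableType d) (R : realType).
Variable P : probability T R.
Variable Y : nat -> T -> R.
Implicit Types X : T -> R.

Lemma past_self j t : (j < t)%N -> past_measurable Y t (Y j).
Proof.
move=> jt _ A mA; apply: sub_gen_smallest.
by exists j => //; exists A.
Qed.

Lemma past_mono s t X : (s <= t)%N ->
  past_measurable Y s X -> past_measurable Y t X.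
Proof.
move=> st mX _ A mA.
have := mX measurableT A mA.
apply: sub_smallest2r => /=; first exact: smallest_sigma_algebra.
by move=> B [j /= js YB]; exists j => //=; exact: leq_trans st.
Qed.

Lemma past_measurableT t X : (forall j, measurable_fun setT (Y j)) ->
  past_measurable Y t X -> measurable_fun setT X.
Proof.
move=> mY mX _ A mA.
have := mX measurableT A mA.
apply: smallest_sub; first exact: sigma_algebra_measurable.
by move=> B [j /= js [C mC <-]]; exact: mY.
Qed.

(** The hypothesis on events passes to functions of the past, since their level
    sets are events of the past. *)
Lemma past_indep t X Z : independent_of_past P X Y t ->
  past_measurable Y t Z -> indep P X Z.
Proof.
move=> iX mZ A B mA mB; apply: iX => //.
have := mZ measurableT B mB.
by rewrite setTI.
Qed.

End past.

(** * From a geometric subsequence to the whole sequence *)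

Section geometric_interpolation.
Context (R : realType).
Implicit Types (a x : R) (S : nat -> R).

Definition geok a n : nat := Num.trunc (a ^+ n).

Lemma geok_le a n : 1 <= a -> (geok a n)%:R <= a ^+ n.
Proof. by move=> a1; rewrite truncn_le exprn_ge0// (le_trans ler01). Qed.

Lemma geok_gt a n : a ^+ n < (geok a n).+1%:R.
Proof. exact: truncnS_gt. Qed.

Lemma expr_unbounded a x : 1 < a -> exists n : nat, x < a ^+ n.
Proof.
move=> a1.
have [n an] : exists n : nat, (x / (a - 1) < n%:R).
  exists (Num.trunc (x / (a - 1))).+1; exact: truncnS_gt.
exists n; move: an; rewrite ltr_pdivrMr ?subr_gt0// => /lt_le_trans; apply.
have : 1 + n%:R * (a - 1) <= a ^+ n.
  elim: n => [|n IH]; first by rewrite mul0r addr0 expr0.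
  rewrite exprS -natr1; have : 0 <= n%:R :> R by [].
  move: (n%:R) (a ^+ n) IH => u v IH u0.
  by have := mulr_ge0 u0 (sqr_ge0 (a - 1)); have := ler_wpM2l (ltW (lt_trans ltr01 a1)) IH; lra.
by move=> h; rewrite (le_trans _ h)// lerDr.
Qed.

Lemma geo_bracket a (m : nat) : 1 < a -> (0 < m)%N ->
  exists n : nat, a ^+ n <= m%:R < a ^+ n.+1.
Proof.
move=> a1 m0.
have ex : exists n : nat, m%:R < a ^+ n by exact: expr_unbounded.
case: (ex_minnP ex) => -[|n]; first by rewrite expr0 ltrn1; case: (m) m0.
move=> mn nmin; exists n; rewrite mn andbT leNgt; apply/negP => /nmin.
by rewrite ltnn.
Qed.

(** Between consecutive points of a geometric grid a monotone sequence is
    squeezed within a factor a, and a may be taken arbitrarily close to 1. *)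
Lemma geo_interpolation S (mu : R) :
  (forall m, 0 <= S m) -> {homo S : m n / (m <= n)%N >-> m <= n} -> 0 <= mu ->
  (forall j : nat, let a := 1 + j.+1%:R^-1 in
     S (geok a n) / a ^+ n @[n --> \oo] --> mu) ->
  S m / m%:R @[m --> \oo] --> mu.
Proof.
move=> S0 Sm mu0 Slim; apply/cvgrPdist_le => e' e'0.
pose e := e' / 2; have e0 : 0 < e by rewrite divr_gt0.
have [j jP] : exists j : nat, (mu + e) / e < j.+1%:R.
  exists (Num.trunc ((mu + e) / e)); exact: truncnS_gt.
pose dl : R := j.+1%:R^-1; pose a := 1 + dl.
have d0 : 0 < dl by rewrite invr_gt0.
have dP : dl * (mu + e) <= e.
  move: jP; rewrite ltr_pdivrMr// => /ltW jP.
  by rewrite mulrC ler_pdivrMr// mulrC.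
have a1 : 1 < a by rewrite ltrDl.
have /cvgrPdist_le /(_ e e0) [n0 _ n0P] := Slim j.
have Sn n : (n0 <= n)%N -> (mu - e) * a ^+ n <= S (geok a n) <= (mu + e) * a ^+ n.
  move=> /n0P /=; rewrite -/dl -/a ler_distlC => /andP[h1 h2].
  have an0 : 0 < a ^+ n by rewrite exprn_gt0// (lt_trans ltr01).
  by rewrite -ler_pdivlMr// -[X in _ && X]ler_pdivrMr// h1 h2.
exists (geok a n0).+1 => //= m mn0.
have m0 : (0 < m)%N by exact: leq_ltn_trans mn0.
have m0R : 0 < m%:R :> R by rewrite ltr0n.
have [n /andP[nm mn]] := geo_bracket a1 m0.
have n0n : (n0 <= n)%N.
  have : a ^+ n0 < a ^+ n.+1.
    rewrite (lt_trans _ mn)// (lt_le_trans (geok_gt _ _))// ler_nat.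
    exact: mn0.
  by rewrite ltr_eXn2l.
have /andP[L _] := Sn n n0n.
have /andP[_ U] := Sn n.+1 (leqW n0n).
have Lm : S (geok a n) <= S m.
  apply: Sm; rewrite -(ler_nat R) (le_trans _ nm)// geok_le//; exact: ltW.
have Um : S m <= S (geok a n.+1).
  by apply: Sm; rewrite -ltnS -(ltr_nat R) (lt_trans mn)// geok_gt.
rewrite ler_distlC ler_pdivlMr// ler_pdivrMr//.
rewrite (_ : e' = 2 * e); last by rewrite /e mulrC divfK.
have S0m := S0 m.
have an0 : 0 < a ^+ n by rewrite exprn_gt0// (lt_trans ltr01).
move: U L nm mn; rewrite exprS /a.
move: (m%:R) (a ^+ n) (S m) (S (geok _ _)) (S (geok _ _)) m0R an0 Lm Um S0m.
move=> M A s s1 s2 M0 A0 Lm Um S0m U L nm mn; apply/andP; split.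
  have [h|h] := leP (mu - 2 * e) 0.
    by rewrite (le_trans _ S0m)// mulr_le0_ge0// ltW.
  rewrite (le_trans _ Lm)// (le_trans _ L)//.
  rewrite (le_trans (ler_wpM2l (ltW h) (ltW mn)))//.
  rewrite mulrA ler_wpM2r ?(ltW A0)//. nra.
rewrite (le_trans Um)// (le_trans U)// mulrA.
rewrite (@le_trans _ _ ((mu + 2 * e) * A))//.
  rewrite ler_wpM2r ?(ltW A0)//. nra.
by rewrite ler_wpM2l// addr_ge0// mulr_ge0// ltW.
Qed.

(** In the law of large numbers this quantity controls both the variance of the
    averages of variables truncated at level b and the probability that a
    truncation at level b has any effect. *)
Definition trunc_sqr (b x : R) := Num.min x b ^+ 2 / b.

(** The terms with a ^ n <= x equal a ^ n and form an increasing geometric sum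
    dominated by its last term; the others equal x ^ 2 / a ^ n and form a
    decreasing geometric sum dominated by its first term.  Both are of order x. *)
Lemma sum_trunc_sqr_le a x (N : nat) : 1 < a -> 0 <= x ->
  \sum_(n < N) trunc_sqr (a ^+ n) x <= 2 * a / (a - 1) * x.
Proof.
move=> a1 x0.
have da : 0 < a - 1 by rewrite subr_gt0.
(* a potential whose increment from b to a * b is at least (a - 1) times the
   term of level b; it is continuous at b = x up to a favourable jump *)
pose Psi b := if b <= x then b else 2 * a * x - a * x ^+ 2 / b.
suff H : (a - 1) * (\sum_(n < N) trunc_sqr (a ^+ n) x) <= Psi (a ^+ N).
  have {}H : (a - 1) * (\sum_(n < N) trunc_sqr (a ^+ n) x) <= 2 * a * x.
    apply: (le_trans H); rewrite /Psi; case: ifPn => h.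
      by have := mulr_ge0 x0 (ltW da); lra.
    have b0 : 0 < a ^+ N by rewrite exprn_gt0// (lt_trans ltr01).
    rewrite gerBl divr_ge0 ?(ltW b0)//.
    by rewrite mulr_ge0 ?sqr_ge0// (le_trans ler01)// ltW.
  by rewrite mulrAC ler_pdivlMr// mulrC.
elim: N => [|N IH].
  rewrite big_ord0 mulr0 expr0 /Psi; case: ifPn => // h.
  rewrite divr1; rewrite -ltNge in h.
  by have := mulr_ge0 x0 (ltW (lt_trans ltr01 a1)); nra.
rewrite big_ord_recr /= mulrDr.
have b0 : 0 < a ^+ N by rewrite exprn_gt0// (lt_trans ltr01).
apply: (le_trans (lerD IH (lexx _))); rewrite exprS.
move: (a ^+ N) b0 => b b0 {IH}.
rewrite /Psi /trunc_sqr.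
have bN0 : b != 0 by rewrite gt_eqF.
have a0 : a != 0 by rewrite gt_eqF// (lt_trans ltr01).
have dab := mulr_gt0 da b0.
have [xb|xb] := ltP x b.
  have -> : (a * b <= x) = false by apply/negbTE; rewrite -ltNge; nra.
  rewrite (_ : a * x ^+ 2 / (a * b) = x ^+ 2 / b); last by field; rewrite bN0.
  by rewrite -(mulrA a); move: (x ^+ 2 / b) => r; nra.
rewrite (_ : b ^+ 2 / b = b); last by field.
case: ifPn => abx; first by nra.
rewrite (_ : a * x ^+ 2 / (a * b) = x ^+ 2 / b); last by field; rewrite bN0.
rewrite -ltNge in abx.
rewrite -(ler_pM2r b0) [X in _ <= X]mulrBl divfK//.
by nra.
Qed.

End geometric_interpolation.

(** * Strong laws of large numbers *)

Section almost_sure_convergence.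
Context (d : measure_display) (T : measurableType d) (R : realType).
Variable P : probability T R.

(** The sum of the series has a finite expectation, hence is almost surely
    finite. *)
Lemma ae_cvg0_of_sum (f : nat -> T -> R) (C : R) :
  (forall n, L1 P (f n)) -> (forall n w, 0 <= f n w) ->
  (forall N, \sum_(n < N) Ex P (f n) <= C) ->
  {ae P, forall w, f n w @[n --> \oo] --> 0}.
Proof.
move=> if_ f0 fC.
pose g w := (\sum_(0 <= n <oo) (f n w)%:E)%E.
have mf n : measurable_fun setT (EFin \o f n).
  by apply/measurable_EFinP; exact: (L1_measurable (if_ n)).
have mg : measurable_fun setT g.
  apply: (@ge0_emeasurable_sum _ _ _ setT (fun n w => (f n w)%:E) predT).
    by move=> n w _ _; rewrite lee_fin.
  by move=> n _; exact: mf.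
have g0 w : (0 <= g w)%E by apply: nneseries_ge0 => n _ _; rewrite lee_fin.
have ig : P.-integrable setT g.
  apply/integrableP; split => //.
  rewrite (eq_integral g); last by move=> w _; rewrite gee0_abs.
  rewrite integral_nneseries//; last by move=> n w _; rewrite lee_fin.
  apply: (@le_lt_trans _ _ C%:E); last exact: ltry.
  apply: lime_le.
    by apply: is_cvg_nneseries => n _ _; apply: integral_ge0 => w _; rewrite lee_fin.
  apply: nearW => N; rewrite big_mkord.
  under eq_bigr do rewrite -ExE//.
  by rewrite sumEFin lee_fin.
apply: filterS (integrable_ae measurableT ig) => w /(_ I) gw.
apply: cvg_series_cvg_0; apply: nondecreasing_is_cvgn.
  apply/nondecreasing_seqP => n; rewrite /series /= big_nat_recr//= lerDl.
  exact: f0.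
exists (fine (g w)) => _ [n _ <-]; rewrite /series /=.
rewrite -lee_fin fineK// -sumEFin.
by apply: nneseries_lim_ge => k _ _; rewrite lee_fin.
Qed.

Lemma L1_sqr_sum (Y : nat -> T -> R) n :
  (forall i, measurable_fun setT (Y i)) ->
  (forall i, L1 P (fun w => Y i w ^+ 2)) ->
  L1 P (fun w => (\sum_(i < n) Y i w) ^+ 2).
Proof.
move=> mY iY; elim: n => [|n IH].
  rewrite (_ : (fun=> _) = cst 0); first exact: L1_cst.
  by apply/funext => w; rewrite big_ord0 expr0n.
have mS : measurable_fun setT (fun w => \sum_(i < n) Y i w).
  exact: measurable_sum.
rewrite (_ : (fun=> _) = fun w => (\sum_(i < n) Y i w) ^+ 2 +
    (2 * ((\sum_(i < n) Y i w) * Y n w) + Y n w ^+ 2)).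
  by apply: L1D => //; apply: L1D => //; apply: L1Z; exact: L1_mul_sqr.
by apply/funext => w; rewrite big_ord_recr/=; ring.
Qed.

(** Orthogonality makes the cross terms vanish. *)
Lemma Ex_sqr_sum (Y : nat -> T -> R) n :
  (forall i, measurable_fun setT (Y i)) ->
  (forall i, L1 P (fun w => Y i w ^+ 2)) ->
  (forall i j, (i < j)%N -> Ex P (fun w => Y i w * Y j w) = 0) ->
  Ex P (fun w => (\sum_(i < n) Y i w) ^+ 2) = \sum_(i < n) Ex P (fun w => Y i w ^+ 2).
Proof.
move=> mY iY oY; elim: n => [|n IH].
  rewrite big_ord0 -[RHS](Ex_cst P 0); apply: eq_Rintegral => w _.
  by rewrite big_ord0 expr0n.
have mS : measurable_fun setT (fun w => \sum_(i < n) Y i w).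
  exact: measurable_sum.
have iS := L1_sqr_sum n mY iY.
have iSY : L1 P (fun w => (\sum_(i < n) Y i w) * Y n w) by exact: L1_mul_sqr.
rewrite (_ : (fun=> _) = fun w => (\sum_(i < n) Y i w) ^+ 2 +
    (2 * ((\sum_(i < n) Y i w) * Y n w) + Y n w ^+ 2)); last first.
  by apply/funext => w; rewrite big_ord_recr/=; ring.
rewrite ExD//; last by apply: L1D => //; exact: L1Z.
rewrite ExD//; last exact: L1Z.
rewrite ExZ// IH big_ord_recr/= (_ : Ex P (fun w => _ * _) = 0) ?mulr0 ?add0r//.
rewrite (_ : (fun=> _) = fun w => \sum_(i < n) (Y i w * Y n w)); last first.
  by apply/funext => w; rewrite mulr_suml.
rewrite Ex_sum; last by move=> i; exact: L1_mul_sqr.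
by rewrite big1// => i _; exact: oY.
Qed.

End almost_sure_convergence.

Lemma cvg_geok_div (R : realType) (a : R) : 1 < a ->
  (geok a n)%:R / a ^+ n @[n --> \oo] --> (1 : R).
Proof.
move=> a1; have a0 : 0 < a by rewrite (lt_trans ltr01).
have h : `|a^-1| < 1 by rewrite ger0_norm ?invr_ge0 ?ltW// invf_lt1.
apply: (@squeeze_cvgr _ _ _ _ (fun n => 1 - a^-1 ^+ n) (cst 1)).
- apply: nearW => n /=; have b0 : 0 < a ^+ n by rewrite exprn_gt0.
  rewrite ler_pdivrMr// mul1r geok_le ?(ltW a1)// andbT ler_pdivlMr//.
  rewrite mulrBl mul1r exprVn mulVf ?gt_eqF// lerBlDr natr1.
  exact/ltW/geok_gt.
- rewrite -[X in _ --> X]subr0; apply: cvgB; first exact: cvg_cst.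
  exact: cvg_expr.
- exact: cvg_cst.
Qed.

Lemma cvg_geok (R : realType) (a : R) : 1 < a -> geok a n @[n --> \oo] --> \oo.
Proof.
move=> a1; apply/cvgnyPge => N.
have [n0 n0P] := expr_unbounded N%:R a1.
exists n0 => // n /= n0n; rewrite truncn_ge_nat; last by rewrite exprn_ge0// (le_trans ler01)// ltW.
by rewrite (le_trans (ltW n0P))// ler_weXn2l// ltW.
Qed.

Lemma cvg0_of_sqr_le (R : realType) (u v : nat -> R) :
  (\forall n \near \oo, u n ^+ 2 <= v n) ->
  v n @[n --> \oo] --> 0 -> u n @[n --> \oo] --> 0.
Proof.
move=> uv /cvgr0Pnorm_le v0; apply/cvgr0Pnorm_le => e e0.
near=> n.
suff : `|u n| ^+ 2 <= e ^+ 2 by rewrite ler_pXn2r// nnegrE ltW.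
rewrite real_normK ?num_real//; apply: (@le_trans _ _ (v n)); first by near: n.
apply: (le_trans (ler_norm _)); near: n; apply: v0.
by rewrite exprn_gt0.
Unshelve. all: by end_near. Qed.

Section etemadi.
Context (d : measure_display) (T : measurableType d) (R : realType).
Variable P : probability T R.
Variable X : nat -> T -> R.
Hypothesis iX : forall i, L1 P (X i).
Hypothesis X0 : forall i w, 0 <= X i w.
Hypothesis X_indep : forall i j, (i < j)%N -> indep P (X i) (X j).
Hypothesis X_id : forall (g : R -> R) i, measurable_fun setT g ->
  (forall x, 0 <= g x) -> Ex P (g \o X i) = Ex P (g \o X 0%N).

Let mX i := L1_measurable (iX i).

Let cut b i w := Num.min (X i w) b.

Let cut_ge0 b i w : 0 <= b -> 0 <= cut b i w.
Proof. by move=> b0; rewrite le_min X0. Qed.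

Let mcut b i : measurable_fun setT (cut b i).
Proof. by apply: measurable_minr. Qed.

Let cut_abs b i w : 0 <= b -> `|cut b i w| <= b.
Proof. by move=> b0; rewrite ger0_norm ?cut_ge0// ge_min lexx orbT. Qed.

Let icut b i : 0 <= b -> L1 P (cut b i).
Proof. by move=> b0; apply: (@L1_bounded _ _ _ _ b) => // w; exact: cut_abs. Qed.

Let icut2 b i : 0 <= b -> L1 P (fun w => cut b i w ^+ 2).
Proof.
move=> b0; apply: (@L1_bounded _ _ _ _ (b ^+ 2)).
  exact: measurable_funX.
by move=> w; rewrite normrX lerXn2r ?nnegrE// cut_abs.
Qed.

Let mu b := Ex P (cut b 0%N).

Let Ex_cut b i : 0 <= b -> Ex P (cut b i) = mu b.
Proof.
move=> b0; pose g x := Num.max 0 (Num.min x b).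
have mg : measurable_fun setT g.
  by apply: measurable_maxr => //; exact: measurable_minr.
have gE j : cut b j = g \o X j.
  by apply/funext => w; rewrite /g /= max_r// le_min X0.
by rewrite /mu !gE; apply: X_id => // x; rewrite le_max lexx.
Qed.

Let Ex_cut2 b i : 0 <= b ->
  Ex P (fun w => cut b i w ^+ 2) = Ex P (fun w => cut b 0%N w ^+ 2).
Proof.
move=> b0; apply: (X_id (g := fun x => Num.min x b ^+ 2)) => [|x].
  by apply: measurable_funX; exact: measurable_minr.
exact: sqr_ge0.
Qed.

Let tail b i w : R := \1_`]b, +oo[ (X i w).

Let mtail b i : measurable_fun setT (tail b i).
Proof. by apply: measurableT_comp => //; exact: measurable_indic. Qed.

Let itail b i : L1 P (tail b i).
Proof.
apply: (@L1_bounded _ _ _ _ 1) => // w.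
by rewrite /tail indicE; case: (_ \in _); rewrite ?normr1 ?normr0.
Qed.

Let Ex_tail b i : Ex P (tail b i) = Ex P (tail b 0%N).
Proof. by apply: (X_id (g := \1_`]b, +oo[)) => //; exact: measurable_indic. Qed.

Let tailE b i w : tail b i w = (b < X i w)%R%:R.
Proof. by rewrite /tail indicE mem_setE in_itv /= andbT. Qed.

Let tail_le b : 0 < b ->
  Ex P (tail b 0%N) <= Ex P (fun w => cut b 0%N w ^+ 2) / b ^+ 2.
Proof.
move=> b0; rewrite mulrC -ExZ; last by apply: icut2; exact: ltW.
apply: Ex_le => //; first by apply: L1Z; apply: icut2; exact: ltW.
move=> w; rewrite tailE /cut; case: ltP => [bX|_].
  by rewrite mulVf// expf_eq0 gt_eqF.
by rewrite mulr_ge0 ?sqr_ge0// invr_ge0 sqr_ge0.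
Qed.

(** This is small only if the truncated average is close to its mean and none of
    the variables up to index geok a n has been truncated. *)
Let f a n w : R := (\sum_(i < geok a n) (cut (a ^+ n) i w - mu (a ^+ n))) ^+ 2
    / (a ^+ n) ^+ 2 + \sum_(i < geok a n) tail (a ^+ n) i w.

Let icentered b i : 0 <= b -> L1 P (fun w => cut b i w - mu b).
Proof. by move=> b0; apply: L1B; [exact: icut|exact: L1_cst]. Qed.

Let icentered2 b i : 0 <= b -> L1 P (fun w => (cut b i w - mu b) ^+ 2).
Proof.
move=> b0; apply: (@L1_bounded _ _ _ _ ((b + `|mu b|) ^+ 2)).
  by apply: measurable_funX; exact: measurable_funB.
move=> w; rewrite normrX lerXn2r ?nnegrE ?addr_ge0//.
by rewrite (le_trans (ler_normB _ _))// lerD2r cut_abs.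
Qed.

Let Ex_centered2 b i : 0 <= b ->
  Ex P (fun w => (cut b i w - mu b) ^+ 2) <= Ex P (fun w => cut b 0%N w ^+ 2).
Proof.
move=> b0; rewrite -(Ex_cut2 i b0).
rewrite (_ : (fun=> _) = fun w => cut b i w ^+ 2 - (2 * mu b * cut b i w - mu b ^+ 2)).
  have i1 : L1 P (fun w => 2 * mu b * cut b i w) by apply: L1Z; exact: icut.
  have i2 : L1 P (fun=> mu b ^+ 2) by exact: L1_cst.
  rewrite ExB//; [|exact: icut2|exact: L1B].
  rewrite ExB// ExZ ?Ex_cst ?Ex_cut//; last exact: icut.
  by have := sqr_ge0 (mu b); nra.
by apply/funext => w; ring.
Qed.

Let orth_centered b i j : 0 <= b -> (i < j)%N ->
  Ex P (fun w => (cut b i w - mu b) * (cut b j w - mu b)) = 0.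
Proof.
move=> b0 ij; pose h x := Num.min x b - mu b.
have mh : measurable_fun setT h.
  by apply: measurable_funB => //; exact: measurable_minr.
have [_ ->] := indep_mul (icentered i b0) (icentered j b0)
  (indep_comp mh mh (X_indep ij)).
by rewrite ExB ?Ex_cst ?Ex_cut ?subrr ?mul0r//; [exact: icut|exact: L1_cst].
Qed.

Let f_ge0 a n w : 0 <= f a n w.
Proof.
rewrite addr_ge0 ?divr_ge0 ?sqr_ge0// sumr_ge0// => i _; rewrite tailE.
Qed.

Let if1 a n : 1 < a -> L1 P (fun w => (\sum_(i < geok a n)
  (cut (a ^+ n) i w - mu (a ^+ n))) ^+ 2).
Proof.
move=> a1; have b0 : 0 <= a ^+ n by rewrite exprn_ge0// (le_trans ler01)// ltW.
apply: (@L1_sqr_sum _ _ _ _ (fun i w => cut (a ^+ n) i w - mu (a ^+ n))) => i;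
  last exact: icentered2.
exact: measurable_funB.
Qed.

Let if_ a n : 1 < a -> L1 P (f a n).
Proof.
move=> a1; rewrite /f; apply: L1D; last exact: (L1_sum _ (fun i => itail _ _)).
rewrite (_ : (fun=> _) = fun w => ((a ^+ n) ^+ 2)^-1 * (\sum_(i < geok a n)
  (cut (a ^+ n) i w - mu (a ^+ n))) ^+ 2); first exact/L1Z/if1.
by apply/funext => w; rewrite mulrC.
Qed.

Let Ex_f_le a n : 1 < a ->
  Ex P (f a n) <= 2 * (Ex P (fun w => cut (a ^+ n) 0%N w ^+ 2) / a ^+ n).
Proof.
move=> a1; have b0 : 0 < a ^+ n by rewrite exprn_gt0// (lt_trans ltr01).
have kb := geok_le n (ltW a1); have i1 := if1 n a1.
rewrite /f ExD; [|rewrite (_ : (fun=> _) = fun w => ((a ^+ n) ^+ 2)^-1 *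
  (\sum_(i < geok a n) (cut (a ^+ n) i w - mu (a ^+ n))) ^+ 2);
  [exact: L1Z|by apply/funext => w; rewrite mulrC]|exact: (L1_sum _ (fun i => itail _ _))].
rewrite (_ : (fun w => _ / _) = fun w => ((a ^+ n) ^+ 2)^-1 *
  (\sum_(i < geok a n) (cut (a ^+ n) i w - mu (a ^+ n))) ^+ 2); last first.
  by apply/funext => w; rewrite mulrC.
rewrite ExZ// (@Ex_sqr_sum _ _ _ _ (fun i w => cut (a ^+ n) i w - mu (a ^+ n))); last 3 first.
- by move=> i; exact: measurable_funB.
- by move=> i; exact/icentered2/ltW.
- by move=> i j ij; exact/orth_centered/ij/ltW.
rewrite Ex_sum//.
set V := Ex P (fun w => cut (a ^+ n) 0%N w ^+ 2).
have V0 : 0 <= V by apply: Ex_ge0 => w; exact: sqr_ge0.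
have h1 : \sum_(i < geok a n) Ex P (fun w => (cut (a ^+ n) i w - mu (a ^+ n)) ^+ 2)
   <= (geok a n)%:R * V.
  rewrite mulr_natl -[X in _ *+ X]card_ord -sumr_const; apply: ler_sum => i _.
  exact/Ex_centered2/ltW.
have h2 : \sum_(i < geok a n) Ex P (tail (a ^+ n) i)
   <= (geok a n)%:R * (V / (a ^+ n) ^+ 2).
  rewrite mulr_natl -[X in _ *+ X]card_ord -sumr_const; apply: ler_sum => i _.
  by rewrite Ex_tail tail_le.
move: (a ^+ n) (geok a n) b0 kb V V0 h1 h2 => b k b0 kb V V0 h1 h2.
have b2 : 0 < b ^+ 2 by rewrite exprn_gt0.
have h3 : k%:R * (V / b ^+ 2) <= V / b.
  rewrite mulrA ler_pdivrMr// expr2 (mulrA (V / b)) divfK ?gt_eqF//.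
  by rewrite mulrC ler_wpM2l.
have h4 : (b ^+ 2)^-1 * (k%:R * V) <= V / b.
  by rewrite (le_trans _ h3)// mulrC mulrA.
have h5 : (b ^+ 2)^-1 * \sum_(i < k) Ex P (fun w => (cut b i w - mu b) ^+ 2) <=
    (b ^+ 2)^-1 * (k%:R * V) by rewrite ler_wpM2l// invr_ge0 ltW.
lra.
Qed.

Let sum_Ex_f_le a N : 1 < a ->
  \sum_(n < N) Ex P (f a n) <= 2 * (2 * a / (a - 1) * Ex P (X 0%N)).
Proof.
move=> a1.
apply: (@le_trans _ _ (\sum_(n < N) 2 * Ex P (fun w => trunc_sqr (a ^+ n) (X 0%N w)))).
  apply: ler_sum => n _; apply: (le_trans (Ex_f_le n a1)).
  rewrite ler_pM2l// mulrC -ExZ; last first.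
    by apply: icut2; rewrite exprn_ge0// (le_trans ler01)// ltW.
  rewrite le_eqVlt; apply/orP; left; apply/eqP; congr Ex.
  by apply/funext => w; rewrite mulrC.
have it n : L1 P (fun w => trunc_sqr (a ^+ n) (X 0%N w)).
  rewrite (_ : (fun=> _) = fun w => (a ^+ n)^-1 * cut (a ^+ n) 0%N w ^+ 2).
    by apply/L1Z/icut2; rewrite exprn_ge0// (le_trans ler01)// ltW.
  by apply/funext => w; rewrite mulrC.
rewrite -mulr_sumr ler_pM2l// -Ex_sum// -ExZ//.
apply: Ex_le; [exact: L1_sum|exact: L1Z|].
by move=> w; exact: sum_trunc_sqr_le.
Qed.

Let cvg_mu a : 1 < a -> mu (a ^+ n) @[n --> \oo] --> Ex P (X 0%N).
Proof.
move=> a1; apply: (@dominated_Ex _ _ _ _ _ _ (X 0%N)) => //.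
  move=> w; have [N XN] := expr_unbounded (X 0%N w) a1.
  apply: cvg_near_cst; exists N => // n /= Nn.
  rewrite /cut min_l// (le_trans (ltW XN))// ler_weXn2l// ltW//.
move=> n w; rewrite ger0_norm; last first.
  by apply: cut_ge0; rewrite exprn_ge0// (le_trans ler01)// ltW.
by rewrite ge_min lexx.
Qed.

(** The expectations of the [f a n] are summable over n. *)
Let etemadi_geo a : 1 < a -> {ae P, forall w,
  (\sum_(i < geok a n) X i w) / a ^+ n @[n --> \oo] --> Ex P (X 0%N)}.
Proof.
move=> a1.
apply: filterS (ae_cvg0_of_sum (fun n => if_ n a1) (f_ge0 a)
  (fun N => sum_Ex_f_le N a1)) => w fw.
pose dl n := (\sum_(i < geok a n) (cut (a ^+ n) i w - mu (a ^+ n))) / a ^+ n.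
have dl0 : dl n @[n --> \oo] --> 0.
  apply: (cvg0_of_sqr_le _ fw); apply: nearW => n.
  rewrite /f /dl exprMn exprVn lerDl sumr_ge0// => i _; rewrite tailE.
rewrite -[X in _ --> X]add0r -[X in _ --> 0 + X]mul1r.
apply: (@cvg_trans _ ((dl n + (geok a n)%:R / a ^+ n * mu (a ^+ n)) @[n --> \oo])).
  (* below 1 the number of truncated variables must be 0 *)
  have h : \forall n \near \oo, `|f a n w| < 1.
    by move/cvgr0Pnorm_lt : fw; apply.
  apply: near_eq_cvg; near=> n.
  have fn1 : f a n w < 1 by apply: le_lt_trans (ler_norm _) _; near: n.
  have b0 : 0 < a ^+ n by rewrite exprn_gt0// (lt_trans ltr01).
  have cutX (i : 'I_(geok a n)) : cut (a ^+ n) i w = X i w.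
    rewrite /cut min_l// leNgt; apply/negP => bX.
    move: fn1; rewrite ltNge => /negP; apply.
    have t1 : 1 <= \sum_(j < geok a n) tail (a ^+ n) j w.
      rewrite (bigD1 i)//= tailE bX -[leLHS]addr0 lerD2l.
      by apply: sumr_ge0 => j _; rewrite tailE.
    by rewrite (le_trans t1)// /f lerDr divr_ge0 ?sqr_ge0.
  rewrite /dl sumrB sumr_const card_ord -(mulr_natl (mu _)).
  rewrite (eq_bigr _ (fun i _ => cutX i)).
  by rewrite mulrBl; ring.
apply: cvgD => //; apply: cvgM; first exact: cvg_geok_div.
exact: cvg_mu.
Unshelve. all: by end_near. Qed.

(** Etemadi's strong law of large numbers: truncation stands in for second
    moments, the variance of a sum involves only pairs of its terms, and
    positivity makes the sums monotone. *)
Theorem etemadi_slln : {ae P, forall w,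
  (\sum_(i < m) X i w) / m%:R @[m --> \oo] --> Ex P (X 0%N)}.
Proof.
have H : {ae P, forall w, forall j : nat, let a := 1 + j.+1%:R^-1 in
    (\sum_(i < geok a n) X i w) / a ^+ n @[n --> \oo] --> Ex P (X 0%N)}.
  by apply: ae_foralln => j; apply: etemadi_geo; rewrite ltrDl invr_gt0.
apply: filterS H => w Hw.
apply: (geo_interpolation (S := fun m => \sum_(i < m) X i w)) => //.
- by move=> m; exact: sumr_ge0.
- apply/nondecreasing_seqP => m; rewrite big_ord_recr /= lerDl; exact: X0.
- exact: Ex_ge0.
Qed.

End etemadi.

Section orthogonal_slln.
Context (d : measure_display) (T : measurableType d) (R : realType).
Variable P : probability T R.
Variable e : nat -> T -> R.
Hypothesis me : forall i, measurable_fun setT (e i).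
Hypothesis ie : forall i, L1 P (fun w => e i w ^+ 2).
Hypothesis e_var : forall i, Ex P (fun w => e i w ^+ 2) = 1.
Hypothesis e_orth : forall i j, (i < j)%N -> Ex P (fun w => e i w * e j w) = 0.

(** The squared averages have expectation of order a ^- n, which is summable. *)
Let orthogonal_geo a : 1 < a -> {ae P, forall w,
  (\sum_(i < geok a n) e i w) / a ^+ n @[n --> \oo] --> 0}.
Proof.
move=> a1.
pose f n w := ((a ^+ n) ^+ 2)^-1 * (\sum_(i < geok a n) e i w) ^+ 2.
have if_ n : L1 P (f n) by apply: L1Z; exact: L1_sqr_sum.
have f0 n w : 0 <= f n w by rewrite mulr_ge0 ?sqr_ge0// invr_ge0 sqr_ge0.
have fC N : \sum_(n < N) Ex P (f n) <= 2 * a / (a - 1) * 1.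
  (* at x = 1 the truncated squares reduce to the inverse powers of a *)
  apply: le_trans (sum_trunc_sqr_le N a1 ler01); apply: ler_sum => n _.
  have b0 : 0 < a ^+ n by rewrite exprn_gt0// (lt_trans ltr01).
  rewrite /f ExZ; last exact: L1_sqr_sum.
  rewrite Ex_sqr_sum//; under eq_bigr do rewrite e_var.
  rewrite sumr_const card_ord /trunc_sqr min_l; last by rewrite exprn_ege1// ltW.
  rewrite expr1n mulrC expr2 invfM mulrA ler_pM2r ?invr_gt0//.
  by rewrite ler_pdivrMr// mul1r geok_le// ltW.
apply: filterS (ae_cvg0_of_sum if_ f0 fC) => w fw.
apply: (cvg0_of_sqr_le _ fw); apply: nearW => n.
by rewrite exprMn exprVn mulrC.
Qed.

(** The sums of e need not be monotone; those of e + |e| are, so that the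
    interpolation applies to them once the averages of |e| are known to
    converge. *)
Lemma orthogonal_slln (mu : R) : 0 <= mu ->
  {ae P, forall w, (\sum_(i < m) `|e i w|) / m%:R @[m --> \oo] --> mu} ->
  {ae P, forall w, (\sum_(i < m) e i w) / m%:R @[m --> \oo] --> 0}.
Proof.
move=> mu0 abs_mu.
have H : {ae P, forall w, forall j : nat, let a := 1 + j.+1%:R^-1 in
    (\sum_(i < geok a n) e i w) / a ^+ n @[n --> \oo] --> 0}.
  by apply: ae_foralln => j; apply: orthogonal_geo; rewrite ltrDl invr_gt0.
apply: filterS2 H abs_mu => w Hw muw.
pose S m := \sum_(i < m) (e i w + `|e i w|).
have SE m : S m = \sum_(i < m) e i w + \sum_(i < m) `|e i w| by rewrite /S big_split.
have Smu : S m / m%:R @[m --> \oo] --> mu.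
  apply: geo_interpolation => //.
  - by move=> m; apply: sumr_ge0 => i _; have := ler_norm (- e i w); rewrite normrN; lra.
  - apply/nondecreasing_seqP => m; rewrite /S big_ord_recr /= lerDl.
    by have := ler_norm (- e m w); rewrite normrN; lra.
  move=> j a; have a1 : 1 < a by rewrite ltrDl invr_gt0.
  have -> : (fun n => S (geok a n) / a ^+ n) = (fun n =>
      (\sum_(i < geok a n) e i w) / a ^+ n +
      (\sum_(i < geok a n) `|e i w|) / (geok a n)%:R * ((geok a n)%:R / a ^+ n)).
    apply/funext => n; rewrite SE mulrDl; congr (_ + _).
    rewrite mulrA divfK// pnatr_eq0 -lt0n truncn_gt0.
    by rewrite exprn_ege1// ltW.
  rewrite -[X in _ --> X]add0r -[X in _ --> 0 + X]mulr1.
  apply: cvgD; first exact: Hw.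
  apply: cvgM; last exact: cvg_geok_div.
  exact: (cvg_comp _ _ (cvg_geok a1) muw).
have -> : (fun m => (\sum_(i < m) e i w) / m%:R) =
    (fun m => S m / m%:R - (\sum_(i < m) `|e i w|) / m%:R).
  by apply/funext => m; rewrite SE mulrDl addrK.
by rewrite -[X in _ --> X](subrr mu); exact: cvgB.
Qed.

End orthogonal_slln.

(** * Taylor bounds for sine and cosine *)

Section trigonometric_bounds.
Context (R : realType).
Implicit Types x y t : R.

Lemma mvt_le (f f' : R -> R) (C x y : R) :
  (forall t, is_derive t 1 f (f' t)) ->
  (forall t, Num.min x y <= t <= Num.max x y -> `|f' t| <= C) ->
  `|f y - f x| <= C * `|y - x|.
Proof.
move=> df fC; wlog xy : x y fC / x <= y.
  move=> W; have [xy|/ltW yx] := leP x y; first exact: W.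
  rewrite distrC (distrC y); apply: W => // t; rewrite minC maxC; exact: fC.
have cf : {within `[x, y], continuous f}.
  apply: derivable_within_continuous => t _.
  by have := df t; case.
have [c] := MVT_segment xy (fun t _ => df t) cf.
rewrite in_itv /= => cxy ->; rewrite normrM ler_wpM2r// fC//.
by rewrite (min_idPl xy) (max_idPr xy).
Qed.

Lemma sin_lip x y : `|sin y - sin x| <= `|y - x|.
Proof.
rewrite -[leRHS]mul1r; apply: mvt_le => t _; exact: cos_max.
Qed.

Lemma cos_lip x y : `|cos y - cos x| <= `|y - x|.
Proof.
rewrite -[leRHS]mul1r; apply: mvt_le => t _; rewrite normrN; exact: sin_max.
Qed.

Lemma abs_sin_le t : `|sin t| <= `|t|.
Proof. by have := sin_lip 0 t; rewrite sin0 !subr0. Qed.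

Lemma cos_half t : 1 - cos t = 2 * sin (t / 2) ^+ 2.
Proof.
have {1}-> : t = (t / 2) *+ 2 by rewrite -mulr_natr divfK.
rewrite cos_mulr2n; have := cos2Dsin2 (t / 2) => h; lra.
Qed.

Lemma cos_bound t : 0 <= 1 - cos t <= t ^+ 2 / 2.
Proof.
rewrite cos_half mulr_ge0 ?sqr_ge0//=.
have : `|sin (t / 2)| ^+ 2 <= `|t / 2| ^+ 2.
  by rewrite lerXn2r ?nnegrE// abs_sin_le.
by rewrite !real_normK ?num_real//; lra.
Qed.

(** The derivative cos - 1 is of second order. *)
Lemma sin_taylor3 t : `|sin t - t| <= `|t| ^+ 3 / 2.
Proof.
have df (s : R) : is_derive s 1 (fun x => sin x - x) (cos s - 1).
  exact: (is_deriveB (is_derive_sin s) (is_derive_id s 1)).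
have := @mvt_le _ _ (t ^+ 2 / 2) 0 t df.
rewrite sin0 !subr0 => /(_ _)/le_trans; apply.
  move=> s /andP[s1 s2]; rewrite distrC ger0_norm; last by case/andP : (cos_bound s).
  case/andP : (cos_bound s) => _ /le_trans; apply.
  rewrite ler_pM2r//; move: s1 s2; rewrite minC maxC; have [t0|t0] := leP t 0 => s1 s2.
    by nra.
  by nra.
rewrite -(real_normK (num_real t)) le_eqVlt; apply/orP; left; apply/eqP.
by field.
Qed.

Lemma sin_taylor2 t : `|sin t - t| <= t ^+ 2.
Proof.
rewrite -(real_normK (num_real t)).
have [t2|t2] := leP `|t| 2.
  apply: (le_trans (sin_taylor3 t)); have := normr_ge0 t.
  move: `|t| t2 => u u2 u0; rewrite exprSr; have := sqr_ge0 u; nra.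
apply: (le_trans (ler_normB _ _)); have := abs_sin_le t; nra.
Qed.

(** The half-angle formula reduces this to [sin_taylor3]. *)
Lemma cos_taylor4 t : `|cos t - 1 + t ^+ 2 / 2| <= t ^+ 4.
Proof.
pose a := t / 2.
have -> : cos t - 1 + t ^+ 2 / 2 = - (2 * ((sin a - a) * (sin a + a))).
  have := cos_half t; rewrite -/a => h.
  have -> : cos t = 1 - 2 * sin a ^+ 2 by lra.
  by rewrite /a; field.
rewrite normrN !normrM ger0_norm//.
have h1 := sin_taylor3 a.
have h2 : `|sin a + a| <= 2 * `|a|.
  by apply: (le_trans (ler_normD _ _)); have := abs_sin_le a; lra.
have -> : t ^+ 4 = 16 * `|a| ^+ 4.
  have -> : `|a| ^+ 4 = a ^+ 4 by rewrite -normrX ger0_norm// exprn_even_ge0.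
  by rewrite /a; field.
have h3 : `|sin a - a| * `|sin a + a| <= `|a| ^+ 3 / 2 * (2 * `|a|).
  exact: ler_pM.
have h4 : 0 <= `|a| ^+ 4 by rewrite exprn_ge0.
have h5 : `|a| ^+ 3 / 2 * (2 * `|a|) = `|a| ^+ 4 by field.
by rewrite h5 in h3; lra.
Qed.

Lemma cos_taylor2 t : `|cos t - 1 + t ^+ 2 / 2| <= t ^+ 2.
Proof.
have /andP[h1 h2] := cos_bound t.
have h3 : 0 <= t ^+ 2 by exact: sqr_ge0.
by rewrite ler_norml; apply/andP; split; lra.
Qed.

Lemma expR_taylor2 x : 0 <= x -> `|expR (- x) - 1 + x| <= x ^+ 2.
Proof.
move=> x0; have h1 := expR_ge1Dx (- x); have h2 := expR_ge1Dx x.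
have h3 : expR (- x) <= 1 - x + x ^+ 2.
  rewrite expRN -(ler_pM2r (expR_gt0 x)) mulVf ?gt_eqF ?expR_gt0//.
  have : 1 <= (1 - x + x ^+ 2) * (1 + x) by have := exprn_ge0 3 x0; lra.
  move=> /le_trans; apply; apply: ler_wpM2l => //.
  by have := sqr_ge0 (x - 2^-1); lra.
rewrite ler_norml; apply/andP; split; last by lra.
by have := sqr_ge0 x; lra.
Qed.

End trigonometric_bounds.

(** * A central limit theorem for signed innovations *)

Section small_increments.
Context (d : measure_display) (T : measurableType d) (R : realType).
Variable P : probability T R.

Definition rsqrt n : R := (Num.sqrt n%:R)^-1.

Lemma rsqrt_ge0 n : 0 <= rsqrt n.
Proof. by rewrite invr_ge0 sqrtr_ge0. Qed.

Lemma rsqrt_sqr n : rsqrt n ^+ 2 = n%:R^-1.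
Proof. by rewrite exprVn sqr_sqrtr. Qed.

Lemma natr_rsqrt_sqr n : (0 < n)%N -> n%:R * rsqrt n ^+ 2 = 1.
Proof. by move=> n0; rewrite rsqrt_sqr mulfV// pnatr_eq0 -lt0n. Qed.

Lemma natr_rsqrt_sqr_le n : n%:R * rsqrt n ^+ 2 <= 1.
Proof.
by case: n => [|n]; [rewrite mul0r|rewrite natr_rsqrt_sqr].
Qed.

Lemma cvg_invn : n%:R^-1 @[n --> \oo] --> (0 : R).
Proof.
rewrite -(cvg_shiftS (fun n => n%:R^-1 : R)); exact: cvg_harmonic.
Qed.

Lemma cvg_rsqrt : rsqrt n @[n --> \oo] --> (0 : R).
Proof.
apply: (cvg0_of_sqr_le _ cvg_invn); apply: nearW => n.
by rewrite rsqrt_sqr.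
Qed.

Variable D : T -> R.
Hypothesis mD : measurable_fun setT D.
Hypothesis iD : L1 P (fun w => D w ^+ 2).
Hypothesis D_mean : Ex P D = 0.

Let mcD n : measurable_fun setT (fun w => rsqrt n * D w).
Proof. exact: measurable_funM. Qed.

Let mcos n : measurable_fun setT (fun w => cos (rsqrt n * D w)).
Proof.
apply: measurableT_comp => //; apply: continuous_measurable_fun.
exact: continuous_cos.
Qed.

Let msin n : measurable_fun setT (fun w => sin (rsqrt n * D w)).
Proof.
apply: measurableT_comp => //; apply: continuous_measurable_fun.
exact: continuous_sin.
Qed.

Let icos n : L1 P (fun w => cos (rsqrt n * D w)).
Proof. by apply: (@L1_bounded _ _ _ _ 1) => // w; exact: cos_max. Qed.

Let isin n : L1 P (fun w => sin (rsqrt n * D w)).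
Proof. by apply: (@L1_bounded _ _ _ _ 1) => // w; exact: sin_max. Qed.

Let cvg_cst_rsqrt (K : R) : rsqrt n * K @[n --> \oo] --> 0.
Proof. by rewrite -(mul0r K); apply: cvgMl; exact: cvg_rsqrt. Qed.

(** After multiplication by n the fourth-order Taylor bound tends to 0 at each
    point, and the second-order bound is at most D ^ 2, so that dominated
    convergence applies.  The comparison is with an exponential instead of
    1 - q / (2 n) because its n-th power is then exact. *)
Lemma cos_small_increment :
  n%:R * (Ex P (fun w => cos (rsqrt n * D w)) -
          expR (- (Ex P (fun w => D w ^+ 2) / 2 / n%:R))) @[n --> \oo] --> 0.
Proof.
set q := Ex P (fun w => D w ^+ 2).
have q0 : 0 <= q by apply: Ex_ge0 => w; exact: sqr_ge0.
pose X n w := n%:R * (cos (rsqrt n * D w) - 1 + (rsqrt n * D w) ^+ 2 / 2).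
have EX : Ex P (X n) @[n --> \oo] --> 0.
  rewrite -(Ex_cst P 0); apply: (@dominated_Ex _ _ _ _ _ _ (fun w => D w ^+ 2)) => //.
  - move=> n; apply: measurable_funM => //; apply: measurable_funD.
      exact: measurable_funB.
    by apply: measurable_funM => //; exact: measurable_funX.
  - move=> w; apply: (cvg0_of_sqr_le (v := fun n => (rsqrt n * D w ^+ 4) ^+ 2)); last first.
      have := cvg_cst_rsqrt (D w ^+ 4); move=> h.
      by rewrite -[X in _ --> X](mulr0 (0 : R)); apply: cvgM.
    near=> n.
    rewrite -(real_normK (num_real (X n w))) lerXn2r ?nnegrE//.
      by rewrite mulr_ge0 ?rsqrt_ge0// exprn_even_ge0.
    rewrite /X normrM ger0_norm//.
    apply: (le_trans (ler_wpM2l _ (cos_taylor4 _))) => //.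
    rewrite exprMn mulrA ler_wpM2r ?exprn_even_ge0//.
    rewrite (_ : 4 = 2 + 2)%N// exprD mulrA.
    rewrite (@le_trans _ _ (1 * rsqrt n ^+ 2))//.
      by rewrite ler_wpM2r ?sqr_ge0// natr_rsqrt_sqr_le.
    rewrite mul1r expr2 ler_piMl ?rsqrt_ge0//.
    near: n; have := cvg_rsqrt => /cvgr_le; apply.
    exact: ltr01.
  - move=> n w; rewrite /X normrM ger0_norm//.
    apply: (le_trans (ler_wpM2l _ (cos_taylor2 _))) => //.
    by rewrite exprMn mulrA ler_piMl ?sqr_ge0// natr_rsqrt_sqr_le.
pose x n : R := q / 2 / n%:R.
have EB : n%:R * (expR (- x n) - 1 + x n) @[n --> \oo] --> 0.
  apply/norm_cvg0P.
  apply: (@squeeze_cvgr _ _ _ _ (cst 0) (fun n => (q / 2) ^+ 2 * n%:R^-1)).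
  - apply: nearW => n; rewrite normr_ge0/= normrM ger0_norm//.
    have x0 : 0 <= x n by rewrite !divr_ge0.
    apply: (le_trans (ler_wpM2l _ (expR_taylor2 x0))) => //.
    rewrite /x; case: n {x0} => [|n]; first by rewrite mul0r invr0 mulr0.
    by rewrite le_eqVlt; apply/orP; left; apply/eqP; field.
  - exact: cvg_cst.
  - by rewrite -(mulr0 ((q / 2) ^+ 2)); apply: cvgMr; exact: cvg_invn.
apply: (@cvg_trans _ (Ex P (X n) - n%:R * (expR (- x n) - 1 + x n) @[n --> \oo])).
  apply: near_eq_cvg; near=> n.
  have n0 : (0 < n)%N by near: n; exact: nbhs_infty_gt.
  have n0R : n%:R != 0 :> R by rewrite pnatr_eq0 -lt0n.
  rewrite /X ExZ; last first.
    apply: L1D; first by apply: L1B => //; exact: L1_cst.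
    rewrite (_ : (fun=> _) = fun w => rsqrt n ^+ 2 / 2 * D w ^+ 2); first exact: L1Z.
    by apply/funext => w; ring.
  rewrite ExD; last 2 first.
    by apply: L1B => //; exact: L1_cst.
    rewrite (_ : (fun=> _) = fun w => rsqrt n ^+ 2 / 2 * D w ^+ 2); first exact: L1Z.
    by apply/funext => w; ring.
  rewrite ExB//; last exact: L1_cst.
  rewrite Ex_cst (_ : (fun w => _ / 2) = fun w => rsqrt n ^+ 2 / 2 * D w ^+ 2).
    rewrite ExZ// -/q rsqrt_sqr /x.
    rewrite (_ : n%:R^-1 / 2 * q = q / 2 / n%:R); last by field.
    by rewrite -mulrBr; congr (_ * _); ring.
  by apply/funext => w; ring.
by rewrite -(subr0 (0 : R)); apply: cvgB.
Unshelve. all: by end_near. Qed.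

(** The linear term vanishes since D is centred. *)
Lemma sin_small_increment :
  n%:R * Ex P (fun w => sin (rsqrt n * D w)) @[n --> \oo] --> 0.
Proof.
have iD1 := L1_of_sqr mD iD.
pose X n w := n%:R * (sin (rsqrt n * D w) - rsqrt n * D w).
have EX : Ex P (X n) @[n --> \oo] --> 0.
  rewrite -(Ex_cst P 0); apply: (@dominated_Ex _ _ _ _ _ _ (fun w => D w ^+ 2)) => //.
  - by move=> n; apply: measurable_funM => //; exact: measurable_funB.
  - move=> w; apply: (cvg0_of_sqr_le (v := fun n => (rsqrt n * `|D w| ^+ 3) ^+ 2)); last first.
      have := cvg_cst_rsqrt (`|D w| ^+ 3); move=> h.
      by rewrite -[X in _ --> X](mulr0 (0 : R)); apply: cvgM.
    apply: nearW => n.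
    rewrite -(real_normK (num_real (X n w))) lerXn2r ?nnegrE//.
      by rewrite mulr_ge0 ?rsqrt_ge0// exprn_ge0.
    rewrite /X normrM ger0_norm//.
    apply: (le_trans (ler_wpM2l _ (sin_taylor3 _))) => //.
    rewrite normrM (ger0_norm (rsqrt_ge0 n)) exprMn.
    have h1 := natr_rsqrt_sqr_le n; have h2 := rsqrt_ge0 n.
    have h3 : 0 <= `|D w| ^+ 3 by rewrite exprn_ge0.
    have h4 := mulr_ge0 h2 h3.
    rewrite (_ : n%:R * (rsqrt n ^+ 3 * `|D w| ^+ 3 / 2) =
      n%:R * rsqrt n ^+ 2 / 2 * (rsqrt n * `|D w| ^+ 3)); last by ring.
    rewrite ler_piMl//; lra.
  - move=> n w; rewrite /X normrM ger0_norm//.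
    apply: (le_trans (ler_wpM2l _ (sin_taylor2 _))) => //.
    by rewrite exprMn mulrA ler_piMl ?sqr_ge0// natr_rsqrt_sqr_le.
have -> : (fun n => n%:R * Ex P (fun w => sin (rsqrt n * D w))) = (fun n => Ex P (X n)).
  apply/funext => n; rewrite /X ExZ; last by apply: L1B => //; exact: L1Z.
  by rewrite ExB//; [rewrite ExZ// D_mean mulr0 subr0|exact: L1Z].
exact: EX.
Qed.

End small_increments.

Lemma measurable_cos_comp (d : measure_display) (T : measurableType d)
    (R : realType) (f : T -> R) :
  measurable_fun setT f -> measurable_fun setT (fun w => cos (f w)).
Proof.
move=> mf; apply: measurableT_comp => //; apply: continuous_measurable_fun.
exact: continuous_cos.
Qed.

Lemma measurable_sin_comp (d : measure_display) (T : measurableType d)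
    (R : realType) (f : T -> R) :
  measurable_fun setT f -> measurable_fun setT (fun w => sin (f w)).
Proof.
move=> mf; apply: measurableT_comp => //; apply: continuous_measurable_fun.
exact: continuous_sin.
Qed.

Lemma L1_cos (d : measure_display) (T : measurableType d) (R : realType)
    (P : probability T R) (f : T -> R) :
  measurable_fun setT f -> L1 P (fun w => cos (f w)).
Proof.
move=> mf; apply: (@L1_bounded _ _ _ _ 1); first exact: measurable_cos_comp.
by move=> w; exact: cos_max.
Qed.

Section one_step.
Context (d : measure_display) (T : measurableType d) (R : realType).
Variable P : probability T R.
Variables (Y : nat -> T -> R) (t : nat).
Hypothesis mY : forall j, measurable_fun setT (Y j).
Variables (th sg eta : T -> R) (fp fm : R -> R).
Hypothesis th_past : past_measurable Y t th.
Hypothesis sg_past : past_measurable Y t sg.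
Hypothesis sgE : forall w, sg w = 1 \/ sg w = - 1.
Hypothesis eta_indep : independent_of_past P eta Y t.
Hypothesis meta : measurable_fun setT eta.
Hypothesis mfp : measurable_fun setT fp.
Hypothesis mfm : measurable_fun setT fm.

Let D w := if sg w == 1 then fp (eta w) else fm (eta w).

(** Adding an increment whose shape depends on the past only through a sign:
    each of the four terms of the expansion is the product of a function of
    the past and a function of the innovation. *)
Lemma one_step (r : R) :
  `|Ex P (fun w => cos (th w + D w)) - r * Ex P (fun w => cos (th w))| <=
  `|Ex P (fun w => cos (fp (eta w))) - r| + `|Ex P (fun w => cos (fm (eta w))) - r|
  + (`|Ex P (fun w => sin (fp (eta w)))| + `|Ex P (fun w => sin (fm (eta w)))|).
Proof.
(* (1 + s * sg) / 2 is the indicator of the event sg = s *)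
pose W (s : R) (g : R -> R) w := 2^-1 * (1 + s * sg w) * g (th w).
have W_past (s : R) (g : R -> R) : measurable_fun setT g -> past_measurable Y t (W s g).
  move=> mg; apply: measurable_funM; last exact: measurableT_comp.
  by apply: measurable_funM => //; apply: measurable_funD => //; exact: measurable_funM.
have mcos : measurable_fun setT (@cos R).
  by apply: continuous_measurable_fun; exact: continuous_cos.
have msin : measurable_fun setT (@sin R).
  by apply: continuous_measurable_fun; exact: continuous_sin.
have W_le (s : R) (g : R -> R) : s = 1 \/ s = -1 -> (forall x, `|g x| <= 1) -> forall w, `|W s g w| <= 1.
  move=> s1 g1 w; rewrite /W normrM mulr_ile1//.
  by case: (sgE w) => ->; case: s1 => ->; rewrite ger0_norm; lra.
have iW (s : R) (g : R -> R) : measurable_fun setT g -> s = 1 \/ s = -1 ->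
    (forall x, `|g x| <= 1) -> L1 P (W s g).
  move=> mg s1 g1; apply: (@L1_bounded _ _ _ _ 1); last exact: W_le.
  by apply: (past_measurableT mY (t := t)); exact: W_past.
have EW (s : R) (g : R -> R) : measurable_fun setT g -> s = 1 \/ s = -1 ->
    (forall x, `|g x| <= 1) -> `|Ex P (W s g)| <= 1.
  move=> mg s1 g1; rewrite -[leRHS](Ex_cst P 1); apply: Ex_abs_le.
  - exact: iW.
  - exact: L1_cst.
  - exact: W_le.
have prod (s : R) (g h : R -> R) : measurable_fun setT g -> measurable_fun setT h ->
    s = 1 \/ s = -1 -> (forall x, `|g x| <= 1) -> (forall x, `|h x| <= 1) ->
    L1 P (fun w => h (eta w) * W s g w) /\
    Ex P (fun w => h (eta w) * W s g w) = Ex P (fun w => h (eta w)) * Ex P (W s g).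
  move=> mg mh s1 g1 h1; apply: (indep_mul (X := h \o eta)).
  - apply: (@L1_bounded _ _ _ _ 1); first exact: (measurableT_comp mh meta).
    by move=> w; exact: h1.
  - exact: iW.
  - have -> : W s g = id \o W s g by [].
    by apply: indep_comp => //; apply: (past_indep eta_indep); exact: W_past.
have mcp : measurable_fun setT (fun x => cos (fp x)) by exact: measurable_cos_comp.
have mcm : measurable_fun setT (fun x => cos (fm x)) by exact: measurable_cos_comp.
have msp : measurable_fun setT (fun x => sin (fp x)) by exact: measurable_sin_comp.
have msm : measurable_fun setT (fun x => sin (fm x)) by exact: measurable_sin_comp.
have c1 x : `|@cos R x| <= 1 by exact: cos_max.
have s1 x : `|@sin R x| <= 1 by exact: sin_max.
have p : (1 : R) = 1 \/ (1 : R) = -1 by left.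
have m : (-1 : R) = 1 \/ (-1 : R) = -1 by right.
have [i1 e1] := prod 1 cos _ mcos mcp p c1 (fun=> c1 _).
have [i2 e2] := prod (-1) cos _ mcos mcm m c1 (fun=> c1 _).
have [i3 e3] := prod 1 sin _ msin msp p s1 (fun=> s1 _).
have [i4 e4] := prod (-1) sin _ msin msm m s1 (fun=> s1 _).
have -> : (fun w => cos (th w + D w)) = (fun w =>
    (cos (fp (eta w)) * W 1 cos w + cos (fm (eta w)) * W (-1) cos w) -
    (sin (fp (eta w)) * W 1 sin w + sin (fm (eta w)) * W (-1) sin w)).
  apply/funext => w; rewrite cosD /W /D.
  case: (sgE w) => ->; first by rewrite eqxx; field.
  have -> : (-1 == 1 :> R) = false by apply/negbTE; rewrite lt_eqF; lra.
  by field.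
have -> : (fun w => cos (th w)) = (fun w => W 1 cos w + W (-1) cos w).
  by apply/funext => w; rewrite /W; field.
rewrite ExB ?ExD ?e1 ?e2 ?e3 ?e4; try by [|exact: L1D|exact: iW].
have := EW 1 cos mcos p c1; have := EW (-1) cos mcos m c1.
have := EW 1 sin msin p s1; have := EW (-1) sin msin m s1.
move: (Ex P (W 1 cos)) (Ex P (W (-1) cos)) (Ex P (W 1 sin)) (Ex P (W (-1) sin)).
move=> x1 x2 x3 x4 h4 h3 h2 h1.
set c1' := Ex P _; set c2' := Ex P _; set s1' := Ex P _; set s2' := Ex P _.
rewrite (_ : _ - _ = (c1' - r) * x1 + (c2' - r) * x2 - (s1' * x3 + s2' * x4)); last by ring.
apply: (le_trans (ler_normB _ _)); apply: lerD;
  apply: (le_trans (ler_normD _ _)); apply: lerD; rewrite normrM ler_piMr//.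
Qed.

End one_step.

Section martingale_clt.
Context (d : measure_display) (T : measurableType d) (R : realType).
Variable P : probability T R.
Variables (Y eta e sg : nat -> T -> R) (kappa : R).
Hypothesis mY : forall j, measurable_fun setT (Y j).
Hypothesis meta : forall i, measurable_fun setT (eta i).
Hypothesis e_past : forall i, past_measurable Y i.+2 (e i).
Hypothesis sg_past : forall i, past_measurable Y i.+1 (sg i).
Hypothesis sgE : forall i w, sg i w = 1 \/ sg i w = - 1.
Hypothesis eE : forall i, {ae P, forall w, e i w = sg i w * eta i w}.
Hypothesis eta_indep : forall i, independent_of_past P (eta i) Y i.+1.
Hypothesis eta_id : forall (g : R -> R) i, measurable_fun setT g ->
  (forall x, `|g x| <= 1) -> Ex P (fun w => g (eta i w)) = Ex P (fun w => g (eta 0%N w)).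
Hypothesis eta4 : L1 P (fun w => eta 0%N w ^+ 4).
Hypothesis E1 : Ex P (eta 0%N) = 0.
Hypothesis E2 : Ex P (fun w => eta 0%N w ^+ 2) = 1.
Hypothesis E3 : Ex P (fun w => eta 0%N w ^+ 3) = 0.
Hypothesis E4 : Ex P (fun w => eta 0%N w ^+ 4) = kappa.

Let pow_le (x : R) k : (k <= 4)%N -> `|x| ^+ k <= 1 + x ^+ 4.
Proof.
move=> k4; have -> : x ^+ 4 = `|x| ^+ 4.
  by rewrite -normrX ger0_norm// exprn_even_ge0.
have [x1|x1] := leP `|x| 1.
  by rewrite (le_trans (exprn_ile1 _ (normr_ge0 x) x1))// lerDl exprn_ge0.
by rewrite (le_trans (ler_weXn2l (ltW x1) k4))// lerDr.
Qed.

Let ieta k : (k <= 4)%N -> L1 P (fun w => eta 0%N w ^+ k).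
Proof.
move=> k4; apply: (@L1_dom _ _ _ _ (fun w => 1 + eta 0%N w ^+ 4)).
- exact: measurable_funX.
- by apply: L1D => //; exact: L1_cst.
- by move=> w; rewrite normrX pow_le.
Qed.

Variables u v : R.

Let f s (x : R) : R := u * (s * x) + v * (x ^+ 2 - 1).

Let mf s : measurable_fun setT (f s).
Proof.
apply: measurable_funD; first by apply: measurable_funM.
by apply: measurable_funM => //; apply: measurable_funB => //; exact: measurable_funX.
Qed.

Let q := u ^+ 2 + v ^+ 2 * (kappa - 1).

Let ie1 : L1 P (eta 0%N).
Proof.
by rewrite (_ : eta 0%N = fun w => eta 0%N w ^+ 1)//; exact: ieta.
Qed.

Let fE s : Ex P (fun w => f s (eta 0%N w)) = 0.
Proof.
rewrite (_ : (fun=> _) = fun w => (u * s) * eta 0%N w + v * (eta 0%N w ^+ 2 - 1)).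
  have i2 : L1 P (fun w => eta 0%N w ^+ 2) by exact: ieta.
  have i3 : L1 P (fun w => eta 0%N w ^+ 2 - 1) by apply: L1B => //; exact: L1_cst.
  rewrite ExD ?ExZ//; [|exact: L1Z|exact: L1Z].
  rewrite E1 ExB//; last exact: L1_cst.
  by rewrite E2 Ex_cst subrr !mulr0 addr0.
by apply/funext => w; rewrite /f; ring.
Qed.

(** The cross term is a multiple of E eta ^ 3 - E eta = 0: the variance does not
    depend on the sign. *)
Let f2E s : s ^+ 2 = 1 ->
  L1 P (fun w => f s (eta 0%N w) ^+ 2) /\ Ex P (fun w => f s (eta 0%N w) ^+ 2) = q.
Proof.
move=> s2; pose p k w := eta 0%N w ^+ k.
have ip k : (k <= 4)%N -> L1 P (p k) by exact: ieta.
have i1 := L1Z (v ^+ 2) (ip 4 isT).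
have i2 := L1Z (2 * u * v * s) (ip 3 isT).
have i3 := L1Z (u ^+ 2 - 2 * v ^+ 2) (ip 2 isT).
have i4 := L1Z (- (2 * u * v * s)) (ip 1 isT).
have i5 := L1_cst P (v ^+ 2).
have -> : (fun w => f s (eta 0%N w) ^+ 2) = (fun w => v ^+ 2 * p 4 w +
    (2 * u * v * s * p 3 w + ((u ^+ 2 - 2 * v ^+ 2) * p 2 w +
    (- (2 * u * v * s) * p 1 w + cst (v ^+ 2) w)))).
  apply/funext => w; rewrite /f /p /=.
  rewrite (_ : (_ + _) ^+ 2 = u ^+ 2 * (s ^+ 2 * eta 0%N w ^+ 2) +
    2 * u * v * s * eta 0%N w * (eta 0%N w ^+ 2 - 1) +
    v ^+ 2 * (eta 0%N w ^+ 2 - 1) ^+ 2); last by ring.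
  by rewrite s2; ring.
have i6 := L1D i4 i5; have i7 := L1D i3 i6; have i8 := L1D i2 i7.
split; first exact: L1D.
rewrite (ExD i1 i8) (ExD i2 i7) (ExD i3 i6) (ExD i4 i5).
rewrite (ExZ _ (ip 4 isT)) (ExZ _ (ip 3 isT)) (ExZ _ (ip 2 isT)) (ExZ _ (ip 1 isT)).
rewrite /p E4 E3 E2 Ex_cst /q.
rewrite (_ : Ex P (fun w => eta 0%N w ^+ 1) = 0); last exact: E1.
by ring.
Qed.

Let inc i w := u * e i w + v * (e i w ^+ 2 - 1).

Let inc_past i : past_measurable Y i.+2 (inc i).
Proof.
apply: measurable_funD; apply: measurable_funM => //; first exact: e_past.
by apply: measurable_funB => //; apply: measurable_funX; exact: e_past.
Qed.

Let sum_past c n k :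
  past_measurable Y k.+1 (fun w => c + rsqrt R n * \sum_(i < k) inc i w).
Proof.
apply: measurable_funD => //; apply: measurable_funM => //.
elim: k => [|k IH].
  rewrite (_ : (fun=> _) = cst 0) //.
  by apply/funext => w; rewrite big_ord0.
rewrite (_ : (fun=> _) = fun w => \sum_(i < k) inc i w + inc k w).
  by apply: measurable_funD; [exact: (past_mono _ IH)|exact: inc_past].
by apply/funext => w; rewrite big_ord_recr.
Qed.

Let r n := expR (- (q / 2 / n%:R)).

Let errc s n := `|Ex P (fun w => cos (rsqrt R n * f s (eta 0%N w))) - r n|.
Let errs s n := `|Ex P (fun w => sin (rsqrt R n * f s (eta 0%N w)))|.
Let err n := errc 1 n + errc (-1) n + (errs 1 n + errs (-1) n).

Let mscaled s n : measurable_fun setT (fun x => rsqrt R n * f s x).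
Proof. by apply: measurable_funM => //; exact: mf. Qed.

Let step c n k :
  `|Ex P (fun w => cos (c + rsqrt R n * \sum_(i < k.+1) inc i w)) -
    r n * Ex P (fun w => cos (c + rsqrt R n * \sum_(i < k) inc i w))| <= err n.
Proof.
have sp1 := @sum_past c n k.
have mT (t : nat) (X : T -> R) (h : past_measurable Y t X) : measurable_fun setT X
  := past_measurableT mY h.
have := one_step mY sp1 (@sg_past k) (sgE k) (@eta_indep k) (meta k)
  (mscaled 1 n) (mscaled (-1) n) (r n).
rewrite /err /errc /errs.
have idc s : Ex P (fun w => cos (rsqrt R n * f s (eta k w))) =
    Ex P (fun w => cos (rsqrt R n * f s (eta 0%N w))).
  apply: (eta_id (g := fun x => cos (rsqrt R n * f s x))) => [|x].
    exact: (measurable_cos_comp (mscaled s n)).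
  exact: cos_max.
have ids s : Ex P (fun w => sin (rsqrt R n * f s (eta k w))) =
    Ex P (fun w => sin (rsqrt R n * f s (eta 0%N w))).
  apply: (eta_id (g := fun x => sin (rsqrt R n * f s x))) => [|x].
    exact: (measurable_sin_comp (mscaled s n)).
  exact: sin_max.
rewrite !idc !ids; apply: le_trans.
rewrite le_eqVlt; apply/orP; left; apply/eqP; congr (`|_ - _|).
apply: Ex_ae.
- by apply: measurable_cos_comp; exact: (mT _ _ (@sum_past c n k.+1)).
- apply: measurable_cos_comp; apply: measurable_funD; first exact: (mT _ _ sp1).
  apply: measurable_fun_ifT.
  + apply: (measurable_fun_eqr (mT _ _ (@sg_past k))) => //.
  + exact: (measurableT_comp (mscaled 1 n) (meta k)).
  + exact: (measurableT_comp (mscaled (-1) n) (meta k)).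
apply: filterS (eE k) => w ew; congr cos.
rewrite big_ord_recr /= mulrDr addrA; congr (_ + _).
rewrite /inc ew /f; case: (sgE k w) => ->.
  by rewrite eqxx !mul1r.
have -> : (-1 == 1 :> R) = false by apply/negbTE; rewrite lt_eqF; lra.
by rewrite exprMn sqrrN expr1n mul1r.
Qed.

(** The factors r n are at most 1, so that the errors of the steps add up. *)
Let telescope c n k :
  `|Ex P (fun w => cos (c + rsqrt R n * \sum_(i < k) inc i w)) - r n ^+ k * cos c|
    <= k%:R * err n.
Proof.
elim: k => [|k IH].
  rewrite expr0 mul1r mul0r (_ : (fun=> _) = fun=> cos c) ?Ex_cst ?subrr ?normr0//.
  by apply/funext => w; rewrite big_ord0 mulr0 addr0.
have q0 : 0 <= q.
  have [i2 <-] := f2E (expr1n R 2); by apply: Ex_ge0 => w; exact: sqr_ge0.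
have r0 : 0 <= r n <= 1.
  by rewrite expR_ge0 -[leRHS]expR0 ler_expR oppr_le0 !divr_ge0.
have := step c n k; move: IH; rewrite exprS -natr1.
set A := Ex P _; set B := Ex P _ => IH st.
rewrite (_ : B - r n * r n ^+ k * cos c =
  (B - r n * A) + r n * (A - r n ^+ k * cos c)); last by ring.
apply: (le_trans (ler_normD _ _)); rewrite addrC mulrDl mul1r; apply: lerD => //.
rewrite normrM; case/andP: r0 => r0 r1; rewrite (ger0_norm r0).
by rewrite (le_trans _ IH)// ler_piMl.
Qed.

Let err_cvg : n%:R * err n @[n --> \oo] --> 0.
Proof.
have mD s : measurable_fun setT (fun w => f s (eta 0%N w)).
  exact: (measurableT_comp (mf s) (meta 0%N)).
have H s : s ^+ 2 = 1 -> n%:R * errc s n @[n --> \oo] --> 0 /\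
    n%:R * errs s n @[n --> \oo] --> 0.
  move=> s2; have [i2 e2] := f2E s2.
  have := cos_small_increment (mD s) i2; have := sin_small_increment (mD s) i2 (fE s).
  rewrite e2 => /(iffRL (norm_cvg0P _)) h1 /(iffRL (norm_cvg0P _)) h2.
  split; [apply: cvg_trans h2|apply: cvg_trans h1]; apply: near_eq_cvg;
    by apply: nearW => n; rewrite normrM ger0_norm.
have [h1 h2] := H 1 (expr1n R 2).
have [h3 h4] : _ /\ _ := H (-1) (etrans (sqrrN 1) (expr1n R 2)).
have -> : (fun n => n%:R * err n) = (fun n => (n%:R * errc 1 n + n%:R * errc (-1) n) +
   (n%:R * errs 1 n + n%:R * errs (-1) n)).
  by apply/funext => n; rewrite /err !mulrDr.
rewrite -[X in _ --> X](addr0 (0 : R)); apply: cvgD.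
  by rewrite -[X in _ --> X](addr0 (0 : R)); apply: cvgD.
by rewrite -[X in _ --> X](addr0 (0 : R)); apply: cvgD.
Qed.

(** Each step contributes the factor r n whatever the sign of the past, and the
    n-th power of r n is the exponential of the limit. *)
Lemma martingale_cf c :
  Ex P (fun w => cos (c + rsqrt R n * \sum_(i < n)
     (u * e i w + v * (e i w ^+ 2 - 1)))) @[n --> \oo] -->
  expR (- ((u ^+ 2 + v ^+ 2 * (kappa - 1)) / 2)) * cos c.
Proof.
rewrite -/q.
suff : Ex P (fun w => cos (c + rsqrt R n * \sum_(i < n) inc i w)) -
    expR (- (q / 2)) * cos c @[n --> \oo] --> 0.
  by move/subr_cvg0.
apply/norm_cvg0P; apply: (@squeeze_cvgr _ _ _ _ (cst 0) (fun n => n%:R * err n)).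
- near=> n; rewrite normr_ge0 /=.
  have n0 : (0 < n)%N by near: n; exact: nbhs_infty_gt.
  have -> : expR (- (q / 2)) = r n ^+ n.
    by rewrite -expRM_natr mulNr divfK// pnatr_eq0 -lt0n.
  exact: telescope.
- exact: cvg_cst.
- exact: err_cvg.
Unshelve. all: by end_near. Qed.

End martingale_clt.

(** * The characteristic function of the normal law *)

Section normal_law.
Context (R : realType).
Local Notation lam := (@lebesgue_measure R).
Let N : probability (measurableTypeR R) R := normal_prob (0 : R) 1.
Let phi (x : R) : R := normal_peak (1 : R) * expR (- (x ^+ 2 / 2)).

Let phiE x : normal_pdf 0 1 x = phi x.
Proof.
rewrite normal_pdfE ?oner_eq0// /phi /normal_fun; congr (_ * expR _).
by rewrite subr0 expr1n mulNr.
Qed.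

Let phi_gt0 x : 0 < phi x.
Proof. by rewrite mulr_gt0 ?expR_gt0// normal_peak_gt0// oner_neq0. Qed.

Let mphi : measurable_fun setT phi.
Proof.
have -> : phi = normal_pdf 0 1 by apply/funext => x; rewrite phiE.
exact: measurable_normal_pdf.
Qed.

Let dom : N `<< lam. Proof. exact: normal_prob_dominates. Qed.

(** The density of a normal law is its Radon-Nikodym derivative, which is
    unique up to negligible sets. *)
Let ge0_integralN (f : measurableTypeR R -> \bar R) :
  measurable_fun setT f -> (forall x, 0 <= f x)%E ->
  (\int[N]_x f x = \int[lam]_x (f x * (phi x)%:E))%E.
Proof.
move=> mf f0.
rewrite -(Radon_Nikodym_SigmaFinite.change_of_variables dom f0)//.
have ig := Radon_Nikodym_SigmaFinite.f_integrable dom.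
apply: ae_eq_integral => //.
- by apply: emeasurable_funM => //; exact: measurable_int ig.
- by apply: emeasurable_funM => //=; exact/measurable_EFinP.
- apply: ae_eqe_mul2l; apply: integral_ae_eq => //=; first exact/measurable_EFinP.
  move=> E _ mE; rewrite -Radon_Nikodym_SigmaFinite.f_integral//.
  by apply: eq_integral => x _; rewrite phiE.
Qed.

Let L1N (f : measurableTypeR R -> R) : measurable_fun setT f ->
  lam.-integrable setT (fun x => (f x * phi x)%:E) -> L1 N f.
Proof.
move=> mf /integrableP[_ foo]; apply/integrableP; split; first exact/measurable_EFinP.
rewrite ge0_integralN//; last first.
  by apply: measurableT_comp => //; exact/measurable_EFinP.
apply: le_lt_trans foo; rewrite le_eqVlt; apply/orP; left; apply/eqP.
by apply: eq_integral => x _; rewrite /= normrM EFinM (ger0_norm (ltW (phi_gt0 x))).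
Qed.

Let ExN (f : measurableTypeR R -> R) : L1 N f ->
  lam.-integrable setT (fun x => (f x * phi x)%:E) /\
  (Ex N f)%:E = (\int[lam]_x (f x * phi x)%:E)%E.
Proof.
move=> iF; have mf := L1_measurable iF.
have ilam : lam.-integrable setT (fun x => (f x * phi x)%:E).
  apply/integrableP; split; first by apply/measurable_EFinP; exact: measurable_funM.
  move/integrableP : (iF) => [_]; rewrite ge0_integralN//; last first.
    by apply: measurableT_comp => //; exact/measurable_EFinP.
  apply: le_lt_trans; rewrite le_eqVlt; apply/orP; left; apply/eqP.
  by apply: eq_integral => x _; rewrite /= normrM EFinM (ger0_norm (ltW (phi_gt0 x))).
split => //; rewrite ExE//.
rewrite -(Radon_Nikodym_change_of_variables dom)//=.
apply: ae_eq_integral => //.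
- by apply: emeasurable_funM => //=; exact/measurable_EFinP.
- by apply/measurable_EFinP; exact: measurable_funM.
- under [X in ae_eq _ _ _ X]eq_fun do rewrite EFinM.
  apply: ae_eqe_mul2l; rewrite Radon_NikodymE//=.
  case: cid => /= h [h1 h2 h3].
  apply: integral_ae_eq => //=; first exact/measurable_EFinP.
  move=> E _ mE; rewrite -h3//=.
  by apply: eq_integral => x _; rewrite phiE.
Qed.

(** x ^ 2 <= 4 exp (x ^ 2 / 4), so that x ^ 2 times the density is dominated by
    a multiple of the density of variance 2. *)
Let idsq : L1 N (fun x => x ^+ 2).
Proof.
apply: L1N; first exact: measurable_funX.
pose K := 4 * normal_peak (1 : R) / normal_peak (Num.sqrt 2).
have s2 : Num.sqrt 2 != 0 :> R by rewrite gt_eqF// sqrtr_gt0.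
have p2 : 0 < normal_peak (Num.sqrt 2 : R) by exact: normal_peak_gt0.
have p1 : 0 < normal_peak (1 : R) by rewrite normal_peak_gt0// oner_neq0.
have iK : lam.-integrable setT (fun x => (K%:E * (normal_pdf 0 (Num.sqrt 2) x)%:E)%E).
  by apply: integrableZl => //; exact: integrable_normal_pdf.
apply: (le_integrable measurableT _ _ iK).
  by apply/measurable_EFinP; apply: measurable_funM => //; exact: measurable_funX.
move=> x _ /=; rewrite lee_fin ger0_norm; last first.
  by rewrite mulr_ge0 ?sqr_ge0// ltW.
have K0 : 0 <= K by rewrite /K divr_ge0 ?mulr_ge0 ?(ltW p1) ?(ltW p2).
rewrite [leRHS]ger0_norm; last by rewrite mulr_ge0 ?normal_pdf_ge0.
rewrite normal_pdfE// /normal_fun /phi /K subr0 sqr_sqrtr//.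
rewrite [leRHS](_ : _ = normal_peak 1 * (4 * expR (- x ^+ 2 / (2 *+ 2)))); last first.
  by field; rewrite gt_eqF.
rewrite mulrCA ler_pM2l//.
have -> : - (x ^+ 2 / 2) = - (x ^+ 2 / 4) + - x ^+ 2 / (2 *+ 2).
  by rewrite -mulr_natr; field.
rewrite expRD mulrA ler_pM2r ?expR_gt0//.
rewrite expRN ler_pdivrMr ?expR_gt0//.
have := expR_ge1Dx (x ^+ 2 / 4); lra.
Qed.

Let dphi (x : R) : is_derive x 1 phi (- x * phi x).
Proof.
have d0 : is_derive x (1 : R) (id : R -> R) 1 by exact: is_derive_id.
have d1 := is_deriveZ (- 2^-1) (is_deriveX 2 d0).
have d2 := is_derive1_comp (is_derive_expR _) d1.
have d3 := is_deriveZ (normal_peak (1 : R)) d2.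
have -> : phi = (normal_peak 1 *: (expR \o (- 2^-1 *: (id ^+ 2)))).
  apply/funext => y; rewrite /phi; congr (_ * expR _).
  change (- (y ^+ 2 / 2) = - 2^-1 * y ^+ 2); ring.
apply: (is_derive_eq d3).
change (normal_peak 1 * (expR (- 2^-1 * x ^+ 2) * (- 2^-1 * ((2 * x ^+ 1) * 1))) =
  - x * (normal_peak 1 * expR (- 2^-1 * x ^+ 2))).
by field.
Qed.

Let dlin (u c x : R) : is_derive x 1 (fun x => u * x + c) u.
Proof.
have d0 : is_derive x (1 : R) (id : R -> R) 1 by exact: is_derive_id.
have d1 := is_deriveD (is_deriveZ u d0) (is_derive_cst c x 1).
apply: (is_derive_eq d1).
change (u * 1 + 0 = u); ring.
Qed.

Let dsin (u c x : R) : is_derive x 1 (fun x => sin (u * x + c)) (u * cos (u * x + c)).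
Proof.
by apply: (is_derive_eq (is_derive1_comp (is_derive_sin _) (dlin u c x))); rewrite mulrC.
Qed.

Let dcos (u c x : R) : is_derive x 1 (fun x => cos (u * x + c)) (- u * sin (u * x + c)).
Proof.
apply: (is_derive_eq (is_derive1_comp (is_derive_cos _) (dlin u c x))).
by rewrite mulrC mulrN mulNr.
Qed.

Let continuous_of_derive (f f' : R -> R) :
  (forall x : R, is_derive x 1 f (f' x)) -> continuous f.
Proof.
move=> df x; apply: differentiable_continuous; apply/derivable1_diffP.
by have [] := df x.
Qed.

Let mlin (u c : R) : measurable_fun setT (fun x : measurableTypeR R => u * x + c).
Proof. by apply: measurable_funD => //; exact: measurable_funM. Qed.

Let Z1 : L1 N (fun x => x).
Proof. by apply: L1_of_sqr idsq. Qed.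

Let iZsin (u c : R) : L1 N (fun x => x * sin (u * x + c)).
Proof.
apply: (L1_dom _ (L1_abs Z1)) => [|x].
  by apply: measurable_funM => //; exact: measurable_sin_comp.
by rewrite normrM ler_piMr// sin_max.
Qed.

(** Integration by parts against the Gaussian density: the difference of the two
    integrands is the derivative of - sin (u x + c) phi x, which vanishes at
    infinity. *)
Let stein (u c : R) : Ex N (fun x => x * sin (u * x + c)) =
  u * Ex N (fun x => cos (u * x + c)).
Proof.
pose g x := x * sin (u * x + c) - u * cos (u * x + c).
have ig : L1 N g.
  by apply: L1B; [exact: iZsin|apply: L1Z; exact: (L1_cos _ (mlin u c))].
suff g0 : Ex N g = 0.
  apply/eqP; rewrite -subr_eq0 -[X in _ - X]ExZ; last exact: (L1_cos _ (mlin u c)).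
  rewrite -ExB; [|exact: iZsin|apply: L1Z; exact: (L1_cos _ (mlin u c))].
  exact/eqP.
have [ilam e] := ExN ig.
pose F x := - (sin (u * x + c) * phi x).
have dF (x : R) : is_derive x 1 F (g x * phi x).
  have d1 := is_deriveN (is_deriveM (dsin u c x) (dphi x)).
  apply: (is_derive_eq d1).
  change (- (sin (u * x + c) * (- x * phi x) + phi x * (u * cos (u * x + c))) = g x * phi x).
  rewrite /g; ring.
have cF := continuous_of_derive dF.
have cg : continuous (fun x => g x * phi x).
  have cl : continuous (fun x : R => x) by move=> x; exact: cvg_id.
  move=> x; apply: cvgM; last exact: (continuous_of_derive dphi).
  apply: cvgB; apply: cvgM => //.
  - exact: (continuous_of_derive (dsin u c)).
  - exact: cvg_cst.
  - exact: (continuous_of_derive (dcos u c)).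
have ftc n : (\int[lam]_(x in `[(- n%:R)%R, n%:R]) (g x * phi x)%:E =
    (F n%:R)%:E - (F (- n%:R))%:E)%E.
  have [->|n0] := eqVneq n 0%N.
    by rewrite oppr0 set_itv1 integral_set1 -EFinB subrr.
  apply: continuous_FTC2.
  - by rewrite (@lt_trans _ _ 0)// ?oppr_lt0 ltr0n lt0n.
  - exact: continuous_subspaceT.
  - split.
    + by move=> x _; have [] := dF x.
    + by apply: cvg_at_right_filter; exact: cF.
    + by apply: cvg_at_left_filter; exact: cF.
  - by move=> x _; rewrite derive1E; have [_ ->] := dF x.
have F_lim : F n%:R - F (- n%:R) @[n --> \oo] --> 0.
  have phi_le (m : nat) (x : R) : x ^+ 2 = m.+1%:R ^+ 2 ->
      `|F x| <= 2 * normal_peak 1 * m.+1%:R^-1.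
    move=> xm; rewrite /F normrN normrM.
    rewrite (le_trans (ler_wpM2r _ (sin_max _)))// mul1r ger0_norm ?(ltW (phi_gt0 _))// /phi xm.
    rewrite -mulrA mulrCA ler_pM2l; last by rewrite normal_peak_gt0// oner_neq0.
    rewrite expRN ler_pdivlMr ?ltr0n// mulrC ler_pdivrMr ?expR_gt0//.
    rewrite (@le_trans _ _ (2 * (1 + m.+1%:R ^+ 2 / 2)))//; last first.
      by rewrite ler_pM2l// expR_ge1Dx.
    have : 1 <= m.+1%:R :> R by rewrite ler1n.
    move: (m.+1%:R : R) => M M1; nra.
  rewrite -(cvg_shiftS (fun n => F n%:R - F (- n%:R))) /=.
  apply/norm_cvg0P.
  apply: (@squeeze_cvgr _ _ _ _ (cst 0) (fun n => 4 * normal_peak 1 * n.+1%:R^-1)).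
  - apply: nearW => n; rewrite normr_ge0 /=.
    rewrite (le_trans (ler_normB _ _))//.
    have h1 := phi_le n n.+1%:R erefl.
    have h2 := phi_le n (- n.+1%:R) (sqrrN _).
    apply: (le_trans (lerD h1 h2)); rewrite le_eqVlt; apply/orP; left; apply/eqP.
    ring.
  - exact: cvg_cst.
  - rewrite -(mulr0 (4 * normal_peak 1)); apply: cvgMr; exact: cvg_harmonic.
pose h (n : nat) := (fun x => (g x * phi x)%:E) \_ `[(- n%:R : R), n%:R].
have [_ _ hlim] : [/\ lam.-integrable setT (fun x => (g x * phi x)%:E),
    [sequence (\int[lam]_x `|h n x - (g x * phi x)%:E|)%E]_n @ \oo --> 0%E &
    [sequence (\int[lam]_x (h n x))%E]_n @ \oo --> (\int[lam]_x (g x * phi x)%:E)%E].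
  have mg : measurable_fun setT (fun x => (g x * phi x)%:E).
    by case/integrableP : ilam.
  apply: (@dominated_convergence _ _ _ lam setT measurableT _ _
    (fun x => `|(g x * phi x)%:E|)%E) => //.
  - move=> n; apply/(measurable_restrictT _ _).1 => //.
    exact: measurable_funTS.
  - apply: aeW => x _; apply: cvg_near_cst.
    have xN : x < (Num.trunc `|x|).+1%:R by rewrite (le_lt_trans (ler_norm _))// truncnS_gt.
    have Nx : - (Num.trunc `|x|).+1%:R < x.
      by rewrite ltrNl (le_lt_trans _ (truncnS_gt _))// -normrN ler_norm.
    exists (Num.trunc `|x|).+1 => // n /= Nn; rewrite /h patchE ifT// inE /= in_itv /=.
    have : (Num.trunc `|x|).+1%:R <= n%:R :> R by rewrite ler_nat.
    by move=> NnR; apply/andP; split; lra.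
  - exact: integrable_abse.
  - apply: aeW => x n _; rewrite /h patchE; case: ifPn => // _.
    by rewrite abse0.
have hE n : (\int[lam]_x h n x = (F n%:R - F (- n%:R))%:E)%E.
  by rewrite EFinB -ftc [RHS]integral_mkcond.
apply: EFin_inj; rewrite e -(cvg_lim (@ereal_hausdorff R) hlim).
have F_elim : (F n%:R - F (- n%:R))%:E @[n --> \oo] --> (0 : R)%:E.
  by apply: cvg_EFin => //; exact: nearW.
rewrite -[RHS](cvg_lim (@ereal_hausdorff R) F_elim).
by congr (lim (_ @ \oo)); apply/funext => n; rewrite /= hE.
Qed.

Let G c u := Ex N (fun x => cos (u * x + c)).

Lemma is_derive_of_quadratic (f : R -> R) (x df K : R) : 0 <= K ->
  (forall h, `|f (x + h) - f x - h * df| <= K * h ^+ 2) -> is_derive x 1 f df.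
Proof.
move=> K0 fK.
have H : h^-1 *: (f (h *: 1 + x) - f x) @[h --> 0^'] --> df.
  apply/cvgrPdist_le => e e0.
  have K1 : 0 < K + 1 by rewrite ltr_wpDl.
  near=> h.
  have h0 : h != 0 by near: h; exact: nbhs_dnbhs_neq.
  have hs : `|h| <= e / (K + 1).
    near: h; apply: dnbhs0_le; exact: divr_gt0.
  rewrite distrC; have -> : h^-1 *: (f (h *: 1 + x) - f x) - df =
      h^-1 * (f (x + h) - f x - h * df).
    rewrite [h *: 1]mulr1 (addrC h) mulrBr; congr (_ - _).
    by rewrite mulrA mulVf ?mul1r.
  rewrite normrM normfV mulrC ler_pdivrMr ?normr_gt0//.
  rewrite (le_trans (fK h))// -(real_normK (num_real h)) expr2 mulrA.
  rewrite ler_wpM2r//; move: hs; rewrite ler_pdivlMr//.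
  have := normr_ge0 h; nra.
have dfx : derivable f x 1 by apply/cvg_ex; exists df.
by apply: DeriveDef => //; rewrite /derive; apply: cvg_lim.
Unshelve. all: by end_near. Qed.

(** Differentiation under the integral sign, by a second-order Taylor bound with
    integrable coefficient x ^ 2. *)
Let dG (c u : R) : is_derive u 1 (G c) (- (u * G c u)).
Proof.
rewrite -stein; pose M := Ex N (fun x => x ^+ 2).
have M0 : 0 <= M by apply: Ex_ge0 => x; exact: sqr_ge0.
apply: (@is_derive_of_quadratic _ _ _ (2 * M)) => [|h].
  by rewrite mulr_ge0.
have i1 : L1 N (fun x => cos ((u + h) * x + c)) by exact: (L1_cos _ (mlin (u + h) c)).
have i2 : L1 N (fun x => cos (u * x + c)) by exact: (L1_cos _ (mlin u c)).
have i3 := L1Z (- h) (iZsin u c).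
rewrite /G mulrN -mulNr -ExZ; last exact: iZsin.
rewrite -ExB// -ExB//; last exact: L1B.
have -> : 2 * M * h ^+ 2 = Ex N (fun x => (2 * h ^+ 2) * x ^+ 2).
  by rewrite ExZ//; rewrite -/M; ring.
apply: Ex_abs_le; [by apply: L1B => //; exact: L1B|exact: L1Z|move=> x].
have -> : (u + h) * x + c = (u * x + c) + h * x by ring.
move: (u * x + c) => a; rewrite cosD.
have -> : cos a * cos (h * x) - sin a * sin (h * x) - cos a - - h * (x * sin a) =
    - (cos a * (1 - cos (h * x))) - sin a * (sin (h * x) - h * x) by ring.
have h1 : `|cos a * (1 - cos (h * x))| <= (h * x) ^+ 2.
  rewrite normrM -[leRHS]mul1r; apply: ler_pM => //; first exact: cos_max.
  have /andP[z1 z2] := cos_bound (h * x); rewrite ger0_norm//.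
  by apply: (le_trans z2); have := sqr_ge0 (h * x); lra.
have h2 : `|sin a * (sin (h * x) - h * x)| <= (h * x) ^+ 2.
  rewrite normrM -[leRHS]mul1r; apply: ler_pM => //; first exact: sin_max.
  exact: sin_taylor2.
apply: (le_trans (ler_normB _ _)); rewrite normrN.
by apply: (le_trans (lerD h1 h2)); rewrite exprMn; lra.
Qed.

(** By [stein], u |-> E cos (u Z + c) solves G' = - u G, so that
    G u * exp (u^2 / 2) is constant. *)
Lemma normal_cf (u c : R) : Ex N (fun x => cos (u * x + c)) = expR (- (u ^+ 2 / 2)) * cos c.
Proof.
pose H x := expR (2^-1 * x ^+ 2) * G c x.
have dexp (x : R) : is_derive x 1 (fun x => expR (2^-1 * x ^+ 2)) (x * expR (2^-1 * x ^+ 2)).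
  have d0 : is_derive x (1 : R) (id : R -> R) 1 by exact: is_derive_id.
  have d1 := is_deriveZ (2^-1) (is_deriveX 2 d0).
  apply: (is_derive_eq (is_derive1_comp (is_derive_expR _) d1)).
  change (expR (2^-1 * x ^+ 2) * (2^-1 * ((2 * x ^+ 1) * 1)) = x * expR (2^-1 * x ^+ 2)).
  by field.
have dH (x : R) : is_derive x 1 H 0.
  apply: (is_derive_eq (is_deriveM (dexp x) (dG c x))).
  change (expR (2^-1 * x ^+ 2) * (- (x * G c x)) + G c x * (x * expR (2^-1 * x ^+ 2)) = 0).
  by ring.
have := is_derive_0_is_cst u 0 dH; rewrite /H expr0n mulr0 expR0 mul1r => e.
have -> : cos c = G c 0.
  rewrite /G (_ : (fun=> _) = fun=> cos c) ?Ex_cst//.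
  by apply/funext => x; rewrite mul0r add0r.
by rewrite -e -/(G c u) mulrA -expRD (_ : _ + _ = 0) ?expR0 ?mul1r//; ring.
Qed.

Lemma normal_L1 : L1 N (fun x => x).
Proof. exact: Z1. Qed.

End normal_law.

(** * Trigonometric approximation in the plane *)

Section trigonometric_approximation.
Context (R : realType).

(** Trigonometric polynomials in two variables.  Products with a single cosine,
    rather than arbitrary products, are generators: this is the closure property
    under which convergence of expectations propagates. *)
Inductive trig : (R * R -> R) -> Prop :=
| trig_cst c : trig (fun=> c)
| trig_add f g : trig f -> trig g -> trig (fun z => f z + g z)
| trig_mul_cos f u v c : trig f ->
    trig (fun z => f z * cos (c + (u * z.1 + v * z.2))).

Lemma trig_scale a f : trig f -> trig (fun z => a * f z).
Proof.
elim=> [c|g h _ IHg _ IHh|g u v c _ IHg].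
- exact: trig_cst.
- rewrite (_ : (fun=> _) = fun z => a * g z + a * h z); first exact: trig_add.
  by apply/funext => z; rewrite mulrDr.
- rewrite (_ : (fun=> _) = fun z => (a * g z) * cos (c + (u * z.1 + v * z.2))).
    exact: trig_mul_cos.
  by apply/funext => z; rewrite mulrA.
Qed.

Lemma trig_mul f g : trig f -> trig g -> trig (fun z => f z * g z).
Proof.
move=> tf; elim=> [c|g1 g2 _ IH1 _ IH2|g1 u v c _ IH].
- rewrite (_ : (fun=> _) = fun z => c * f z); first exact: trig_scale.
  by apply/funext => z; rewrite mulrC.
- rewrite (_ : (fun=> _) = fun z => f z * g1 z + f z * g2 z); first exact: trig_add.
  by apply/funext => z; rewrite mulrDr.
- rewrite (_ : (fun=> _) = fun z => (f z * g1 z) * cos (c + (u * z.1 + v * z.2))).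
    exact: trig_mul_cos.
  by apply/funext => z; rewrite mulrA.
Qed.

(** The n-th Bernstein polynomial of the values h, as the expectation of h at the
    number of heads in n tosses of a coin of bias t.  Recursion on the first toss
    replaces the identities on binomial coefficients. *)
Fixpoint bern (n : nat) (h : nat -> R) (t : R) : R :=
  if n is n'.+1 then
    (1 - t) * bern n' h t + t * bern n' (fun k => h k.+1) t
  else h 0%N.

Lemma trig_bern n (h : nat -> R * R -> R) s : (forall k, trig (h k)) -> trig s ->
  trig (fun z => bern n (h^~ z) (s z)).
Proof.
move=> th ts; elim: n h th => [|n IH] h th /=; first exact: th.
apply: trig_add; apply: trig_mul => //.
- rewrite (_ : (fun=> _) = fun z => 1 + (-1) * s z).
    by apply: trig_add; [exact: trig_cst|exact: trig_scale].
  by apply/funext => z; rewrite mulN1r.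
- exact: IH.
- by apply: IH => k; exact: th.
Qed.

Lemma bern_affine n (h : nat -> R) a b t :
  bern n (fun k => a + b * h k) t = a + b * bern n h t.
Proof. by elim: n h => [|n IH] h //=; rewrite !IH; ring. Qed.

Lemma bern_dist n (h b : nat -> R) c t : 0 <= t <= 1 ->
  (forall k, (k <= n)%N -> `|h k - c| <= b k) ->
  `|bern n h t - c| <= bern n b t.
Proof.
move=> /andP[t0 t1]; elim: n h b => [|n IH] h b hb /=; first exact: hb.
have -> : (1 - t) * bern n h t + t * bern n (fun k => h k.+1) t - c =
  (1 - t) * (bern n h t - c) + t * (bern n (fun k => h k.+1) t - c) by ring.
apply: (le_trans (ler_normD _ _)); rewrite !normrM (ger0_norm t0) ger0_norm ?subr_ge0//.
apply: lerD; apply: ler_wpM2l; rewrite ?subr_ge0//.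
- by apply: IH => k kn; apply: hb; exact: leqW.
- by apply: IH => k kn; apply: hb.
Qed.

(** Squared bias plus variance of the binomial law. *)
Lemma bern_sqr n c t :
  bern n (fun k => (k%:R - c) ^+ 2) t = (n%:R * t - c) ^+ 2 + n%:R * t * (1 - t).
Proof.
elim: n c => [|n IH] c /=; first by rewrite !mul0r addr0.
rewrite IH (_ : (fun k => _) = fun k : nat => (k%:R - (c - 1)) ^+ 2).
  by rewrite IH -natr1; ring.
by apply/funext => k; rewrite -natr1; congr (_ ^+ 2); ring.
Qed.

Lemma bern_node_sqr n t : 0 <= t <= 1 ->
  bern n.+1 (fun k => (t - k%:R / n.+1%:R) ^+ 2) t <= n.+1%:R^-1.
Proof.
move=> /andP[t0 t1].
have n0 : n.+1%:R != 0 :> R by rewrite pnatr_eq0.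
rewrite (_ : (fun k => _) = fun k : nat =>
    0 + (n.+1%:R ^+ 2)^-1 * (k%:R - n.+1%:R * t) ^+ 2); last first.
  by apply/funext => k; move: (n.+1%:R : R) n0 => m n0; field.
rewrite bern_affine bern_sqr subrr expr0n /= !add0r.
rewrite (_ : _ * _ = n.+1%:R^-1 * (t * (1 - t))); last first.
  by move: (n.+1%:R : R) n0 => m n0; field.
by rewrite ler_piMr ?invr_ge0//; nra.
Qed.

(** By sin u - sin v = 2 sin ((u - v) / 2) cos ((u + v) / 2), where the half-sum
    and the half-difference stay away from pi / 2 because |u| <= 1 < pi / 2. *)
Lemma sin_separation (eta : R) : 0 < eta -> exists2 delta : R, 0 < delta &
  forall u v : R, `|u| <= 1 -> `|v| <= pi / 2 -> eta <= `|u - v| ->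
  delta <= `|sin u - sin v|.
Proof.
move=> eta0; pose m := Num.min (eta / 2) 1.
have pi2 : 1 < (pi : R) / 2.
  have h := pihalf_ge1 R; rewrite lt_neqAle h andbT; apply/eqP => e.
  have := sin_pihalf R; have := cos_pihalf R; rewrite -e.
  by have := cos1_gt0 R; lra.
pose b := (1 + pi / 2) / 2 : R.
have bpi : b < pi / 2 by rewrite /b; lra.
have m0 : 0 < m by rewrite lt_min ltr01 divr_gt0.
have m1 : m <= 1 by rewrite ge_min lexx orbT.
have me : m <= eta / 2 by rewrite ge_min lexx.
have sm : 0 < sin m by rewrite sin_gt0_pihalf// m0 (le_lt_trans m1).
have cb : 0 < cos b by rewrite cos_gt0_pihalf// bpi andbT; rewrite /b; lra.
exists (2 * (sin m * cos b)); first by rewrite !mulr_gt0.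
move=> u v u1 v1 uv.
pose w := (u - v) / 2; pose p := (u + v) / 2.
have -> : sin u - sin v = 2 * (sin w * cos p).
  have -> : u = p + w by rewrite /w /p; field.
  have -> : v = p - w by rewrite /w /p; field.
  by rewrite sinD sinB; ring.
have wb : `|w| <= b.
  rewrite /w normrM (ger0_norm (x := 2^-1))// /b ler_pM2r//.
  by rewrite (le_trans (ler_normB _ _))// lerD.
have pb : `|p| <= b.
  rewrite /p normrM (ger0_norm (x := 2^-1))// /b ler_pM2r//.
  by rewrite (le_trans (ler_normD _ _))// lerD.
have mw : m <= `|w|.
  by rewrite (le_trans me)// /w normrM (ger0_norm (x := 2^-1))// ler_pM2r.
have cosN' (x : R) : cos `|x| = cos x.
  by case: (ler0P x) => _; rewrite ?cosN.
have sinN' (x : R) : `|sin `|x| | = `|sin x|.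
  by case: (ler0P x) => _; rewrite ?sinN ?normrN.
rewrite normrM ger0_norm// ler_pM2l// normrM; apply: ler_pM.
- exact: ltW.
- exact: ltW.
- rewrite -sinN' (le_trans _ (ler_norm _))//.
  have i1 : m \in `[- (pi / 2), pi / 2] by rewrite in_itv /=; apply/andP; split; lra.
  have i2 : `|w| \in `[- (pi / 2), pi / 2].
    by rewrite in_itv /=; have := normr_ge0 w => w0; apply/andP; split; lra.
  by rewrite leNgt (ltr_sin i2 i1) -leNgt.
- rewrite -(cosN' p) (le_trans _ (ler_norm _))//.
  have i1 : b \in `[0, pi] by rewrite in_itv /=; apply/andP; split; rewrite ?/b; lra.
  have i2 : `|p| \in `[0, pi] by rewrite in_itv /= normr_ge0 /=; lra.
  by rewrite leNgt (ltr_cos i1 i2) -leNgt.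
Qed.

(** Heine's theorem, with only one of the two points in the compact square. *)
Lemma uniform_on_square (f : R * R -> R) (M e : R) : continuous f -> 0 < e ->
  exists2 eta : R, 0 < eta & forall z z' : R * R, `|z.1| <= M -> `|z.2| <= M ->
  `|z.1 - z'.1| < eta -> `|z.2 - z'.2| < eta -> `|f z - f z'| <= e.
Proof.
move=> cf e0.
pose K : set (R * R) := `[- M, M] `*` `[- M, M].
have cK : compact K by apply: compact_setX; exact: segment_compact.
pose P (n : nat) (z : R * R) := forall z' : R * R,
  `|z.1 - z'.1| < n.+1%:R^-1 -> `|z.2 - z'.2| < n.+1%:R^-1 -> `|f z - f z'| <= e.
have /(_ nat \oo P _) : near_covering K by apply/compact_near_coveringP.
case.
  move=> x Kx; have /cvgrPdist_lt /(_ (e / 2)) := cf x.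
  rewrite divr_gt0// => /(_ isT) /nbhs_ballP [r /= r0 rP].
  have r2 : 0 < r / 2 by rewrite divr_gt0.
  near=> z n => /= z' h1 h2.
  have nr : n.+1%:R^-1 < r / 2 :> R.
    by near: n; apply: (near_infty_natSinv_lt (PosNum r2)).
  have [b1 b2] : ball x (r / 2) z by near: z; exact: nbhsx_ballx.
  rewrite /= -!ball_normE /ball_ /= in b1 b2.
  have rr : r / 2 < r by rewrite ltr_pdivrMr// mulr_natr mulr2n ltrDl.
  have fz : `|f x - f z| < e / 2.
    apply: rP; split; rewrite /= -ball_normE /ball_ /=.
      exact: lt_trans b1 rr.
    exact: lt_trans b2 rr.
  have fz' : `|f x - f z'| < e / 2.
    apply: rP; split; rewrite /= -ball_normE /ball_ /=.
      apply: (le_lt_trans (ler_distD z.1 _ _)).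
      by rewrite [ltRHS](splitr r) ltrD// (lt_trans h1).
    apply: (le_lt_trans (ler_distD z.2 _ _)).
    by rewrite [ltRHS](splitr r) ltrD// (lt_trans h2).
  apply: (le_trans (ler_distD (f x) _ _)); rewrite (distrC (f z)) [leRHS](splitr e).
  by rewrite lerD// ltW.
move=> n0 _ /(_ n0 (leqnn n0)) KP.
exists n0.+1%:R^-1; first by rewrite invr_gt0.
move=> z z' z1 z2; apply: KP; split; rewrite /= in_itv /=; move: z1 z2; rewrite !ler_norml.
  by [].
by [].
Unshelve. all: by end_near. Qed.

End trigonometric_approximation.

(** * From characteristic functions to convergence in law *)

Section characteristic_functions.
Context (R : realType).

(** On the square of half-side M the function f is replaced by the Bernstein
    polynomial of f in the coordinates (1 + sin (a x)) / 2, which are injective on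
    the square and stay in the unit interval on the whole plane.  Therefore the
    polynomial is bounded by F everywhere, and outside the square the weight
    |x| + |y| compensates for an error of at most 2 F. *)
Lemma trig_approx (f : R * R -> R) (F e : R) : continuous f ->
  (forall z, `|f z| <= F) -> 0 < e ->
  exists2 B, trig B & forall z, `|f z - B z| <= e * (1 + `|z.1| + `|z.2|).
Proof.
move=> cf fF e0.
have F0 : 0 <= F by apply: le_trans (fF (0, 0)).
pose M := 2 * F / e + 1; pose a := M^-1.
have M0 : 0 < M by rewrite ltr_wpDl// divr_ge0// ?mulr_ge0// ltW.
have a0 : 0 < a by rewrite invr_gt0.
have eM : 2 * F <= e * M.
  by rewrite /M mulrDr mulr1 (mulrC e) divfK ?gt_eqF// lerDl ltW.
have e2 : 0 < e / 2 by rewrite divr_gt0.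
have [eta eta0 etaP] := uniform_on_square M cf e2.
have [delta delta0 deltaP] := sin_separation (mulr_gt0 a0 eta0).
pose s x := (1 + sin (a * x)) / 2; pose node t := asin (2 * t - 1) / a.
have s01 x : 0 <= s x <= 1.
  rewrite /s; have := sin_le1 (a * x); have := sin_geN1 (a * x) => h1 h2.
  by apply/andP; split; lra.
pose K := 8 * F / delta ^+ 2.
have d2 : 0 < delta ^+ 2 by rewrite exprn_gt0.
have K0 : 0 <= K by rewrite divr_ge0 ?mulr_ge0// ltW.
have far x t : `|x| <= M -> 0 <= t <= 1 -> eta <= `|x - node t| ->
    2 * F <= K * (s x - t) ^+ 2.
  move=> xM /andP[t0 t1] xt.
  have t11 : -1 <= 2 * t - 1 <= 1 by apply/andP; split; lra.
  have [/andP[p1 p2] sE] := asin_def t11.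
  have h1 : `|a * x| <= 1 by rewrite normrM (gtr0_norm a0) mulrC ler_pdivrMr// mul1r.
  have h2 : `|asin (2 * t - 1)| <= pi / 2 by rewrite ler_norml p1 p2.
  have h3 : a * eta <= `|a * x - asin (2 * t - 1)|.
    rewrite (_ : a * x - _ = a * (x - node t)); last first.
      by rewrite /node mulrBr mulrCA mulfV ?gt_eqF// mulr1.
    by rewrite normrM (gtr0_norm a0) ler_pM2l.
  have := deltaP _ _ h1 h2 h3; rewrite sE => h4.
  have h5 : delta ^+ 2 <= (2 * (s x - t)) ^+ 2.
    rewrite -(real_normK (num_real (2 * _))) lerXn2r ?nnegrE ?(ltW delta0)//.
    by apply: le_trans h4 _; rewrite le_eqVlt; apply/orP; left; apply/eqP;
      rewrite /s; congr (`|_|); field.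
  rewrite /K mulrAC ler_pdivlMr//.
  have := ler_wpM2l (mulr_ge0 (ltW (ltr0Sn R 1)) F0) h5.
  by rewrite exprMn; lra.
(* either both nodes are close, or one of the two quadratic terms exceeds 2 F *)
have key z t t' : `|z.1| <= M -> `|z.2| <= M -> 0 <= t <= 1 -> 0 <= t' <= 1 ->
    `|f (node t, node t') - f z| <=
    (e / 2 + K * (s z.1 - t) ^+ 2) + K * (s z.2 - t') ^+ 2.
  move=> z1 z2 t1 t2.
  have f2 : `|f (node t, node t') - f z| <= 2 * F.
    by rewrite (le_trans (ler_normB _ _))// mulr2n mulrDl mul1r lerD.
  have k1 := mulr_ge0 K0 (sqr_ge0 (s z.1 - t)).
  have k2 := mulr_ge0 K0 (sqr_ge0 (s z.2 - t')).
  have [n1|n1] := ltP `|z.1 - node t| eta; last first.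
    by have := far _ _ z1 t1 n1; lra.
  have [n2|n2] := ltP `|z.2 - node t'| eta; last first.
    by have := far _ _ z2 t2 n2; lra.
  by have := etaP z (node t, node t') z1 z2 n1 n2; rewrite distrC; lra.
pose n := Num.trunc (4 * K / e).
have nP : 2 * (K * n.+1%:R^-1) <= e / 2.
  have := truncnS_gt (4 * K / e); rewrite -/n ltr_pdivrMr// => h.
  rewrite mulrA ler_pdivrMr ?ltr0n//; lra.
have node01 (k : nat) : (k <= n.+1)%N -> 0 <= (k%:R / n.+1%:R : R) <= 1.
  by move=> kn; rewrite divr_ge0//= ler_pdivrMr ?ltr0n// mul1r ler_nat.
pose h (i j : nat) := f (node (i%:R / n.+1%:R), node (j%:R / n.+1%:R)).
pose B z := bern n.+1 (fun i => bern n.+1 (h i) (s z.2)) (s z.1).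
have trig_s (u v : R) : trig (fun z => (1 + sin (u * z.1 + v * z.2)) / 2).
  rewrite (_ : (fun=> _) = fun z => 2^-1 + 2^-1 * (1 * cos (- (pi / 2) + (u * z.1 + v * z.2)))).
    by apply: trig_add; [exact: trig_cst|apply/trig_scale/trig_mul_cos; exact: trig_cst].
  by apply/funext => z; rewrite [- _ + _]addrC cosBpihalf; field.
exists B.
  apply: (@trig_bern _ _ (fun i z => bern n.+1 (h i) (s z.2)) (fun z => s z.1)).
    move=> i; apply: (@trig_bern _ _ (fun j z => h i j) (fun z => s z.2)).
      by move=> j; exact: trig_cst.
    rewrite (_ : (fun=> _) = fun z => (1 + sin (0 * z.1 + a * z.2)) / 2)//.
    by apply/funext => z; rewrite mul0r add0r.
  rewrite (_ : (fun=> _) = fun z => (1 + sin (a * z.1 + 0 * z.2)) / 2)//.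
  by apply/funext => z; rewrite mul0r addr0.
move=> z.
have [box|] := boolP ((`|z.1| <= M) && (`|z.2| <= M)).
  have /andP[z1 z2] := box.
  have inner i : (i <= n.+1)%N -> `|bern n.+1 (h i) (s z.2) - f z| <=
      (e / 2 + K * n.+1%:R^-1) + K * (s z.1 - i%:R / n.+1%:R) ^+ 2.
    move=> iN.
    have := @bern_dist _ n.+1 (h i) (fun j => (e / 2 + K * (s z.1 - i%:R / n.+1%:R) ^+ 2)
      + K * (s z.2 - j%:R / n.+1%:R) ^+ 2) (f z) (s z.2) (s01 _).
    rewrite bern_affine => /(_ _)/le_trans; apply.
      by move=> k kN; apply: key => //; exact: node01.
    by rewrite [leRHS]addrAC lerD2l ler_wpM2l// bern_node_sqr.
  have := @bern_dist _ n.+1 (fun i => bern n.+1 (h i) (s z.2)) _ (f z) (s z.1) (s01 _) inner.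
  rewrite bern_affine -/(B z) distrC => /le_trans; apply.
  have h1 := ler_wpM2l K0 (bern_node_sqr n (s01 z.1)).
  have h2 : e <= e * (1 + `|z.1| + `|z.2|).
    by rewrite ler_peMr ?(ltW e0)// -addrA lerDl addr_ge0.
  rewrite (le_trans _ h2)// (le_trans (lerD (lexx _) h1))//.
  by move: nP; move: (K / _) => Q; lra.
rewrite negb_and -!ltNge => out.
have cF t : bern n.+1 (fun=> F) t = F.
  by have := bern_affine n.+1 (fun=> 0) F 0 t; rewrite !mul0r !addr0.
have BF : `|B z| <= F.
  have := @bern_dist _ n.+1 (fun i => bern n.+1 (h i) (s z.2)) (fun=> F) 0 (s z.1) (s01 _).
  rewrite cF subr0; apply=> i _; rewrite subr0.
  have := @bern_dist _ n.+1 (h i) (fun=> F) 0 (s z.2) (s01 _).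
  by rewrite cF subr0; apply=> j _; rewrite subr0; exact: fF.
apply: (le_trans (ler_normB _ _)); apply: (@le_trans _ _ (2 * F)).
  by rewrite mulr2n mulrDl mul1r lerD.
apply: (le_trans eM); rewrite ler_wpM2l ?(ltW e0)//.
have := normr_ge0 z.1; have := normr_ge0 z.2.
by case/orP : out => ? ? ?; lra.
Qed.

Lemma trig_measurable (B : R * R -> R) : trig B -> measurable_fun setT B.
Proof.
elim=> [c|f g _ mf _ mg|f u v c _ mf] //; first exact: measurable_funD.
apply: measurable_funM => //; apply: measurable_cos_comp.
apply: measurable_funD => //; apply: measurable_funD; apply: measurable_funM => //.
Qed.

Lemma trig_bounded (B : R * R -> R) : trig B -> exists K, forall z, `|B z| <= K.
Proof.
elim=> [c|f g _ [K1 h1] _ [K2 h2]|f u v c _ [K h]].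
- by exists `|c|.
- by exists (K1 + K2) => z; rewrite (le_trans (ler_normD _ _))// lerD.
- exists K => z; rewrite normrM (le_trans _ (h z))// ler_piMr//; exact: cos_max.
Qed.

(** A pointwise limit of trigonometric polynomials. *)
Lemma continuous_measurable2 (f : R * R -> R) (F : R) : continuous f ->
  (forall z, `|f z| <= F) -> measurable_fun setT f.
Proof.
move=> cf fF.
have ex (k : nat) : exists2 B, trig B &
    forall z, `|f z - B z| <= k.+1%:R^-1 * (1 + `|z.1| + `|z.2|).
  by apply: (trig_approx cf fF); rewrite invr_gt0.
have /choice [B BP] : forall k : nat, exists B, trig B /\
    forall z, `|f z - B z| <= k.+1%:R^-1 * (1 + `|z.1| + `|z.2|).
  by move=> k; have [B h1 h2] := ex k; exists B.
apply: (@measurable_fun_cvg _ _ _ _ B).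
  by move=> k; apply: trig_measurable; exact: (BP k).1.
move=> z _; apply/subr_cvg0/norm_cvg0P.
apply: (@squeeze_cvgr _ _ _ _ (cst 0) (fun k => k.+1%:R^-1 * (1 + `|z.1| + `|z.2|))).
- by apply: nearW => k; rewrite normr_ge0 /= distrC; exact: (BP k).2.
- exact: cvg_cst.
- rewrite -(mul0r (1 + `|z.1| + `|z.2|)); apply: cvgMl; exact: cvg_harmonic.
Qed.

Context (d : measure_display) (T : measurableType d) (P : probability T R).
Variables (U V : nat -> T -> R) (nu : probability (R * R)%type R) (C : R).
Hypothesis iU : forall n, L1 P (U n).
Hypothesis iV : forall n, L1 P (V n).
Hypothesis tight : forall n, Ex P (fun w => `|U n w|) + Ex P (fun w => `|V n w|) <= C.
Hypothesis i1 : L1 nu (fun z => z.1).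
Hypothesis i2 : L1 nu (fun z => z.2).
Hypothesis cf_cvg : forall u v c,
  Ex P (fun w => cos (c + (u * U n w + v * V n w))) @[n --> \oo] -->
  Ex nu (fun z => cos (c + (u * z.1 + v * z.2))).

Let X n w := (U n w, V n w).

Let mX n : measurable_fun setT (X n).
Proof. by apply: measurable_fun_pair; exact: L1_measurable. Qed.

Let L1X (h : R * R -> R) n K : measurable_fun setT h -> (forall z, `|h z| <= K) ->
  L1 P (h \o X n).
Proof.
move=> mh hK; apply: (@L1_bounded _ _ _ _ K); first exact: (measurableT_comp mh (mX n)).
by move=> w; exact: hK.
Qed.

Let mlin (u v c : R) : measurable_fun setT (fun z : R * R => c + (u * z.1 + v * z.2)).
Proof.
by apply: measurable_funD => //; apply: measurable_funD; apply: measurable_funM.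
Qed.

(** The extra cosine is absorbed by the product-to-sum formula, which makes the
    induction over [trig] possible. *)
Let trig_cos_cvg B : trig B -> forall u v c,
  Ex P (fun w => B (X n w) * cos (c + (u * U n w + v * V n w))) @[n --> \oo] -->
  Ex nu (fun z => B z * cos (c + (u * z.1 + v * z.2))).
Proof.
elim=> [k|f g tf IHf tg IHg|f a b e tf IH] u v c.
- rewrite ExZ; last exact: L1_cos.
  have -> : (fun n => Ex P (fun w => k * cos (c + (u * U n w + v * V n w)))) =
      (fun n => k * Ex P (fun w => cos (c + (u * U n w + v * V n w)))).
    apply/funext => n; rewrite ExZ//; apply: L1_cos.
    exact: (measurableT_comp (mlin u v c) (mX n)).
  by apply: cvgMr; exact: cf_cvg.
- have [Kf hf] := trig_bounded tf; have [Kg hg] := trig_bounded tg.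
  have b1 (h : R * R -> R) K : trig h -> (forall z, `|h z| <= K) ->
      measurable_fun setT (fun z => h z * cos (c + (u * z.1 + v * z.2))) /\
      forall z, `|h z * cos (c + (u * z.1 + v * z.2))| <= K.
    move=> th hK; split.
      by apply: measurable_funM; [exact: trig_measurable|exact: measurable_cos_comp].
    by move=> z; rewrite normrM (le_trans _ (hK z))// ler_piMr//; exact: cos_max.
  have [mf bf] := b1 _ _ tf hf; have [mg bg] := b1 _ _ tg hg.
  have -> : (fun z => (f z + g z) * cos (c + (u * z.1 + v * z.2))) = (fun z =>
      f z * cos (c + (u * z.1 + v * z.2)) + g z * cos (c + (u * z.1 + v * z.2))).
    by apply/funext => z; rewrite mulrDl.
  rewrite ExD; [|exact: L1_bounded bf|exact: L1_bounded bg].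
  have -> : (fun n => Ex P (fun w => (f (X n w) + g (X n w)) * cos (c + (u * U n w + v * V n w)))) =
     (fun n => Ex P (fun w => f (X n w) * cos (c + (u * U n w + v * V n w))) +
       Ex P (fun w => g (X n w) * cos (c + (u * U n w + v * V n w)))).
    apply/funext => n; rewrite -ExD.
    + by congr Ex; apply/funext => w; rewrite mulrDl.
    + exact: (L1X n mf bf).
    + exact: (L1X n mg bg).
  by apply: cvgD; [exact: IHf|exact: IHg].
- have [Kf hf] := trig_bounded tf.
  have b1 (p q r : R) : measurable_fun setT (fun z => f z * cos (r + (p * z.1 + q * z.2))) /\
      forall z, `|f z * cos (r + (p * z.1 + q * z.2))| <= Kf.
    split.
      by apply: measurable_funM; [exact: trig_measurable|exact: measurable_cos_comp].
    by move=> z; rewrite normrM (le_trans _ (hf z))// ler_piMr//; exact: cos_max.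
  have pts x y : f x * cos (e + (a * y.1 + b * y.2)) * cos (c + (u * y.1 + v * y.2)) =
      2^-1 * (f x * cos ((e + c) + ((a + u) * y.1 + (b + v) * y.2)) +
              f x * cos ((e - c) + ((a - u) * y.1 + (b - v) * y.2))) :> R.
    have -> : (e + c) + ((a + u) * y.1 + (b + v) * y.2) =
      (e + (a * y.1 + b * y.2)) + (c + (u * y.1 + v * y.2)) by ring.
    have -> : (e - c) + ((a - u) * y.1 + (b - v) * y.2) =
      (e + (a * y.1 + b * y.2)) - (c + (u * y.1 + v * y.2)) by ring.
    move: (e + (a * y.1 + b * y.2)) (c + (u * y.1 + v * y.2)) => p q.
    by rewrite cosD cosB; field.
  have [m1 h1] := b1 (a + u) (b + v) (e + c); have [m2 h2] := b1 (a - u) (b - v) (e - c).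
  have L1a := L1_bounded nu m1 h1; have L1b := L1_bounded nu m2 h2.
  have -> : (fun z => f z * cos (e + (a * z.1 + b * z.2)) * cos (c + (u * z.1 + v * z.2))) =
      (fun z => 2^-1 * (f z * cos ((e + c) + ((a + u) * z.1 + (b + v) * z.2)) +
              f z * cos ((e - c) + ((a - u) * z.1 + (b - v) * z.2)))).
    by apply/funext => z; exact: pts.
  rewrite ExZ ?ExD//; last exact: L1D.
  have -> : (fun n => Ex P (fun w => f (X n w) * cos (e + (a * (X n w).1 + b * (X n w).2)) *
        cos (c + (u * U n w + v * V n w)))) =
     (fun n => 2^-1 * (
       Ex P (fun w => f (X n w) * cos ((e + c) + ((a + u) * U n w + (b + v) * V n w))) +
       Ex P (fun w => f (X n w) * cos ((e - c) + ((a - u) * U n w + (b - v) * V n w))))).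
    apply/funext => n; have L1c := L1X n m1 h1; have L1d := L1X n m2 h2.
    rewrite -ExD// -ExZ; last exact: L1D.
    by congr Ex; apply/funext => w; exact: (pts (X n w) (X n w)).
  by apply: cvgMr; apply: cvgD; exact: IH.
Qed.

(** Levy's continuity theorem in the plane, for sequences bounded in mean. *)
Lemma cf_cvg_in_law : cvg_in_law P X nu.
Proof.
move=> f cf [F fF].
have mf := continuous_measurable2 cf fF.
have F0 : 0 <= F by apply: le_trans (fF (0, 0)).
have ifX n : L1 P (f \o X n) by exact: L1X fF.
have if_ : L1 nu f by exact: L1_bounded fF.
rewrite -ExE//.
have -> : (fun n => 'E_P[(f \o X n)%FUN])%E = (fun n => (Ex P (f \o X n))%:E).
  by apply/funext => n; rewrite expectationE.
apply: cvg_EFin; first exact: nearW.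
pose C' := C + Ex nu (fun z => `|z.1|) + Ex nu (fun z => `|z.2|).
have E0 (m : probability (R * R)%type R) (h : R * R -> R) : 0 <= Ex m (fun z => `|h z|).
  exact: Ex_ge0.
have C0 : 0 <= C.
  by apply: le_trans (tight 0%N); rewrite addr_ge0//; exact: Ex_ge0.
have C'0 : 0 <= C' by rewrite /C' !addr_ge0.
apply/cvgrPdist_le => e e0.
pose e1 := e / 2 / (2 + C').
have e10 : 0 < e1 by rewrite !divr_gt0// ltr_wpDr.
have [B tB fB] := trig_approx cf fF e10.
have [KB hB] := trig_bounded tB; have mB := trig_measurable tB.
have iB := L1_bounded nu mB hB.
have iBX n := L1X n mB hB.
have Bcvg : Ex P (B \o X n) @[n --> \oo] --> Ex nu B.
  have := @trig_cos_cvg B tB 0 0 0.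
  have -> : (fun z => B z * cos (0 + (0 * z.1 + 0 * z.2))) = B.
    by apply/funext => z; rewrite !mul0r !addr0 cos0 mulr1.
  have -> : (fun n => Ex P (fun w => B (X n w) * cos (0 + (0 * U n w + 0 * V n w)))) =
      (fun n => Ex P (B \o X n)).
    by apply/funext => n; congr Ex; apply/funext => w; rewrite !mul0r !addr0 cos0 mulr1.
  by [].
have nuB : `|Ex nu f - Ex nu B| <= e1 * (1 + Ex nu (fun z => `|z.1|) + Ex nu (fun z => `|z.2|)).
  rewrite -ExB//.
  have j1 := L1_abs i1; have j2 := L1_abs i2; have j0 := L1_cst nu (1 : R).
  have -> : 1 + Ex nu (fun z => `|z.1|) + Ex nu (fun z => `|z.2|) =
      Ex nu (fun z => 1 + `|z.1| + `|z.2|).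
    by rewrite ExD// ?ExD ?Ex_cst//; exact: L1D.
  rewrite -ExZ; last by apply: L1D => //; exact: L1D.
  by apply: Ex_abs_le => //; [exact: L1B|apply/L1Z/L1D => //; exact: L1D].
have PB n : `|Ex P (f \o X n) - Ex P (B \o X n)| <= e1 * (1 + C).
  rewrite -ExB//.
  have j1 := L1_abs (iU n); have j2 := L1_abs (iV n); have j0 := L1_cst P (1 : R).
  apply: (@le_trans _ _ (e1 * (1 + Ex P (fun w => `|U n w|) + Ex P (fun w => `|V n w|)))).
    have -> : 1 + Ex P (fun w => `|U n w|) + Ex P (fun w => `|V n w|) =
        Ex P (fun w => 1 + `|U n w| + `|V n w|).
      by rewrite ExD// ?ExD ?Ex_cst//; exact: L1D.
    rewrite -ExZ; last by apply: L1D => //; exact: L1D.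
    apply: Ex_abs_le => //; [exact: L1B|apply/L1Z/L1D => //; exact: L1D|].
    by move=> w; exact: fB.
  by rewrite ler_wpM2l ?(ltW e10)// -addrA lerD2l.
have /cvgrPdist_le /(_ (e / 2)) := Bcvg; rewrite divr_gt0// => /(_ isT) Bn.
near=> n.
have Bn' : `|Ex nu B - Ex P (B \o X n)| <= e / 2 by near: n.
have PBn := PB n.
have -> : Ex nu f - Ex P (f \o X n) = (Ex nu f - Ex nu B) +
  (Ex nu B - Ex P (B \o X n)) - (Ex P (f \o X n) - Ex P (B \o X n)) by ring.
apply: (le_trans (ler_normB _ _)); apply: (le_trans (lerD (ler_normD _ _) (lexx _))).
apply: (le_trans (lerD (lerD nuB Bn') PBn)).
have : e1 * (2 + C') = e / 2 by rewrite /e1 divfK// gt_eqF// ltr_wpDr.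
rewrite /C'; move: (Ex nu _) (Ex nu _) => x y; lra.
Unshelve. all: by end_near. Qed.

End characteristic_functions.

(** * The Gaussian quasi-maximum likelihood estimator *)

Section quasi_maximum_likelihood.
Context (R : realType).

Lemma ln_lt_subr1 (x : R) : 0 < x -> x != 1 -> ln x < x - 1.
Proof.
move=> x0 x1; have l0 : ln x != 0.
  apply: contra x1 => /eqP l; apply/eqP; rewrite -(lnK (x := x)) ?posrE//.
  by rewrite l expR0.
by have := expR_gt1Dx l0; rewrite lnK ?posrE//; lra.
Qed.

Variables (y : nat -> R) (n : nat).
Hypothesis y_neq0 : forall t, y t != 0.
Hypothesis n_gt0 : (0 < n)%N.

Let r t := y t / y t.-1.
Let p := phi_hat y n.

Let n0 : n%:R != 0 :> R. Proof. by rewrite pnatr_eq0 -lt0n. Qed.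

Lemma alpha_hatE : alpha_hat y n = n%:R^-1 * \sum_(1 <= t < n.+1) (r t - p) ^+ 2.
Proof.
congr (_ * _); apply: eq_bigr => t _; rewrite -expr_div_n; congr (_ ^+ 2).
by rewrite mulrBl mulfK.
Qed.

Lemma alpha_hat_ge0 : 0 <= alpha_hat y n.
Proof. by rewrite alpha_hatE mulr_ge0// sumr_ge0// => t _; rewrite sqr_ge0. Qed.

Let n0' : 0 < n%:R :> R. Proof. by rewrite ltr0n. Qed.

(** Steiner's identity. *)
Let sum_sqr_shift phi : \sum_(1 <= t < n.+1) (r t - phi) ^+ 2 =
  n%:R * (alpha_hat y n + (phi - p) ^+ 2).
Proof.
rewrite alpha_hatE mulrDr mulrA mulfV// mul1r.
have sr : \sum_(1 <= t < n.+1) (r t - p) = 0.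
  rewrite sumrB sumr_const_nat subSS subn0 -(mulr_natl p).
  by rewrite /p /phi_hat mulrA mulfV// mul1r subrr.
rewrite (eq_bigr (fun t => (r t - p) ^+ 2 + (2 * (p - phi) * (r t - p) + (p - phi) ^+ 2))).
  rewrite big_split /= big_split /= -mulr_sumr sr mulr0 add0r.
  rewrite sumr_const_nat subSS subn0 -(mulr_natl ((p - phi) ^+ 2)).
  by congr (_ + _ * _); ring.
by move=> t _; ring.
Qed.

Let profile (phi al : R) := ln al + (alpha_hat y n + (phi - p) ^+ 2) / al.

Let loglikE phi al : 0 < al -> loglik y n (phi, al) =
  - 2^-1 * (\sum_(1 <= t < n.+1) ln (y t.-1 ^+ 2) + n%:R * profile phi al).
Proof.
move=> al0; rewrite /loglik /loglik1 -mulr_sumr; congr (_ * _).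
rewrite (eq_bigr (fun t => ln (y t.-1 ^+ 2) + (ln al + al^-1 * (r t - phi) ^+ 2))).
  rewrite big_split /= big_split /= -mulr_sumr sum_sqr_shift.
  rewrite sumr_const_nat subSS subn0 -(mulr_natl (ln al)) /profile.
  by ring.
move=> t _ /=; have y2 : 0 < y t.-1 ^+ 2 by rewrite exprn_even_gt0//= y_neq0.
rewrite lnM ?posrE// (addrC (ln al)) addrA; congr (_ + _).
have yn := y_neq0 t.-1; rewrite /r; field.
by rewrite yn gt_eqF.
Qed.

Let loglik_le phi al phi' al' : 0 < al -> 0 < al' ->
  (loglik y n (phi', al') <= loglik y n (phi, al)) =
  (profile phi al <= profile phi' al').
Proof.
move=> al0 al0'; rewrite !loglikE// !mulNr lerN2 ler_pM2l ?invr_gt0//.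
by rewrite lerD2l ler_pM2l.
Qed.

(** For fixed alpha the profile is minimal at phi_hat; then ln alpha + A / alpha,
    with A = alpha_hat, has the unique minimum A if A > 0, and decreases to minus
    infinity as alpha tends to 0 if A = 0. *)
Lemma qmle_explicit th : is_qmle y n th <-> th = theta_hat y n /\ 0 < alpha_hat y n.
Proof.
have A0 := alpha_hat_ge0; set A := alpha_hat y n in A0 *.
case: th => phi al; split.
  move=> [al0]; rewrite /Theta /= in al0 => max.
  have prof phi' al' : 0 < al' -> profile phi al <= profile phi' al'.
    by move=> al0'; rewrite -loglik_le//; apply: max.
  have phip : phi = p.
    have := prof p al al0; rewrite /profile -/A lerD2l ler_pM2r ?invr_gt0//.
    rewrite lerD2l subrr expr0n /= => h.
    by apply/eqP; rewrite -subr_eq0 -(sqrf_eq0 (phi - p)) eq_le h sqr_ge0.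
  have profE al' : profile p al' = ln al' + A / al'.
    by rewrite /profile subrr expr0n addr0.
  rewrite phip in prof.
  have Apos : 0 < A.
    rewrite lt_neqAle A0 andbT; apply/eqP => A00.
    have a2 : 0 < al / 2 by rewrite divr_gt0.
    (* halving alpha would increase the likelihood *)
    have := prof p (al / 2) a2; rewrite !profE -A00 !mul0r !addr0 leNgt => /negP; apply.
    by rewrite ltr_ln ?posrE//; lra.
  split => //; rewrite /theta_hat -/p -/A phip; congr (_, _).
  have := prof p A Apos; rewrite !profE mulfV ?gt_eqF// => h.
  apply/eqP; apply: contraT => alA.
  have x1 : A / al != 1.
    by apply: contra alA => /eqP /divr1_eq ->.
  have := ln_lt_subr1 (divr_gt0 Apos al0) x1.
  by rewrite ln_div ?posrE//; lra.
move=> [[-> ->] Apos]; split => // -[phi' al'] /= al0'.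
rewrite loglik_le// /profile -/A -/p subrr expr0n addr0 mulfV ?gt_eqF//.
apply: (@le_trans _ _ (ln al' + A / al')).
  have [e|x1] := eqVneq (A / al') 1.
    by rewrite e (divr1_eq e).
  have := ln_lt_subr1 (divr_gt0 Apos al0') x1.
  by rewrite ln_div ?posrE//; lra.
by rewrite lerD2l ler_pM2r ?invr_gt0// lerDl sqr_ge0.
Qed.

End quasi_maximum_likelihood.

(** * Measurability and identical distribution *)

Section distributions.
Context (d : measure_display) (T : measurableType d) (R : realType).

(** With the convention 0^-1 = 0, the inverse is f times the power of f ^ 2 of
    exponent -1. *)
Lemma measurable_funV (f : T -> R) : measurable_fun setT f ->
  measurable_fun setT (fun w => (f w)^-1).
Proof.
move=> mf.
rewrite (_ : (fun=> _) = fun w => f w * powR (f w ^+ 2) (-1)).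
  apply: measurable_funM => //.
  exact: (measurableT_comp (@measurable_powR R (-1)) (measurable_funX 2 mf)).
apply/funext => w; rewrite powR_inv1 ?sqr_ge0//.
have [->|f0] := eqVneq (f w) 0; first by rewrite mul0r invr0.
by field.
Qed.

Variable P : probability T R.

Lemma L1_ge0 (X : T -> R) (c : R) : measurable_fun setT X -> (forall w, 0 <= X w) ->
  ('E_P[X] = c%:E)%E -> L1 P X /\ Ex P X = c.
Proof.
rewrite unlock => mX X0 EX; split; last by rewrite /Ex /Rintegral EX.
apply/integrableP; split; first exact/measurable_EFinP.
rewrite (eq_integral (EFin \o X)) ?EX ?ltry// => w _.
by rewrite /= ger0_norm.
Qed.

Lemma Ex_same_law (X Y : T -> R) (g : R -> R) :
  measurable_fun setT X -> measurable_fun setT Y -> measurable_fun setT g ->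
  (forall B, measurable B -> P (X @^-1` B) = P (Y @^-1` B)) ->
  (forall x, 0 <= g x) -> Ex P (g \o X) = Ex P (g \o Y).
Proof.
move=> mX mY mg XY g0; rewrite /Ex /Rintegral; congr fine.
have mge : measurable_fun setT (EFin \o g) by exact/measurable_EFinP.
pose X' : {mfun T >-> R} := HB.pack X (isMeasurableFun.Build _ _ _ _ _ mX).
pose Y' : {mfun T >-> R} := HB.pack Y (isMeasurableFun.Build _ _ _ _ _ mY).
have -> : (\int[P]_w ((g \o X) w)%:E = \int[distribution P X']_x (EFin \o g) x)%E.
  by rewrite ge0_integral_pushforward// => x _; rewrite lee_fin.
have -> : (\int[P]_w ((g \o Y) w)%:E = \int[distribution P Y']_x (EFin \o g) x)%E.
  by rewrite ge0_integral_pushforward// => x _; rewrite lee_fin.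
by apply: eq_measure_integral => A mA _; exact: XY.
Qed.

Lemma Ex_same_law_bounded (X Y : T -> R) (g : R -> R) :
  measurable_fun setT X -> measurable_fun setT Y -> measurable_fun setT g ->
  (forall B, measurable B -> P (X @^-1` B) = P (Y @^-1` B)) ->
  (forall x, `|g x| <= 1) -> Ex P (g \o X) = Ex P (g \o Y).
Proof.
move=> mX mY mg XY g1.
have H Z : measurable_fun setT Z -> Ex P (g \o Z) = Ex P ((fun x => 1 + g x) \o Z) - 1.
  move=> mZ; rewrite ExD ?Ex_cst; [by rewrite addrC addKr|exact: L1_cst|].
  apply: (@L1_bounded _ _ _ _ 1); first exact: measurableT_comp.
  by move=> w; exact: g1.
rewrite !H//; congr (_ - _); apply: Ex_same_law => //; first exact: measurable_funD.
by move=> x; have := g1 x; rewrite ler_norml => /andP[]; lra.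
Qed.

Lemma mutually_indep2 (X : nat -> T -> R) i j : mutually_independent P X ->
  i != j -> indep P (X i) (X j).
Proof.
move=> mX ij A B mA mB.
pose C k := if k == i then A else B.
have := mX [:: i; j] C; rewrite /= inE ij /= => /(_ isT).
rewrite !big_cons !big_nil setIT mule1 /C eqxx eq_sym (negbTE ij); apply.
by move=> k; case: ifP.
Qed.

End distributions.

(** * Normal laws in the plane *)

Section normal_plane.
Context (R : realType).
Local Notation mR := (measurableTypeR R).
Let N : probability mR R := normal_prob (0 : R) 1.
Let N2 : probability (mR * mR)%type R := (N \x N)%E.
Variables s1 s2 : R.
Let A : 'M[R]_2 := diag_mx (\row_(i < 2) [:: s1; s2]`_i).
Let aff : (mR * mR)%type -> (R * R)%type := affine2 (0, 0) A.

Let affE z : aff z = (s1 * z.1, s2 * z.2).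
Proof.
rewrite /aff /affine2 /A !mxE /= !mulr1n !mulr0n !mul0r !add0r addr0.
by [].
Qed.

Let maff : measurable_fun setT aff.
Proof.
rewrite (_ : aff = fun z => (s1 * z.1, s2 * z.2)); last exact/funext/affE.
by apply: measurable_fun_pair; exact: measurable_funM.
Qed.

Let aff' : {mfun (mR * mR)%type >-> (R * R)%type} :=
  HB.pack aff (isMeasurableFun.Build _ _ _ _ _ maff).

Definition normal_plane : probability (R * R)%type R := distribution N2 aff'.

Lemma normal_plane_normal : is_normal2 normal_plane (0, 0)
  (diag_mx (\row_(i < 2) [:: s1 ^+ 2; s2 ^+ 2]`_i)).
Proof.
exists A => //; rewrite /A tr_diag_mx mulmx_diag; congr diag_mx.
by apply/rowP => i; rewrite !mxE; case: i => -[|[|]].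
Qed.

Let mfst : measurable_fun [set: (mR * mR)%type] (fun z => z.1 : R).
Proof. exact: (@measurable_fst _ _ mR mR). Qed.

Let msnd : measurable_fun [set: (mR * mR)%type] (fun z => z.2 : R).
Proof. exact: (@measurable_snd _ _ mR mR). Qed.

Let ilin1 : L1 N2 (fun z => z.1 : R).
Proof.
apply/integrable12ltyP; first by apply/measurable_EFinP; exact: mfst.
have /integrableP[_] := normal_L1 R; apply: le_lt_trans.
rewrite le_eqVlt; apply/orP; left; apply/eqP; apply: eq_integral => x _.
by rewrite /= integral_cst// [X in (_ * X)%E]probability_setT mule1.
Qed.

Let ilin2 : L1 N2 (fun z => z.2 : R).
Proof.
apply/integrable12ltyP; first by apply/measurable_EFinP; exact: msnd.
have /integrableP[_] := normal_L1 R; apply: le_lt_trans.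
by rewrite /= integral_cst// [X in (_ * X)%E]probability_setT mule1.
Qed.

Let L1_pull (f : R * R -> R) : measurable_fun setT f -> L1 N2 (f \o aff) ->
  L1 normal_plane f /\ Ex normal_plane f = Ex N2 (f \o aff).
Proof.
move=> mf if_; have mfe : measurable_fun setT (EFin \o f) by exact/measurable_EFinP.
split; first exact: (integrable_pushforward maff mfe if_ measurableT).
by congr fine; exact: (integral_pushforward maff mfe if_ measurableT).
Qed.

Lemma normal_plane_L1 : L1 normal_plane (fun z => z.1) /\ L1 normal_plane (fun z => z.2).
Proof.
split; apply: (L1_pull _ _).1 => //.
  rewrite (_ : _ \o _ = fun z => s1 * z.1); first exact: (L1Z _ ilin1).
  by apply/funext => z; change ((aff z).1 = s1 * z.1); rewrite affE.
rewrite (_ : _ \o _ = fun z => s2 * z.2); first exact: (L1Z _ ilin2).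
by apply/funext => z; change ((aff z).2 = s2 * z.2); rewrite affE.
Qed.

Lemma normal_plane_cf u v c : Ex normal_plane (fun z => cos (c + (u * z.1 + v * z.2))) =
  expR (- (((u * s1) ^+ 2 + (v * s2) ^+ 2) / 2)) * cos c.
Proof.
have mf : measurable_fun setT (fun z : R * R => c + (u * z.1 + v * z.2)).
  by apply: measurable_funD => //; apply: measurable_funD; exact: measurable_funM.
have mc := measurable_cos_comp mf.
have ic : L1 N2 ((fun z : R * R => cos (c + (u * z.1 + v * z.2))) \o aff).
  by apply: (L1_cos N2 (f := (fun z : R * R => c + (u * z.1 + v * z.2)) \o aff));
    exact: (measurableT_comp mf maff).
rewrite (L1_pull mc ic).2; apply: EFin_inj; rewrite ExE//.
rewrite -integral12_prod_meas1//.
transitivity (\int[N]_x (expR (- ((v * s2) ^+ 2 / 2)) * cos (u * s1 * x + c))%:E)%E.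
  apply: eq_integral => x _; rewrite /fubini_F /=.
  transitivity ((Ex N (fun y => cos (v * s2 * y + (u * s1 * x + c))))%:E).
    rewrite ExE; last first.
      apply: L1_cos; apply: measurable_funD => //.
    apply: eq_integral => y _; congr (_%:E).
    change (cos (c + (u * (aff (x, y)).1 + v * (aff (x, y)).2)) =
      cos (v * s2 * y + (u * s1 * x + c))).
    rewrite affE; congr cos; change (c + (u * (s1 * x) + v * (s2 * y)) =
      v * s2 * y + (u * s1 * x + c)); ring.
  by rewrite normal_cf.
have ic1 : L1 N (fun x => cos (u * s1 * x + c)).
  by apply: L1_cos; apply: measurable_funD.
rewrite -[LHS](ExE (L1Z _ ic1)) ExZ// normal_cf mulrA -expRD; congr (expR _ * _)%:E.
ring.
Qed.

End normal_plane.

(** * The first-order double autoregression *)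

Section double_autoregression.
Context (d : measure_display) (T : measurableType d) (R : realType)
    (P : probability T R).
Variables (phi0 alpha0 : R) (y eta : nat -> {RV P >-> R}).
Hypothesis alpha0_gt0 : 0 < alpha0.
Hypothesis model : forall (t : nat) (w : T), (1 <= t)%N ->
  y t w = phi0 * y t.-1 w + eta t w * Num.sqrt (alpha0 * y t.-1 w ^+ 2).
Hypothesis eta_iid : iid P (fun t : nat => eta t.+1).
Hypothesis eta_past : forall t : nat, (1 <= t)%N ->
  independent_of_past P (eta t) y t.
Hypothesis y_neq0 : forall t : nat, {ae P, forall w : T, y t w != 0}.
Hypothesis eta_mean : forall t : nat, (1 <= t)%N -> ('E_P[eta t] = 0%:E)%E.
Hypothesis eta_var : forall t : nat, (1 <= t)%N ->
  ('E_P[fun w => (eta t w ^+ 2)%R] = 1%:E)%E.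

Let my t : measurable_fun setT (y t). Proof. by []. Qed.

Let y_ae : {ae P, forall w, forall t, y t w != 0}.
Proof. exact: ae_foralln. Qed.

Let H i : T -> R := eta i.+1.

Let mH i : measurable_fun setT (H i). Proof. exact: (measurable_funPT (eta i.+1)). Qed.

Let mHX i k : measurable_fun setT (fun w => H i w ^+ k).
Proof. exact: measurable_funX. Qed.

Let s0 := Num.sqrt alpha0.

Let s0_gt0 : 0 < s0. Proof. by rewrite sqrtr_gt0. Qed.

Let s0_sqr : s0 ^+ 2 = alpha0. Proof. by rewrite sqr_sqrtr// ltW. Qed.

(** The standardized residuals of the true parameter. *)
Let e i w := (y i.+1 w / y i w - phi0) / s0.

(** The sign of y i, with the value 1 at 0 so that it never vanishes. *)
Let sg i w : R := 2 * \1_`[0, +oo[ (y i w) - 1.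

Let sgE i w : sg i w = 1 \/ sg i w = -1.
Proof.
by rewrite /sg indicE; case: (_ \in _); [left|right]; rewrite ?mulr1 ?mulr0; ring.
Qed.

Let sg_past i : past_measurable y i.+1 (sg i).
Proof.
apply: measurable_funB => //; apply: measurable_funM => //.
apply: (@measurableT_comp _ _ _ _ _ _ (\1_`[0, +oo[ : R -> R)).
  exact: measurable_indic.
exact: past_self.
Qed.

Let e_past i : past_measurable y i.+2 (e i).
Proof.
apply: measurable_funM => //; apply: measurable_funB => //.
apply: measurable_funM; first exact: past_self.
by apply: measurable_funV; apply: past_self; exact: leqW.
Qed.

Let me i : measurable_fun setT (e i).
Proof. exact: past_measurableT my (@e_past i). Qed.

Let msg i : measurable_fun setT (sg i).
Proof. exact: past_measurableT my (@sg_past i). Qed.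

Let eE_of i w : y i w != 0 -> e i w = sg i w * H i w.
Proof.
move=> yi; rewrite /e model// /= sqrtrM ?ltW// sqrtr_sqr -/s0 -/(H i).
have -> : `|y i w| = sg i w * y i w.
  rewrite /sg indicE mem_setE in_itv /= andbT; case: ger0P => h; rewrite ?mulr1 ?mulr0; ring.
have s0n : s0 != 0 by rewrite gt_eqF.
by field; rewrite yi s0n.
Qed.

Let eE i : {ae P, forall w, e i w = sg i w * H i w}.
Proof. by apply: filterS (y_neq0 i) => w; exact: eE_of. Qed.

Let sg2 i w : sg i w ^+ 2 = 1.
Proof. by case: (sgE i w) => ->; rewrite ?sqrrN expr1n. Qed.

Let abs_sg i w : `|sg i w| = 1.
Proof. by case: (sgE i w) => ->; rewrite ?normrN normr1. Qed.

Let H2 i : L1 P (fun w => H i w ^+ 2) /\ Ex P (fun w => H i w ^+ 2) = 1.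
Proof. by apply: L1_ge0 => [||]; [exact: mHX|move=> w; exact: sqr_ge0|exact: eta_var]. Qed.

Let iH i : L1 P (H i). Proof. exact: L1_of_sqr (mH i) (H2 i).1. Qed.

Let H1 i : Ex P (H i) = 0.
Proof. by apply: EFin_inj; rewrite -expectationE//; exact: eta_mean. Qed.

Let e2E i : {ae P, forall w, H i w ^+ 2 = e i w ^+ 2}.
Proof. by apply: filterS (eE i) => w ->; rewrite exprMn sg2 mul1r. Qed.

Let ie2 i : L1 P (fun w => e i w ^+ 2).
Proof. by apply: (L1_ae _ (e2E i) (H2 i).1); exact: measurable_funX. Qed.

Let Ee2 i : Ex P (fun w => e i w ^+ 2) = 1.
Proof.
by rewrite -(H2 i).2; apply/esym/Ex_ae => //; exact: measurable_funX.
Qed.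

Let ie i : L1 P (e i). Proof. exact: L1_of_sqr (me i) (ie2 i). Qed.

(** The innovation H j has mean zero and is independent of the past. *)
Let orth_past j (Z : T -> R) : past_measurable y j.+1 Z -> L1 P Z ->
  Ex P (fun w => H j w * Z w) = 0.
Proof.
move=> pZ iZ; have ij := past_indep (@eta_past j.+1 isT) pZ.
by have [_ ->] := indep_mul (iH j) iZ ij; rewrite H1 mul0r.
Qed.

Let L1_sg i Z : measurable_fun setT Z -> L1 P Z -> L1 P (fun w => Z w * sg i w).
Proof.
move=> mZ iZ; apply: (L1_dom _ (L1_abs iZ)); first exact: measurable_funM.
by move=> w; rewrite normrM abs_sg mulr1.
Qed.

Let Ee i : Ex P (e i) = 0.
Proof.
rewrite -(@orth_past i (sg i)) //; last first.
  by apply: (@L1_bounded _ _ _ _ 1) => // w; rewrite abs_sg.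
apply: Ex_ae => //; first exact: measurable_funM.
by apply: filterS (eE i) => w ->; rewrite mulrC.
Qed.

Let e_orth i j : (i < j)%N -> Ex P (fun w => e i w * e j w) = 0.
Proof.
move=> ij; rewrite -(@orth_past j (fun w => e i w * sg j w)).
- apply: Ex_ae; first exact: measurable_funM.
    by apply: measurable_funM => //; exact: measurable_funM.
  by apply: filterS (eE j) => w ->; ring.
- by apply: measurable_funM; [exact: (past_mono _ (@e_past i))|exact: sg_past].
- exact: L1_sg.
Qed.

Let H_indep i j : (i < j)%N -> indep P (H i) (H j).
Proof.
move=> ij; apply: (mutually_indep2 eta_iid.1 (i := i) (j := j)).
by rewrite ltn_eqF.
Qed.

Let H_law i (B : set R) : measurable B -> P (H i @^-1` B) = P (H 0%N @^-1` B).
Proof. exact: eta_iid.2. Qed.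

Let slln_H (g : R -> R) : measurable_fun setT g -> (forall x, 0 <= g x) ->
  (forall i, L1 P (g \o H i)) ->
  {ae P, forall w, (\sum_(i < m) g (H i w)) / m%:R @[m --> \oo] --> Ex P (g \o H 0%N)}.
Proof.
move=> mg g0 ig; apply: (@etemadi_slln _ _ _ P (fun i => g \o H i)) => //.
- by move=> i w; exact: g0.
- by move=> i j ij; apply: indep_comp => //; exact: H_indep.
- move=> h i mh h0; apply: (@Ex_same_law _ _ _ P (H i) (H 0%N) (h \o g)) => //.
  + exact: (measurableT_comp mh mg).
  + exact: H_law.
  + by move=> x; exact: h0.
Qed.

Let ebar n w := n%:R^-1 * \sum_(i < n) e i w.

Let ebar_cvg : {ae P, forall w, ebar n w @[n --> \oo] --> 0}.
Proof.
have abs_cvg := @slln_H (@Num.norm _ R) (@normr_measurable R setT) (@normr_ge0 _ R) (fun i => L1_abs (iH i)).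
have := @orthogonal_slln _ _ _ P e me ie2 Ee2 e_orth (Ex P (Num.norm \o H 0%N)).
move=> /(_ _ _) h; apply: filterS (h _ _) => [w||].
- rewrite /ebar; apply: cvg_trans; apply: near_eq_cvg; apply: nearW => n.
  by rewrite mulrC.
- by apply: Ex_ge0 => w; exact: normr_ge0.
- apply: filterS2 abs_cvg (ae_foralln eE) => w + ew.
  have -> // : (fun m => (\sum_(i < m) `|e i w|) / m%:R) =
      (fun m => (\sum_(i < m) `|H i w|) / m%:R).
  apply/funext => m; congr (_ / _); apply: eq_bigr => i _.
  by rewrite ew normrM abs_sg mul1r.
Qed.

Let e2_cvg : {ae P, forall w, n%:R^-1 * \sum_(i < n) e i w ^+ 2 @[n --> \oo] --> (1 : R)}.
Proof.
have sqr_cvg := @slln_H (fun x => x ^+ 2) (@exprn_measurable R setT 2) (@sqr_ge0 R) (fun i => (H2 i).1).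
apply: filterS2 sqr_cvg (ae_foralln e2E) => w + ew.
rewrite (_ : Ex P _ = 1); last exact: (H2 0%N).2.
have -> // : (fun n => n%:R^-1 * \sum_(i < n) e i w ^+ 2) =
    (fun m => (\sum_(i < m) H i w ^+ 2) / m%:R).
apply/funext => m; rewrite mulrC; congr (_ * _).
by apply: eq_bigr => i _; exact/esym/ew.
Qed.

Let path (w : T) (t : nat) : R := y t w.

Let phi_hatE n w : (0 < n)%N -> phi_hat (path w) n = phi0 + s0 * ebar n w.
Proof.
move=> n0; have n0R : n%:R != 0 :> R by rewrite pnatr_eq0 -lt0n.
rewrite /phi_hat big_add1 /= big_mkord /ebar mulrCA.
rewrite (eq_bigr (fun i : 'I_n => phi0 + s0 * e i w)); last first.
  move=> i _; rewrite /e /path /= (mulrC s0) divfK ?gt_eqF//. by rewrite [RHS]addrC subrK.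
by rewrite big_split /= sumr_const card_ord -mulr_sumr -(mulr_natl phi0); field.
Qed.

Let alpha_hatE' n w : (0 < n)%N -> (forall t, y t w != 0) ->
  alpha_hat (path w) n = alpha0 * (n%:R^-1 * \sum_(i < n) e i w ^+ 2 - ebar n w ^+ 2).
Proof.
move=> n0 yw; have n0R : n%:R != 0 :> R by rewrite pnatr_eq0 -lt0n.
rewrite alpha_hatE// big_add1 /= big_mkord phi_hatE//.
rewrite (eq_bigr (fun i : 'I_n => alpha0 * e i w ^+ 2 -
    2 * alpha0 * ebar n w * e i w + alpha0 * ebar n w ^+ 2)); last first.
  move=> i _; have -> : path w i.+1 / path w i.+1.-1 = phi0 + s0 * e i w.
    by rewrite /e /path /= (mulrC s0) divfK ?gt_eqF// [RHS]addrC subrK.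
  by rewrite -s0_sqr; ring.
rewrite big_split sumrB /= sumr_const card_ord -!mulr_sumr.
rewrite -(mulr_natl (alpha0 * _)).
have -> : \sum_(i < n) e i w = n%:R * ebar n w by rewrite /ebar mulrA mulfV// mul1r.
by field.
Qed.

Let mebar n : measurable_fun setT (ebar n).
Proof. by apply: measurable_funM => //; exact: measurable_sum. Qed.

Let iebar n : L1 P (ebar n).
Proof. by apply: L1Z; exact: L1_sum. Qed.

Let iebar2 n : L1 P (fun w => ebar n w ^+ 2) /\
  Ex P (fun w => ebar n w ^+ 2) = n%:R^-1.
Proof.
have iS := L1_sqr_sum (P := P) n me ie2.
have -> : (fun w => ebar n w ^+ 2) = (fun w => n%:R^-1 ^+ 2 * (\sum_(i < n) e i w) ^+ 2).
  by apply/funext => w; rewrite exprMn.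
split; first exact: L1Z.
rewrite ExZ// Ex_sqr_sum// (eq_bigr (fun=> 1)); last by move=> i _; exact: Ee2.
rewrite sumr_const card_ord; case: n {iS} => [|n]; first by rewrite mulr0n mulr0 invr0.
by rewrite expr2 -mulrA mulVf ?mulr1// pnatr_eq0.
Qed.

Let malpha n : measurable_fun setT (fun w => alpha_hat (path w) n).
Proof.
have my' t : measurable_fun setT (fun w => path w t) by exact: my.
have mphi : measurable_fun setT (fun w => phi_hat (path w) n).
  apply: measurable_funM => //; apply: measurable_sum => t.
  by apply: measurable_funM => //; exact: measurable_funV.
apply: measurable_funM => //; apply: measurable_sum => t.
apply: measurable_funM; last by apply: measurable_funV; exact: measurable_funX.
by apply: measurable_funX; apply: measurable_funB => //; exact: measurable_funM.
Qed.

Lemma qmle_of_double_autoregression :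
  {ae P, forall w, forall (n : nat) (th : R * R), (1 <= n)%N ->
     is_qmle (path w) n th <->
     th = theta_hat (path w) n /\ 0 < alpha_hat (path w) n}.
Proof. by apply: filterS y_ae => w yw n th n0; exact: qmle_explicit. Qed.

Lemma phi_hat_unbiased : unbiased P (fun n w => phi_hat (path w) n) phi0.
Proof.
move=> n n0.
have -> : (fun w => phi_hat (path w) n) = fun w => phi0 + s0 * ebar n w.
  by apply/funext => w; exact: phi_hatE.
have i1 := L1_cst P phi0; have i2 := L1Z s0 (iebar n).
rewrite expectationE; last exact: L1D.
rewrite ExD// Ex_cst ExZ// /ebar ExZ; last exact: L1_sum.
by rewrite Ex_sum// big1 ?mulr0 ?addr0// => i _; exact: Ee.
Qed.

Let ialpha n : (0 < n)%N -> L1 P (fun w => alpha_hat (path w) n) /\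
  Ex P (fun w => alpha_hat (path w) n) = alpha0 * (1 - n%:R^-1).
Proof.
move=> n0; pose W w := alpha0 * (n%:R^-1 * \sum_(i < n) e i w ^+ 2 - ebar n w ^+ 2).
have aE : {ae P, forall w, W w = alpha_hat (path w) n}.
  by apply: filterS y_ae => w yw; rewrite alpha_hatE'.
have iS : L1 P (fun w => \sum_(i < n) e i w ^+ 2) by exact: (L1_sum _ (fun i : 'I_n => ie2 i)).
have i1 := L1Z n%:R^-1 iS; have i2 := L1B i1 (iebar2 n).1.
have iW : L1 P W by exact: L1Z.
split; first exact: (L1_ae (malpha n) aE iW).
rewrite -(Ex_ae (L1_measurable iW) (malpha n) aE) ExZ// ExB ?(iebar2 n).1//.
rewrite (iebar2 n).2 ExZ// (Ex_sum _ (fun i : 'I_n => ie2 i)) (eq_bigr (fun=> 1)); last by move=> i _; exact: Ee2.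
by rewrite sumr_const card_ord mulVf// pnatr_eq0 -lt0n.
Qed.

Lemma alpha_hat_asymptotically_unbiased :
  asymptotically_unbiased P (fun n w => alpha_hat (path w) n) alpha0.
Proof.
rewrite /asymptotically_unbiased.
apply: (@cvg_trans _ ((alpha0 * (1 - n%:R^-1))%:E @[n --> \oo])).
  apply: near_eq_cvg; near=> n.
  have n0 : (0 < n)%N by near: n; exact: nbhs_infty_gt.
  by have [i1 <-] := ialpha n0; rewrite expectationE.
apply: cvg_EFin; first exact: nearW.
rewrite -[X in _ --> X]mulr1; apply: cvgMr; rewrite -[X in _ --> X]subr0.
by apply: cvgB; [exact: cvg_cst|exact: cvg_invn].
Unshelve. all: by end_near. Qed.

Lemma theta_hat_strongly_consistent :
  {ae P, forall w, theta_hat (path w) n @[n --> \oo] --> (phi0, alpha0)}.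
Proof.
apply: filterS3 y_ae ebar_cvg e2_cvg => w yw h1 h2.
have l1 : phi0 + s0 * ebar n w @[n --> \oo] --> phi0.
  rewrite -[X in _ --> X]addr0 -(mulr0 s0); apply: cvgD; first exact: cvg_cst.
  exact: cvgMr.
have l2 : alpha0 * (n%:R^-1 * \sum_(i < n) e i w ^+ 2 - ebar n w ^+ 2)
    @[n --> \oo] --> alpha0.
  rewrite -[X in _ --> X]mulr1; apply: cvgMr; rewrite -[X in _ --> X]subr0.
  by apply: cvgB => //; rewrite -(mulr0 (0 : R)); exact: cvgM.
apply: (@cvg_pair _ _ _ \oo (nbhs phi0) (nbhs alpha0) _ _ _
  (fun n => phi_hat (path w) n) (fun n => alpha_hat (path w) n)).
  apply: cvg_trans l1; apply: near_eq_cvg; near=> n.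
  by rewrite phi_hatE//; near: n; exact: nbhs_infty_gt.
apply: cvg_trans l2; apply: near_eq_cvg; near=> n.
by rewrite alpha_hatE'//; near: n; exact: nbhs_infty_gt.
Unshelve. all: by end_near. Qed.

Section asymptotic_normality.
Variable kappa4 : R.
Hypothesis eta_skew : forall t : nat, (1 <= t)%N ->
  ('E_P[fun w => (eta t w ^+ 3)%R] = 0%:E)%E.
Hypothesis eta_kurt : forall t : nat, (1 <= t)%N ->
  ('E_P[fun w => (eta t w ^+ 4)%R] = kappa4%:E)%E.

Let H4 i : L1 P (fun w => H i w ^+ 4) /\ Ex P (fun w => H i w ^+ 4) = kappa4.
Proof.
by apply: L1_ge0 => [||]; [exact: mHX|move=> w; exact: exprn_even_ge0|exact: eta_kurt].
Qed.

Let G i w := H i w ^+ 2 - 1.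
Let Y i w := e i w ^+ 2 - 1.

Let mG i : measurable_fun setT (G i).
Proof. by apply: measurable_funB => //; exact: mHX. Qed.

Let mY i : measurable_fun setT (Y i).
Proof. by apply: measurable_funB => //; exact: measurable_funX. Qed.

Let GY i : {ae P, forall w, G i w = Y i w}.
Proof. by apply: filterS (e2E i) => w ew; rewrite /G /Y ew. Qed.

Let iG i : L1 P (G i) /\ Ex P (G i) = 0.
Proof.
have i1 := L1_cst P (1 : R); split; first by apply: L1B => //; exact: (H2 i).1.
by rewrite ExB ?(H2 i).1// (H2 i).2 Ex_cst subrr.
Qed.

Let iG2 i : L1 P (fun w => G i w ^+ 2) /\ Ex P (fun w => G i w ^+ 2) = kappa4 - 1.
Proof.
have -> : (fun w => G i w ^+ 2) = fun w => H i w ^+ 4 - (2 * H i w ^+ 2 - 1).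
  by apply/funext => w; rewrite /G; ring.
have i1 := L1_cst P (1 : R); have i2 := L1Z 2 (H2 i).1; have i3 := L1B i2 i1.
split; first exact: L1B (H4 i).1 i3.
rewrite ExB ?(H4 i).1// (H4 i).2 ExB// ExZ ?(H2 i).1// (H2 i).2 Ex_cst; ring.
Qed.

Let kappa4_ge1 : 0 <= kappa4 - 1.
Proof. by rewrite -(iG2 0%N).2; apply: Ex_ge0 => w; exact: sqr_ge0. Qed.

Let iY2 i : L1 P (fun w => Y i w ^+ 2) /\ Ex P (fun w => Y i w ^+ 2) = kappa4 - 1.
Proof.
have m1 : measurable_fun setT (fun w => Y i w ^+ 2) by exact: measurable_funX.
have a1 : {ae P, forall w, G i w ^+ 2 = Y i w ^+ 2} by apply: filterS (GY i) => w ->.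
split; first exact: (L1_ae m1 a1 (iG2 i).1).
by rewrite -(iG2 i).2; apply/esym/Ex_ae => //; exact: measurable_funX.
Qed.

(** The squares of the innovations are pairwise independent, whereas
    the e i themselves need not be. *)
Let Y_orth i j : (i < j)%N -> Ex P (fun w => Y i w * Y j w) = 0.
Proof.
move=> ij; pose g (x : R) := x ^+ 2 - 1.
have mg : measurable_fun setT g by apply: measurable_funB => //; exact: measurable_funX.
have gij : indep P (G i) (G j) by exact: (indep_comp mg mg (H_indep ij)).
have [_ E0] := indep_mul (iG i).1 (iG j).1 gij.
rewrite -[RHS](mul0r (Ex P (G j))) -(iG i).2 -E0; apply/esym/Ex_ae.
- exact: measurable_funM.
- exact: measurable_funM.
- by apply: filterS2 (GY i) (GY j) => w -> ->.
Qed.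

Let S n w := rsqrt R n * \sum_(i < n) e i w.
Let Q n w := rsqrt R n * \sum_(i < n) Y i w.
Let D n w := Num.sqrt n%:R * ebar n w ^+ 2.

Let sqrtn_div n : Num.sqrt n%:R * n%:R^-1 = rsqrt R n.
Proof.
case: n => [|n]; first by rewrite /rsqrt sqrtr0 invr0 mul0r.
by rewrite -rsqrt_sqr expr2 mulrA /rsqrt mulfV ?mul1r// sqrtr_eq0 -ltNge.
Qed.

Let U n w := Num.sqrt n%:R * (phi_hat (path w) n - phi0).
Let V n w := Num.sqrt n%:R * (alpha_hat (path w) n - alpha0).

Let UE n w : U n w = s0 * S n w.
Proof.
rewrite /U /S -sqrtn_div; case: n => [|n]; first by rewrite sqrtr0 !mul0r mulr0.
by rewrite phi_hatE// /ebar; ring.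
Qed.

Let W n w := alpha0 * (Q n w - D n w).

Let VE n : {ae P, forall w, W n w = V n w}.
Proof.
apply: filterS y_ae => w yw; rewrite /W /V /Q /D -sqrtn_div.
case: n => [|n]; first by rewrite sqrtr0 !mul0r subrr mulr0.
rewrite alpha_hatE'// /Y sumrB sumr_const card_ord.
have n0 : n.+1%:R != 0 :> R by rewrite pnatr_eq0.
by field.
Qed.

Let iD n : L1 P (D n) /\ Ex P (D n) = rsqrt R n.
Proof.
split; first exact: L1Z (iebar2 n).1.
by rewrite /D ExZ ?(iebar2 n).1// (iebar2 n).2 sqrtn_div.
Qed.

Let iS n : L1 P (S n). Proof. by apply: L1Z; exact: (L1_sum _ (fun i : 'I_n => ie i)). Qed.

Let iQ n : L1 P (Q n).
Proof.
apply: L1Z; apply: (L1_sum _ _) => i; exact: L1_of_sqr (mY i) (iY2 i).1.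
Qed.

Let iW n : L1 P (W n). Proof. by apply: L1Z; apply: L1B; [exact: iQ|exact: (iD n).1]. Qed.

Let iU n : L1 P (U n).
Proof.
by rewrite (_ : U n = fun w => s0 * S n w); [exact: L1Z|apply/funext => w; exact: UE].
Qed.

Let mV n : measurable_fun setT (V n).
Proof. by apply: measurable_funM => //; apply: measurable_funB => //; exact: malpha. Qed.

Let iV n : L1 P (V n). Proof. exact: (L1_ae (mV n) (VE n) (iW n)). Qed.

(** |x| <= 1 + x ^ 2, and orthogonality. *)
Let normalized_bound (Z : nat -> T -> R) (q : R) n : 0 <= q ->
  (forall i, measurable_fun setT (Z i)) ->
  (forall i, L1 P (fun w => Z i w ^+ 2)) -> (forall i, Ex P (fun w => Z i w ^+ 2) = q) ->
  (forall i j, (i < j)%N -> Ex P (fun w => Z i w * Z j w) = 0) ->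
  Ex P (fun w => `|rsqrt R n * \sum_(i < n) Z i w|) <= 1 + q.
Proof.
move=> q0 mZ iZ Zq orth; have iZ2 := L1_sqr_sum (P := P) n mZ iZ.
have iZ1 : L1 P (fun w => \sum_(i < n) Z i w) by apply: (L1_of_sqr _ iZ2); exact: measurable_sum.
have i3 : L1 P (fun w => 1 + n%:R^-1 * (\sum_(i < n) Z i w) ^+ 2).
  by apply: L1D; [exact: L1_cst|exact: L1Z].
apply: (@le_trans _ _ (Ex P (fun w => 1 + n%:R^-1 * (\sum_(i < n) Z i w) ^+ 2))).
  apply: Ex_le => [||w]; [exact/L1_abs/L1Z|by []|].
  rewrite -rsqrt_sqr -exprMn -(real_normK (num_real (_ * _))).
  have := sqr_ge0 (`|rsqrt R n * \sum_(i < n) Z i w| - 2^-1); nra.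
rewrite ExD ?Ex_cst; [|exact: L1_cst|exact: L1Z].
rewrite lerD2l ExZ// Ex_sqr_sum// (eq_bigr (fun=> q)); last by move=> i _; exact: Zq.
rewrite sumr_const card_ord; case: n {iZ2 iZ1 i3} => [|n]; first by rewrite mulr0n mulr0.
by rewrite -(mulr_natl q) mulrA mulVf ?mul1r// pnatr_eq0.
Qed.

Let rsqrt_le1 n : rsqrt R n <= 1.
Proof.
rewrite -(ler_pXn2r (n := 2)) ?nnegrE ?rsqrt_ge0// rsqrt_sqr expr1n.
by case: n => [|n]; [rewrite invr0|rewrite invf_le1 ?ltr0n// ler1n].
Qed.

Let tight n : Ex P (fun w => `|U n w|) + Ex P (fun w => `|V n w|) <=
  s0 * (1 + 1) + alpha0 * (1 + (kappa4 - 1) + 1).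
Proof.
apply: lerD.
  rewrite (_ : (fun=> _) = fun w => s0 * `|S n w|); last first.
    by apply/funext => w; rewrite UE normrM gtr0_norm.
  rewrite ExZ ?ler_pM2l//; last exact: L1_abs.
  exact: normalized_bound me ie2 Ee2 e_orth.
have mW := L1_measurable (iW n).
rewrite -(Ex_ae (X := fun w => `|W n w|)); last 3 first.
- exact: measurableT_comp.
- exact: measurableT_comp.
- by apply: filterS (VE n) => w ->.
have i1 := L1_abs (iQ n).
apply: (@le_trans _ _ (Ex P (fun w => alpha0 * (`|Q n w| + D n w)))).
  apply: Ex_le; [exact: L1_abs|by apply: L1Z; apply: L1D; [exact: i1|exact: (iD n).1]|].
  move=> w; rewrite /W normrM gtr0_norm// ler_pM2l//.
  rewrite (le_trans (ler_normB _ _))// lerD2l ger0_norm//.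
  by rewrite mulr_ge0 ?sqr_ge0// sqrtr_ge0.
rewrite ExZ; last by apply: L1D; [exact: i1|exact: (iD n).1].
rewrite ler_pM2l// ExD ?(iD n).1// (iD n).2; apply: lerD.
  exact: normalized_bound kappa4_ge1 mY (fun i => (iY2 i).1) (fun i => (iY2 i).2) Y_orth.
exact: rsqrt_le1.
Qed.

Let s1 := s0.
Let s2 := Num.sqrt (kappa4 - 1) * alpha0.

(** Up to the term D, whose expectation is of order n ^ (-1/2), the normalized
    estimator is a linear image of the sums covered by [martingale_cf]. *)
Lemma asymptotic_normality : exists2 nu : probability (R * R)%type R,
  is_normal2 nu (0, 0)
    (diag_mx (\row_(i < 2) [:: alpha0; (kappa4 - 1) * alpha0 ^+ 2]`_i)) &
  cvg_in_law P (fun n w =>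
     (Num.sqrt n%:R * (phi_hat (path w) n - phi0),
      Num.sqrt n%:R * (alpha_hat (path w) n - alpha0))) nu.
Proof.
have s2E : s2 ^+ 2 = (kappa4 - 1) * alpha0 ^+ 2 by rewrite exprMn sqr_sqrtr.
exists (normal_plane s1 s2).
  by rewrite -s2E -s0_sqr; exact: normal_plane_normal.
have [n1 n2] := normal_plane_L1 s1 s2.
apply: (cf_cvg_in_law iU iV tight n1 n2) => u v c.
rewrite normal_plane_cf.
pose A n w := cos (c + rsqrt R n * \sum_(i < n) (u * s0 * e i w + v * alpha0 * Y i w)).
have -> : (u * s1) ^+ 2 + (v * s2) ^+ 2 = (u * s0) ^+ 2 + (v * alpha0) ^+ 2 * (kappa4 - 1).
  by rewrite (exprMn 2 v s2) s2E /s1; ring.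
have Acvg : Ex P (A n) @[n --> \oo] -->
    expR (- (((u * s0) ^+ 2 + (v * alpha0) ^+ 2 * (kappa4 - 1)) / 2)) * cos c.
  apply: (@martingale_cf _ _ _ P y H e sg kappa4) => //.
  - by move=> i; exact: eta_past.
  - move=> g i mg g1.
    by apply: (@Ex_same_law_bounded _ _ _ P (H i) (H 0%N) g) => //; exact: H_law.
  - exact: (H4 0%N).1.
  - exact: (H2 0%N).2.
  - by have := eta_skew (t := 1%N) isT; rewrite unlock /Ex /Rintegral => ->.
  - exact: (H4 0%N).2.
have mA n : measurable_fun setT (fun w => c + rsqrt R n *
    \sum_(i < n) (u * s0 * e i w + v * alpha0 * Y i w)).
  apply: measurable_funD => //; apply: measurable_funM => //; apply: measurable_sum => i.
  by apply: measurable_funD; apply: measurable_funM.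
have mUV n : measurable_fun setT (fun w => c + (u * U n w + v * V n w)).
  apply: measurable_funD => //; apply: measurable_funD; apply: measurable_funM => //.
  exact: L1_measurable (iU n).
have iA n : L1 P (A n) by exact: L1_cos.
have iC n : L1 P (fun w => cos (c + (u * U n w + v * V n w))) by exact: L1_cos.
suff diff : Ex P (fun w => cos (c + (u * U n w + v * V n w))) - Ex P (A n)
    @[n --> \oo] --> 0.
  rewrite -[X in _ --> X]add0r; apply: cvg_trans (cvgD diff Acvg).
  by apply: near_eq_cvg; apply: nearW => n /=; rewrite subrK.
apply/norm_cvg0P.
apply: (@squeeze_cvgr _ _ _ _ (cst 0) (fun n => `|v * alpha0| * rsqrt R n)).
- apply: nearW => n; rewrite normr_ge0 /= -(iD n).2 -ExZ; last exact: (iD n).1.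
  rewrite -ExB//.
  have mW' : measurable_fun setT (fun w => cos (c + (u * U n w + v * W n w))).
    apply: measurable_cos_comp; apply: measurable_funD => //; apply: measurable_funD.
      by apply: measurable_funM => //; exact: L1_measurable (iU n).
    by apply: measurable_funM => //; exact: L1_measurable (iW n).
  rewrite (Ex_ae (Y := fun w => cos (c + (u * U n w + v * W n w)) - A n w)); last 3 first.
  + exact: L1_measurable (L1B (iC n) (iA n)).
  + by apply: measurable_funB => //; exact: L1_measurable (iA n).
  + by apply: filterS (VE n) => w ->.
  apply: Ex_abs_le.
  + by apply: L1B => //; apply: (@L1_bounded _ _ _ _ 1) => // w; exact: cos_max.
  + exact: L1Z (iD n).1.
  + move=> w; rewrite /A; apply: (le_trans (cos_lip _ _)).
    rewrite UE /W big_split /= -!mulr_sumr.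
    rewrite (_ : _ - _ = - (v * alpha0 * D n w)); last by rewrite /S /Q; ring.
    rewrite normrN normrM ler_wpM2l// ger0_norm//.
    by rewrite mulr_ge0 ?sqr_ge0// sqrtr_ge0.
- exact: cvg_cst.
- by rewrite -(mulr0 `|v * alpha0|); apply: cvgMr; exact: cvg_rsqrt.
Qed.

End asymptotic_normality.

End double_autoregression.

Theorem theorem4p1 (d : measure_display) (T : measurableType d)
    (R : realType) (P : probability T R)
    (phi0 alpha0 : R) (y eta : nat -> {RV P >-> R})
    (alpha0_gt0 : 0 < alpha0)
    (model : forall (t : nat) (w : T), (1 <= t)%N ->
       y t w = phi0 * y t.-1 w + eta t w * Num.sqrt (alpha0 * y t.-1 w ^+ 2))
    (* the innovations are indexed by t >= 1; eta 0 is irrelevant *)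
    (eta_iid : iid P (fun t : nat => eta t.+1))
    (eta_past : forall t : nat, (1 <= t)%N ->
       independent_of_past P (eta t) y t)
    (* almost surely, the quotients and logarithms below are meaningful *)
    (y_neq0 : forall t : nat, {ae P, forall w : T, y t w != 0})
    (eta_mean : forall t : nat, (1 <= t)%N -> ('E_P[eta t] = 0%:E)%E)
    (eta_var : forall t : nat, (1 <= t)%N ->
       ('E_P[fun w => (eta t w ^+ 2)%R] = 1%:E)%E) :
  let path := fun (w : T) (t : nat) => y t w in
  [/\ (* the explicit expression is that of the QMLE; there is no maximizer
         over Theta when alpha_hat vanishes, as always happens for n = 1 *)
      {ae P, forall w : T, forall (n : nat) (th : R * R), (1 <= n)%N ->
         is_qmle (path w) n th <->
         th = theta_hat (path w) n /\ 0 < alpha_hat (path w) n},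
      unbiased P (fun n w => phi_hat (path w) n) phi0 /\
      asymptotically_unbiased P (fun n w => alpha_hat (path w) n) alpha0,
      {ae P, forall w : T,
         theta_hat (path w) n @[n --> \oo] --> (phi0, alpha0)} &
      forall kappa4 : R,
        (forall t : nat, (1 <= t)%N -> ('E_P[fun w => (eta t w ^+ 3)%R] = 0%:E)%E) ->
        (forall t : nat, (1 <= t)%N ->
           ('E_P[fun w => (eta t w ^+ 4)%R] = kappa4%:E)%E) ->
        exists2 nu : probability (R * R)%type R,
          is_normal2 nu (0, 0)
            (diag_mx (\row_(i < 2)
               [:: alpha0; (kappa4 - 1) * alpha0 ^+ 2]`_i)) &
          cvg_in_law P
            (fun n w =>
               (Num.sqrt n%:R * (phi_hat (path w) n - phi0),
                Num.sqrt n%:R * (alpha_hat (path w) n - alpha0)))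
            nu].
Proof.
split.
- exact: (qmle_of_double_autoregression y_neq0).
- split; first exact: (phi_hat_unbiased alpha0_gt0 model eta_past y_neq0 eta_mean eta_var).
  exact: (alpha_hat_asymptotically_unbiased alpha0_gt0 model eta_past y_neq0 eta_mean eta_var).
- exact: (theta_hat_strongly_consistent alpha0_gt0 model eta_iid eta_past y_neq0
    eta_mean eta_var).
- move=> kappa4 eta_skew eta_kurt.
  exact: (asymptotic_normality alpha0_gt0 model eta_iid eta_past y_neq0 eta_mean
    eta_var eta_skew eta_kurt).
Qed.
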